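(* Let $(\overline{M},\omega)$ be a compact complex surface with a Gauduchon metric, $D=\sum_{i=1}^mD_i$ a simple normal crossing divisor, $M=\overline{M}\setminus D$, and $\mathcal{E}$ a holomorphic vector bundle over $\overline{M}$ with a parabolic structure with respect to $D$. Let $H_{par}$ be the Hermitian metric on $\mathcal{E}|_M$ constructed in the context. Then $|\Lambda_\omega F_{H_{par}}|_{H_{par}}$ is bounded on $M$.
   Context: **Setting.** A Gauduchon metric on a complex surface is a Hermitian metric with fundamental form $\omega$ satisfying $\partial\bar\partial\omega=0$. $r=\operatorname{rank}\mathcal{E}$. $F_H$ is the curvature of the Chern connection of a Hermitian metric $H$, and $\Lambda_\omega$ is contraction with $\omega$. **Parabolic structure.** It consists of, for each $i$, a flag of holomorphic subbundles $\mathcal{E}|_{D_i}=\mathcal{F}^i_1\supsetneq\mathcal{F}^i_2\supsetneq\cdots\supsetneq\mathcal{F}^i_{m_i}\supsetneq 0$ and weights $0\le\alpha^i_1<\cdots<\alpha^i_{m_i}<1$, where $\alpha^i_j$ is attached to $\mathcal{F}^i_j$. Compatibility is required: for all $i_1,i_2$, the collection $\{\mathcal{F}^{i_k}_j|_{D_{i_1}\cap D_{i_2}}: k\in\{1,2\},\,1\le j\le m_{i_k}\}$ is a flag (totally ordered by inclusion) refining each of the flags $\{\mathcal{F}^{i_k}_j|_{D_{i_1}\cap D_{i_2}}\}_j$, $k=1,2$. **Construction of $H_{par}$.** Let $\sigma_i$ be the canonical section of $\mathcal{O}(D_i)$ and $\|\sigma_i\|$ its norm for a fixed smooth Hermitian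 metric on $\mathcal{O}(D_i)$. Let $U_i$ be a sufficiently small tubular neighborhood of $D_i$, $U=\bigcup_iU_i$, such that for $i\ne j$ the set $U_i\cap U_j$ is a disjoint union of small coordinate neighborhoods of the points of $D_i\cap D_j$ with $D_i=\{z_1=0\}$, $D_j=\{z_2=0\}$, on which $\mathcal{E}$ is trivial. (a) On each $U_i\cap U_j$ choose a flag of trivial holomorphic subbundles $\mathcal{E}=\mathcal{F}^{ij}_1\supset\cdots\supset\mathcal{F}^{ij}_r\supset0$ whose restriction to $D_i\cap U_j$ refines the flag $\{\mathcal{F}^i_s\}$ and whose restriction to $D_j\cap U_i$ refines $\{\mathcal{F}^j_s\}$, and a holomorphic frame $e^{ij}_1,\dots,e^{ij}_r$ with $\mathcal{F}^{ij}_k=\operatorname{Span}\{e^{ij}_k,\dots,e^{ij}_r\}$. Let $\alpha^i_{(k)}$ be the weight $\alpha^i_s$ with $s$ maximal such that $e^{ij}_k|_{D_i}\in\mathcal{F}^i_s$; define $\alpha^j_{(k)}$ similarly. (b) Choose a smooth Hermitian metric $H_2$ on $\mathcal{E}\to\overline{M}$ with $H_2(e^{ij}_k,e^{ij}_l)=\delta_{kl}$ on each $U_i\cap U_j$. Each $U_i$ carries a smooth foliation by holomorphic discs $B_x$ ($x\in D_i$) with $B_x\cap D_i=\{x\}$ and $B_x$ $\omega$-orthogonal to $D_i$ at $x$; the foliation is such that in local coordinates with $D_i=\{z_1=0\}$ the leaf through $a\in D_i$ is a graph $z_2=f_a(z_1)$ with $f_a$ holomorphic in $z_1$ and smooth in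 $a$. Let $H_1$ be the smooth Hermitian metric on $\mathcal{E}|_U$ which on each leaf solves the Dirichlet problem $F_{H_1|_{B_x}}=0$, $H_1|_{\partial B_x}=H_2$; on $U_i\cap U_j$ it satisfies $H_1(e^{ij}_k,e^{ij}_l)=\delta_{kl}$. (c) Extend each $\mathcal{F}^i_j$ to a smooth subbundle $F^i_j$ of $\mathcal{E}|_{U_i}$ by parallel transport along the leaves $B_x$ with respect to the Chern connection of $H_1$; on $U_i\cap U_j$ one has $F^i_s=\operatorname{Span}\{e^{ij}_k:\alpha^i_{(k)}\ge\alpha^i_s\}$. Let $Q^i_j$ be the $H_1$-orthogonal complement of $F^i_{j+1}$ in $F^i_j$ (with $F^i_{m_i+1}=0$), so $\mathcal{E}|_{U_i}=\bigoplus_jQ^i_j$ orthogonally. (d) $H_{par}$ is a smooth Hermitian metric on $\mathcal{E}|_M$ such that on each $U_i\cap U_j\setminus D$ ($i\neq j$), $H_{par}(e^{ij}_k,e^{ij}_l)=\delta_{kl}\,c_k\,\|\sigma_i\|^{2\alpha^i_{(k)}}\|\sigma_j\|^{2\alpha^j_{(k)}}$ with $c_k$ smooth and positive on a neighborhood of $\overline{U_i\cap U_j}$ (coming from $\|\sigma_t\|$, $t\ne i,j$), and on each $U_i\setminus D$, $H_{par}=\bigoplus_j\|\sigma_i\|^{2\alpha^i_j}G^i_j$ with $G^i_j$ a Hermitian metric on $Q^i_j$, smooth on $U_i\setminus\bigcup_{l\ne i}D_l$ (in particular smooth across $D_i\setminus\bigcup_{l\neq i}D_l$), equal to $H_1|_{Q^i_j}$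 up to the factors involving $\|\sigma_t\|$, $t\ne i$. On $M\setminus U$ it is extended smoothly. *)

(* Defs.v *)
From HB Require Import structures.
From mathcomp Require Export all_boot all_order all_algebra perm.
From mathcomp Require Export all_classical all_reals all_analysis.
From mathcomp Require Export complex.

Set Implicit Arguments.
Unset Strict Implicit.
Unset Printing Implicit Defensive.

Export Order.TTheory GRing.Theory Num.Theory.
Export numFieldNormedType.Exports.

Local Open Scope classical_set_scope.
Local Open Scope ring_scope.
Local Open Scope complex_scope.
Local Open Scope sesquilinear_scope.

(* R[i] with its norm topology; the library only provides it on R[i]^o. *)
HB.instance Definition _ (R : realType) :=
  NormedModule.copy R[i] R[i]^o.

Section Calculus.
Context {R : realType} {V : normedModType R[i]}.
Implicit Types (A : set V) (f : V -> R[i]) (z v w : V).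

Definition line f z v : R -> R[i] := fun t => f (z + t%:C *: v).

(* Differentiability and derivative along the *real* direction v. *)
Definition dir_derivable f z v : Prop :=
  derivable ((@complex.Re R \o line f z v) : R -> R) 0 1 /\
  derivable ((@complex.Im R \o line f z v) : R -> R) 0 1.

Definition dir_deriv v f : V -> R[i] := fun z =>
  derive1 ((@complex.Re R \o line f z v) : R -> R) 0 +i*
  derive1 ((@complex.Im R \o line f z v) : R -> R) 0.

(* Real C^oo smoothness: all iterated directional derivatives exist and are
   continuous.  The set A is open wherever this is used. *)
Definition smooth_on A f : Prop := forall (s : seq V) z, A z ->
  {for z, continuous (foldr dir_deriv f s)} /\
  (forall v, dir_derivable (foldr dir_deriv f s) z v).

(* Wirtinger derivatives: if v is the k-th unit vector of C^n these are
   d/dz_k and d/d\bar z_k. *)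
Definition del v f : V -> R[i] := fun z =>
  (dir_deriv v f z - 'i%C * dir_deriv ('i%C *: v) f z) / 2.

Definition delbar v f : V -> R[i] := fun z =>
  (dir_deriv v f z + 'i%C * dir_deriv ('i%C *: v) f z) / 2.

Definition holo_on A f : Prop :=
  smooth_on A f /\ forall z, A z -> forall v, delbar v f z = 0.

Section Matrices.
Context {p q : nat}.
Implicit Type F : V -> 'M[R[i]]_(p, q).

Definition smooth_mx_on A F : Prop :=
  forall i j, smooth_on A (fun z => F z i j).

Definition holo_mx_on A F : Prop :=
  forall i j, holo_on A (fun z => F z i j).

Definition del_mx v F : V -> 'M[R[i]]_(p, q) :=
  fun z => \matrix_(i, j) del v (fun w => F w i j) z.

Definition delbar_mx v F : V -> 'M[R[i]]_(p, q) :=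
  fun z => \matrix_(i, j) delbar v (fun w => F w i j) z.

End Matrices.

(* G is the Gram matrix G_kl = H(e_k, e_l) of a Hermitian metric in a
   holomorphic frame e = (e_k), written as a column of (row) vectors.  The Chern
   connection is D e = theta e with theta = (del G) G^-1, and its curvature is
   delbar theta; [chern_curv v w G] is the coefficient of dz_v /\ d\bar z_w, the
   sign coming from d\bar z_w /\ dz_v = - dz_v /\ d\bar z_w. *)
Definition chern_conn {r} v (G : V -> 'M[R[i]]_r) : V -> 'M[R[i]]_r :=
  fun z => del_mx v G z *m invmx (G z).

Definition chern_curv {r} v w (G : V -> 'M[R[i]]_r) : V -> 'M[R[i]]_r :=
  fun z => - delbar_mx w (chern_conn v G) z.

End Calculus.

Section LinearAlgebra.
Context {R : realType} {r : nat}.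
Implicit Types (A G H : 'M[R[i]]_r) (u v : 'rV[R[i]]_r).

Definition herm H u v : R[i] := (u *m H *m v^t*) 0 0.

Definition posdef H : Prop :=
  H^t* = H /\ forall u, u != 0 -> 0 < herm H u u.

(* An endomorphism u = s e |-> s A e, written in a frame e with Gram matrix G,
   has adjoint G A^* G^-1; this is the Hilbert-Schmidt norm tr(A A^adj)^(1/2). *)
Definition endo_norm G A : R :=
  Num.sqrt (complex.Re (\tr (A *m (G *m A^t* *m invmx G)))).

Definition span_rows (S : pred 'I_r) A : 'M[R[i]]_r :=
  (\sum_(k | S k) <<row k A>>)%MS.

End LinearAlgebra.

Section Charts.
Context {R : realType} {X : topologicalType}.

Record chart := Chart {
  cdom : set X;
  cmap : X -> 'rV[R[i]]_2;
  cinv : 'rV[R[i]]_2 -> X }.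

Implicit Types (c : chart) (W : set X).

Definition cimg c W : set 'rV[R[i]]_2 := cmap c @` (cdom c `&` W).

Definition is_chart c : Prop :=
  [/\ open (cdom c) /\ open (cimg c setT),
      forall x, cdom c x -> cinv c (cmap c x) = x,
      forall x, cdom c x -> {for x, continuous (cmap c)} &
      forall z, cimg c setT z -> {for z, continuous (cinv c)}].

Definition chart_compat c c' : Prop :=
  holo_mx_on (cimg c (cdom c')) (cmap c' \o cinv c).

Definition is_coord_line c (D : set X) (k : 'I_2) : Prop :=
  forall x, cdom c x -> (D x <-> cmap c x 0 k = 0).

End Charts.
Arguments chart : clear implicits.

Record surface (R : realType) := Surface {
  carrier :> topologicalType;
  atlas : set (chart R carrier);
  surface_hausdorff : hausdorff_space carrier;
  atlas_chart : forall c, atlas c -> is_chart c;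
  atlas_cover : forall x, exists2 c, atlas c & cdom c x;
  atlas_compat : forall c c', atlas c -> atlas c' -> chart_compat c c';
  atlas_max : forall c, is_chart c ->
    (forall c', atlas c' -> chart_compat c c' /\ chart_compat c' c) -> atlas c }.

Notation evec k := (delta_mx 0 k : 'rV_2).

Section Surfaces.
Context {R : realType} (X : surface R).
Implicit Types (W D : set X) (c : chart R X).

Definition smooth_fun W (f : X -> R[i]) : Prop :=
  forall c, atlas c -> smooth_on (cimg c W) (f \o cinv c).

Definition holo_fun W (f : X -> R[i]) : Prop :=
  forall c, atlas c -> holo_on (cimg c W) (f \o cinv c).

Definition smooth_mx {p q} W (F : X -> 'M[R[i]]_(p, q)) : Prop :=
  forall i j, smooth_fun W (fun x => F x i j).

Definition holo_mx {p q} W (F : X -> 'M[R[i]]_(p, q)) : Prop :=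
  forall i j, holo_fun W (fun x => F x i j).

(* entry (a, k) is d z'_k / d z_a *)
Definition jacobian c c' (x : X) : 'M[R[i]]_2 :=
  \matrix_(a, k) del (evec a) (fun z => cmap c' (cinv c z) 0 k) (cmap c x).

(* In the chart c the metric has the fundamental form
   i \sum_(k,l) (gmat c)_kl dz_k /\ d\bar z_l. *)
Record hermitian_metric := HermitianMetric {
  gmat : chart R X -> X -> 'M[R[i]]_2;
  gmat_smooth : forall c, atlas c -> smooth_mx (cdom c) (gmat c);
  gmat_posdef : forall c x, atlas c -> cdom c x -> posdef (gmat c x);
  gmat_change : forall c c' x, atlas c -> atlas c' -> cdom c x -> cdom c' x ->
    gmat c x = jacobian c c' x *m gmat c' x *m (jacobian c c' x)^t* }.

(* The sum is the coefficient of dz_1 /\ d\bar z_1 /\ dz_2 /\ d\bar z_2 in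
   \sum del_a delbar_b g_kl dz_a /\ d\bar z_b /\ dz_k /\ d\bar z_l. *)
Definition gauduchon (g : hermitian_metric) : Prop :=
  forall c x, atlas c -> cdom c x ->
    \sum_(s : 'S_2) \sum_(t : 'S_2) (-1) ^+ s * (-1) ^+ t *
      del (evec (s 0)) (delbar (evec (t 0))
        (fun z => gmat g c (cinv c z) (s 1) (t 1))) (cmap c x) = 0.

(* A smooth curve is irreducible if and only if it is connected. *)
Record snc {m} (D : 'I_m -> set X) : Prop := SNC {
  snc_closed : forall i, closed (D i);
  snc_nonempty : forall i, D i !=set0;
  snc_connected : forall i, connected (D i);
  snc_smooth : forall i x, D i x ->
    exists c, [/\ atlas c, cdom c x & is_coord_line c (D i) 0];
  snc_crossing : forall i j x, i != j -> D i x -> D j x ->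
    exists c, [/\ atlas c, cdom c x, is_coord_line c (D i) 0 &
                  is_coord_line c (D j) 1];
  snc_no_triple : forall i j k x, i != j -> j != k -> i != k ->
    ~ [/\ D i x, D j x & D k x] }.

End Surfaces.

(* Every fibre is identified, as a vector space and without any continuity in
   the base point, with the space of row vectors of length r; the holomorphic
   structure is the maximal collection [hframe] of holomorphic local frames.
   The rows of e x are the values at x of the frame e, so that the section with
   coordinates s (a row) in the frame e is s *m e.  Sections are functions to
   row vectors, and subspaces of fibres are row spaces of square matrices. *)
Record hol_bundle (R : realType) (X : surface R) (r : nat) := HolBundle {
  hframe : set X -> (X -> 'M[R[i]]_r) -> Prop;
  hframe_open : forall W e, hframe W e -> open W;
  hframe_unit : forall W e x, hframe W e -> W x -> e x \in unitmx;
  hframe_cover : forall x, exists W e, hframe W e /\ W x;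
  hframe_compat : forall W e W' e', hframe W e -> hframe W' e' ->
    holo_mx (W `&` W') (fun x => e' x *m invmx (e x));
  hframe_max : forall W e, open W -> (forall x, W x -> e x \in unitmx) ->
    (forall W' e', hframe W' e' ->
       holo_mx (W `&` W') (fun x => e x *m invmx (e' x)) /\
       holo_mx (W `&` W') (fun x => e' x *m invmx (e x))) ->
    hframe W e }.

Section Bundles.
Context {R : realType} {X : surface R} {r : nat} (E : hol_bundle X r).
Implicit Types (W : set X) (e H F : X -> 'M[R[i]]_r) (u : X -> 'rV[R[i]]_r).

Definition smooth_section W u : Prop := forall W' e, hframe E W' e ->
  smooth_mx (W `&` W') (fun x => u x *m invmx (e x)).

Definition smooth_frame W e : Prop :=
  (forall x, W x -> e x \in unitmx) /\
  forall k, smooth_section W (fun x => row k (e x)).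

Definition hol_subbundle (D : set X) F : Prop :=
  exists d : nat, forall x, D x -> exists W e, [/\ hframe E W e, W x &
    forall y, D y -> W y ->
      (F y == span_rows (fun k : 'I_r => (k < d)%N) (e y))%MS].

Definition smooth_subbundle (U : set X) F : Prop :=
  exists d : nat, forall x, U x -> exists W e,
    [/\ open W, W x, smooth_frame W e &
     forall y, U y -> W y ->
      (F y == span_rows (fun k : 'I_r => (k < d)%N) (e y))%MS].

(* A metric is given on each fibre by its matrix in the standard basis. *)
Definition gram e H : X -> 'M[R[i]]_r := fun x => e x *m H x *m (e x)^t*.

Definition bundle_metric W H : Prop :=
  (forall x, W x -> posdef (H x)) /\
  forall W' e, hframe E W' e -> smooth_mx (W `&` W') (gram e H).

(* G is a smooth Hermitian metric on the subbundle Q over W; only its values on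
   pairs of vectors of Q matter. *)
Definition subbundle_metric W (Q G : X -> 'M[R[i]]_r) : Prop :=
  [/\ forall x (u v : 'rV[R[i]]_r), W x -> (u <= Q x)%MS -> (v <= Q x)%MS ->
        herm (G x) v u = (herm (G x) u v)^*,
      forall x (u : 'rV[R[i]]_r), W x -> (u <= Q x)%MS -> u != 0 ->
        0 < herm (G x) u u &
      forall W' u v, open W' -> W' `<=` W ->
        smooth_section W' u -> smooth_section W' v ->
        (forall x, W' x -> (u x <= Q x)%MS /\ (v x <= Q x)%MS) ->
        smooth_fun W' (fun x => herm (G x) (u x) (v x))].

(* Matrix in the frame e of the endomorphism Lambda_omega F_H, computed in the
   chart c; for omega = i \sum g_kl dz_k /\ d\bar z_l one has
   Lambda_omega (dz_k /\ d\bar z_l) = - i (g^-1)_lk. *)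
Definition Lambda_curv (g : hermitian_metric X) (c : chart R X) e H (x : X)
    : 'M[R[i]]_r :=
  - 'i%C *: \sum_(k < 2) \sum_(l < 2) (invmx (gmat g c x)) l k *:
      chern_curv (evec k) (evec l) (gram e H \o cinv c) (cmap c x).

End Bundles.

(* (L, s) is isomorphic to O(D) with its canonical section: in every local
   holomorphic frame s is a local equation of D vanishing to order one. *)
Definition canonical_section (R : realType) (X : surface R) (D : set X)
    (L : hol_bundle X 1) (s : X -> 'rV[R[i]]_1) : Prop :=
  forall W e, hframe L W e ->
    let f := fun x => (s x *m invmx (e x)) 0 0 in
    [/\ holo_fun W f,
        forall x, W x -> (D x <-> f x = 0) &
        forall c x, atlas c -> cdom c x -> W x -> D x ->
          exists k, del (evec k) (f \o cinv c) (cmap c x) != 0].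

Definition section_norm (R : realType) (X : Type) (r : nat)
    (h : X -> 'M[R[i]]_r) (s : X -> 'rV[R[i]]_r) (x : X) : R :=
  Num.sqrt (complex.Re (herm (h x) (s x) (s x))).

(* Indices of flags and weights start at 0; the term of index [plen i] is the
   zero subbundle. *)
Record parabolic (R : realType) (X : surface R) (m r : nat)
    (D : 'I_m -> set X) (E : hol_bundle X r) := Parabolic {
  plen : 'I_m -> nat;
  flag : 'I_m -> nat -> X -> 'M[R[i]]_r;
  weight : 'I_m -> nat -> R;
  plen_gt0 : forall i, (0 < plen i)%N;
  flag_hol : forall i s, (s < plen i)%N -> hol_subbundle E (D i) (flag i s);
  flag_top : forall i x, D i x -> (1%:M <= flag i 0 x)%MS;
  flag_bot : forall i x, D i x -> flag i (plen i) x = 0;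
  flag_proper : forall i s x, (s < plen i)%N -> D i x ->
    (flag i s.+1 x < flag i s x)%MS;
  weight_ge0 : forall i s, (s < plen i)%N -> 0 <= weight i s;
  weight_lt1 : forall i s, (s < plen i)%N -> weight i s < 1;
  weight_incr : forall i s t, (s < t < plen i)%N -> weight i s < weight i t;
  (* total order by inclusion on D_i /\ D_j; each flag is then automatically
     refined by the union of the two *)
  flag_compat : forall i j s t, (s < plen i)%N -> (t < plen j)%N ->
    (forall x, D i x -> D j x -> (flag i s x <= flag j t x)%MS) \/
    (forall x, D i x -> D j x -> (flag j t x <= flag i s x)%MS) }.

Section Leaves.
Context {R : realType} {X : surface R}.
Implicit Types (D U : set X) (b : R[i] -> X).

Definition unit_disc : set R[i] := [set z | `|z| < 1].

Definition hol_disc b : Prop :=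
  [/\ forall z, unit_disc z -> {for z, continuous b},
      forall z w, unit_disc z -> unit_disc w -> b z = b w -> z = w &
      forall c, atlas c ->
        holo_mx_on (unit_disc `&` (b @^-1` cdom c)) (cmap c \o b) /\
        forall z, unit_disc z -> cdom c (b z) ->
          del_mx (1 : R[i]) (cmap c \o b) z != 0].

Definition leaf b : set X := b @` unit_disc.

Definition pair_vec (z a : R[i]) : 'rV[R[i]]_2 :=
  \row_k (if k == 0 then z else a).

Definition polydisc (rho : R) : set 'rV[R[i]]_2 :=
  [set z | forall k, `|z 0 k| < rho%:C].

(* Around each point of U there are coordinates in which the leaves are the
   graphs z_2 = f(z_1, a) with f(0, a) = a; around a point of D these
   coordinates are moreover such that D = {z_1 = 0}. *)
Definition smooth_foliation D U (B : X -> R[i] -> X) : Prop :=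
  forall y, U y -> exists c (rho : R) (f : 'rV[R[i]]_2 -> R[i]),
    [/\ [/\ atlas c, cdom c y & cmap c y = 0],
        D y -> is_coord_line c D 0,
        0 < rho,
        [/\ smooth_on (polydisc rho) f,
            forall z, polydisc rho z -> delbar (evec 0) f z = 0 &
            forall a, `|a| < rho%:C -> f (pair_vec 0 a) = a] &
        forall a, `|a| < rho%:C -> exists2 x, D x &
          forall z, `|z| < rho%:C -> exists p,
            [/\ cdom c p, leaf (B x) p &
                cmap c p = pair_vec z (f (pair_vec z a))]].

(* The leaf B_x is the image of the unit disc under the map B x. *)
Record tube (g : hermitian_metric X) D U (B : X -> R[i] -> X) : Prop := Tube {
  tube_open : open U;
  tube_leaves : U = \bigcup_(x in D) leaf (B x);
  tube_disc : forall x, D x -> hol_disc (B x);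
  tube_center : forall x, D x -> B x 0 = x;
  tube_meet : forall x, D x -> leaf (B x) `&` D = [set x];
  tube_disjoint : forall x x', D x -> D x' ->
    leaf (B x) `&` leaf (B x') !=set0 -> x = x';
  tube_smooth : smooth_foliation D U B;
  tube_orth : forall x c, D x -> atlas c -> cdom c x -> is_coord_line c D 0 ->
    herm (gmat g c x) (del_mx (1 : R[i]) (cmap c \o B x) 0) (evec 1) = 0 }.

Context {r : nat} (E : hol_bundle X r).

Definition flat_on_disc (H : X -> 'M[R[i]]_r) b : Prop :=
  forall W e, hframe E W e -> forall z, unit_disc z -> W (b z) ->
    chern_curv (1 : R[i]) (1 : R[i]) (gram e H \o b) z = 0.

Definition boundary_values (H H' : X -> 'M[R[i]]_r) b : Prop :=
  forall W e y, hframe E W e -> W y -> (closure (leaf b) `\` leaf b) y ->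
    forall k l, (fun x => gram e H x k l) @ within (leaf b) (nbhs y)
                  --> gram e H' y k l.

(* s is a section of b^*E, so s z lies in the fibre over b z. *)
Definition parallel_on_disc (H : X -> 'M[R[i]]_r) b (s : R[i] -> 'rV[R[i]]_r)
    : Prop :=
  forall W e, hframe E W e ->
    let sigma := fun z => s z *m invmx (e (b z)) in
    smooth_mx_on (unit_disc `&` (b @^-1` W)) sigma /\
    forall z, unit_disc z -> W (b z) ->
      del_mx (1 : R[i]) sigma z + sigma z *m chern_conn (1 : R[i]) (gram e H \o b) z = 0 /\
      delbar_mx (1 : R[i]) sigma z = 0.

End Leaves.

Section HparConstruction.
Context {R : realType} {X : surface R} {m r : nat}.
Context {D : 'I_m -> set X} {E : hol_bundle X r}.
Context (g : hermitian_metric X) (P : parabolic D E).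

Definition Dsupp : set X := \bigcup_i D i.
Definition Dother (i : 'I_m) : set X := \bigcup_(l in [set l | l != i]) D l.

Definition crossing_nbhd (U : 'I_m -> set X) (i j : 'I_m)
    (N : X -> chart R X) : Prop :=
  [/\ forall p, D i p -> D j p ->
        [/\ atlas (N p), cdom (N p) p, cmap (N p) p = 0,
            is_coord_line (N p) (D i) 0 & is_coord_line (N p) (D j) 1],
      U i `&` U j = \bigcup_(p in D i `&` D j) cdom (N p) &
      forall p q, D i p -> D j p -> D i q -> D j q ->
        cdom (N p) `&` cdom (N q) !=set0 -> p = q].

Definition is_level (U : 'I_m -> set X) (i j : 'I_m) (e : X -> 'M[R[i]]_r)
    (k : 'I_r) (s : nat) : Prop :=
  let inflag t := forall x, D i x -> U j x -> (row k (e x) <= flag P i t x)%MS in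
  [/\ (s < plen P i)%N, inflag s &
      forall t, (t < plen P i)%N -> inflag t -> (t <= s)%N].

Definition orth_compl (H F F' : X -> 'M[R[i]]_r) : X -> 'M[R[i]]_r :=
  fun x => (F x :&: kermx (H x *m (F' x)^t*))%MS.

Record Hpar_data := HparData {
  odiv : 'I_m -> hol_bundle X 1;
  csec : 'I_m -> X -> 'rV[R[i]]_1;
  odiv_metric : 'I_m -> X -> 'M[R[i]]_1;
  csec_canonical : forall i, canonical_section (D i) (odiv i) (csec i);
  odiv_metricP : forall i, bundle_metric (odiv i) setT (odiv_metric i);
  signorm := fun i => section_norm (odiv_metric i) (csec i);

  nb : 'I_m -> set X;
  disc : 'I_m -> X -> R[i] -> X;
  nb_tube : forall i, tube g (D i) (nb i) (disc i);
  nb_crossing : forall i j, i != j -> exists N, crossing_nbhd nb i j N;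

  (* alpha^i_(k) and alpha^j_(k) on U_i /\ U_j are [alpha i j k] and
     [alpha j i k]. *)
  fr : 'I_m -> 'I_m -> X -> 'M[R[i]]_r;
  level : 'I_m -> 'I_m -> 'I_r -> nat;
  fr_sym : forall i j x, nb i x -> nb j x -> fr i j x = fr j i x;
  fr_hol : forall i j, i != j -> hframe E (nb i `&` nb j) (fr i j);
  fr_refine : forall i j s, i != j -> (s < plen P i)%N ->
    exists k0 : nat, forall x, D i x -> nb j x ->
      (flag P i s x == span_rows (fun k : 'I_r => (k0 <= k)%N) (fr i j x))%MS;
  levelP : forall i j k, i != j -> is_level nb i j (fr i j) k (level i j k);
  alpha := fun i j k => weight P i (level i j k);

  H2 : X -> 'M[R[i]]_r;
  H2_metric : bundle_metric E setT H2;
  H2_fr : forall i j x, i != j -> nb i x -> nb j x ->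
    gram (fr i j) H2 x = 1%:M;
  H1 : X -> 'M[R[i]]_r;
  H1_metric : bundle_metric E (\bigcup_i nb i) H1;
  H1_flat : forall i x, D i x -> flat_on_disc E H1 (disc i x);
  H1_boundary : forall i x, D i x -> boundary_values E H1 H2 (disc i x);
  H1_fr : forall i j x, i != j -> nb i x -> nb j x ->
    gram (fr i j) H1 x = 1%:M;

  flagx : 'I_m -> nat -> X -> 'M[R[i]]_r;
  flagx_transport : forall i s x z, (s <= plen P i)%N -> D i x ->
    unit_disc z -> forall u : 'rV[R[i]]_r,
    (u <= flagx i s (disc i x z))%MS <->
    exists v, [/\ parallel_on_disc E H1 (disc i x) v,
                  (v 0%R <= flag P i s x)%MS & v z = u];
  flagx_smooth : forall i s, (s < plen P i)%N ->
    smooth_subbundle E (nb i) (flagx i s);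
  flagx_fr : forall i j s x, i != j -> (s < plen P i)%N -> nb i x -> nb j x ->
    (flagx i s x ==
     span_rows (fun k => (weight P i s <= alpha i j k)%R) (fr i j x))%MS;
  Q := fun i s => orth_compl H1 (flagx i s) (flagx i s.+1);

  Hpar : X -> 'M[R[i]]_r;
  Hpar_metric : bundle_metric E (~` Dsupp) Hpar;
  cfac : 'I_m -> 'I_m -> 'I_r -> X -> R;
  cfacP : forall i j k, i != j -> exists W,
    [/\ open W, closure (nb i `&` nb j) `<=` W,
        smooth_fun W (fun x => (cfac i j k x)%:C) &
        forall x, W x -> 0 < cfac i j k x];
  Hpar_crossing : forall i j x, i != j -> nb i x -> nb j x -> ~ Dsupp x ->
    gram (fr i j) Hpar x =
    diag_mx (\row_k (cfac i j k x *
      signorm i x `^ (2 * alpha i j k) * signorm j x `^ (2 * alpha j i k))%:C);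
  G : 'I_m -> nat -> X -> 'M[R[i]]_r;
  G_metric : forall i s, (s < plen P i)%N ->
    subbundle_metric E (nb i `\` Dother i) (Q i s) (G i s);
  (* G_s is H_1 on Q_s up to smooth factors: it is diagonal in local smooth
     H_1-orthonormal frames.  The shape of the factors is left free. *)
  G_H1 : forall i x, (nb i `\` Dother i) x -> exists W q (t : 'I_r -> nat),
    [/\ open W /\ W x, W `<=` nb i `\` Dother i, smooth_frame E W q,
        forall k, (t k < plen P i)%N &
        forall y, W y ->
          [/\ gram q H1 y = 1%:M,
              forall k, (row k (q y) <= Q i (t k) y)%MS &
              forall k l, k != l -> t k = t l ->
                herm (G i (t k) y) (row k (q y)) (row l (q y)) = 0]];
  Hpar_sum : forall i s t x (u v : 'rV[R[i]]_r),
    (s < plen P i)%N -> (t < plen P i)%N -> nb i x -> ~ Dsupp x ->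
    (u <= Q i s x)%MS -> (v <= Q i t x)%MS ->
    herm (Hpar x) u v =
    if s == t then (signorm i x `^ (2 * weight P i s))%:C * herm (G i s x) u v
    else 0 }.

End HparConstruction.

(* Main.v *)
Require Import Defs.
From mathcomp Require Import ring lra.

Set Implicit Arguments.
Unset Strict Implicit.
Unset Printing Implicit Defensive.

Local Open Scope classical_set_scope.
Local Open Scope ring_scope.
Local Open Scope complex_scope.
Local Open Scope sesquilinear_scope.

(** The norm of [Lambda F] depends neither on the coordinates nor on the
holomorphic frame ([endo_norm_Lambda_curv]).  By compactness it is therefore enough to
bound it near each point of the surface, off the divisor.  Near a point that is
not on the divisor this is continuity.

Near a point of the divisor, write the metric in a smooth frame in which it is
diagonal: its Gram matrix in a holomorphic frame is [B Delta B^*], where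
[Delta_k = gam_k * |sigma|^(2 a_k)] with [gam_k] smooth and positive.  In the smooth frame the
(0,1)-part of the connection is [b = B^-1 delbar B], and the curvature has entries
built from [b], its first derivatives, the logarithmic derivatives [L_k] of [Delta_k] and
the ratios [Delta_k / Delta_l] ([chern_curv_diag]).  The norm of an endomorphism weighs its
entry (k, l) by [mu = |sigma|^(a_l - a_k)].  So what has to be bounded is [mu b_kl] and the
contraction with the metric of [mu (del b_kl + b_kl (L_l - L_k))]; the other terms are
products and conjugates of these, or of the form [delbar L_k], which is smooth since
the logarithm of the modulus of a holomorphic function is pluriharmonic
([endo_norm_diag_bound]).

At a crossing the frame is holomorphic, [b = 0], and nothing else is left
([crossing_bound]).

Near a point of a single component with local equation [f], take a frame adapted to the
decomposition into the [Q_s] and orthonormal for the auxiliary metric; let [t k] be the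
index of the summand of its k-th vector.  If [a_k <= a_l] then [mu] is bounded.
Otherwise [t l < t k], and since the weights lie in [0, 1), only [mu f] is bounded: a zero
of order one is needed, and one of order two where the pole of [L_l - L_k], a multiple of
[del f / f], occurs.  The zeros come from the geometry of the construction.
- Parallel transport along the leaves preserves the extended flag, so [b_kl] vanishes
  in the direction of the leaves whenever [t k <> t l] ([leaf_normal]); on the divisor
  the flag is holomorphic, so [b_kl] also vanishes in the direction of the divisor if
  [t l < t k] ([line_frame_dbar]).  Hence [b_kl = O(f)] in the latter case.
- The pole is multiplied by the contraction of [b_kl] with [del f].  On the divisor,
  [del f] is dual to the normal direction, which is the direction of the leaf by
  orthogonality; so the contraction is [O(f)] if [t k <> t l] ([frame_dbar_normal]).  If
  [t l < t k], its normal derivatives vanish too, as one sees by differentiating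
  the vanishing along the leaves ([wirt_frame_dbar_normal]); so it is [O(f^2)].
The passage from zeros on the divisor to bounds is the mean value theorem on
segments in the normal direction ([lbd_div1], [lbd_div2]), and the estimate is
[single_divisor_bound]. *)

(** * Curves in the complex plane *)

Section ComplexTopology.
Context {R : realType} {V : normedModType R[i]}.

Lemma continuous_real_complex (t : R) :
  {for t, continuous (fun t : R => t%:C : R[i])}.
Proof.
apply/cvgrPdist_lt => /= e e0.
have [e1 e2] : complex.Im e = 0 /\ 0 < complex.Re e.
  by move: e0; rewrite ltcE /= => /andP[/eqP ? ?].
near=> s.
have -> : e = (complex.Re e)%:C by rewrite {1}(complexE e) e1 mulr0 addr0.
rewrite -rmorphB /= normc_def /= expr0n addr0 sqrtr_sqr ltcR.
near: s.
by apply: cvgr_dist_lt.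
Unshelve. all: by end_near.
Qed.

Lemma continuous_Re (x : R[i]) : {for x, continuous (@complex.Re R)}.
Proof.
apply/(@cvgrPdist_lt _ _ _ (nbhs _) _) => /= e e0.
apply/nbhs_normP; exists e%:C => /=; first by rewrite ltcR.
move=> y; rewrite /ball_ /= => h.
have := le_lt_trans (normc_ge_Re (x - y)) h.
by rewrite ltcR raddfB.
Qed.

Lemma continuous_Im (x : R[i]) : {for x, continuous (@complex.Im R)}.
Proof.
apply/(@cvgrPdist_lt _ _ _ (nbhs _) _) => /= e e0.
apply/nbhs_normP; exists e%:C => /=; first by rewrite ltcR.
move=> y; rewrite /ball_ /= => h.
rewrite -[ltLHS]mulr1 -(_ : `|'i%C : R[i]| = 1) -?normrM in h; last first.
  by rewrite normc_def /= expr0n expr1n add0r sqrtr1.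
have := le_lt_trans (normc_ge_Re ((x - y) * 'i%C)) h.
by rewrite ltcR ReiNIm normrN raddfB.
Qed.

Lemma continuous_line (z v : V) (t : R) :
  {for t, continuous (fun t : R => z + t%:C *: v)}.
Proof.
apply: cvgD; first exact: cvg_cst.
by apply: cvgZ; [exact: continuous_real_complex | exact: cvg_cst].
Qed.

Lemma near_line (z v : V) (A : set V) :
  (\forall x \near z, A x) -> \forall t \near (0 : R), A (z + t%:C *: v).
Proof.
move=> nA; have /(_ A) := @continuous_line z v 0.
by rewrite /= scale0r addr0; apply.
Qed.

End ComplexTopology.

Section Curves.
Context {R : realType}.
Implicit Types (c : R -> R[i]) (t : R) (d : R[i]).

(** Stated on real and imaginary parts because [dir_deriv] is defined through them. *)
Definition cder c t d : Prop :=
  is_derive t 1 (fun s => complex.Re (c s)) (complex.Re d) /\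
  is_derive t 1 (fun s => complex.Im (c s)) (complex.Im d).

Lemma cder_cst (a : R[i]) t : cder (fun=> a) t 0.
Proof. by split; apply: is_derive_cst. Qed.

Lemma cder_near c1 c2 t d :
  (\forall s \near t, c1 s = c2 s) -> cder c1 t d -> cder c2 t d.
Proof.
by move=> e [h1 h2]; split; [apply: near_eq_is_derive h1 | apply: near_eq_is_derive h2];
  apply: filterS e => s ->.
Qed.

Lemma cder_unique c t d d' : cder c t d -> cder c t d' -> d = d'.
Proof.
case: d d' => [a b] [a' b'] [[_ /= <-] [_ /= <-]] [[_ /= <-] [_ /= <-]].
by [].
Qed.

Lemma ReD (x y : R[i]) : complex.Re (x + y) = complex.Re x + complex.Re y.
Proof. by case: x y => [? ?] []. Qed.

Lemma ImD (x y : R[i]) : complex.Im (x + y) = complex.Im x + complex.Im y.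
Proof. by case: x y => [? ?] []. Qed.

Lemma ReM (x y : R[i]) : complex.Re (x * y) =
  complex.Re x * complex.Re y - complex.Im x * complex.Im y.
Proof. by case: x y => [? ?] []. Qed.

Lemma ImM (x y : R[i]) : complex.Im (x * y) =
  complex.Re x * complex.Im y + complex.Im x * complex.Re y.
Proof. by case: x y => [? ?] []. Qed.

Lemma cderD c1 c2 t d1 d2 : cder c1 t d1 -> cder c2 t d2 ->
  cder (fun s => c1 s + c2 s) t (d1 + d2).
Proof.
move=> [a1 b1] [a2 b2]; split.
  rewrite ReD; under eq_fun do rewrite ReD.
  exact: (is_deriveD a1 a2).
rewrite ImD; under eq_fun do rewrite ImD.
exact: (is_deriveD b1 b2).
Qed.

Lemma cderM c1 c2 t d1 d2 : cder c1 t d1 -> cder c2 t d2 ->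
  cder (fun s => c1 s * c2 s) t (d1 * c2 t + c1 t * d2).
Proof.
move=> [a1 b1] [a2 b2]; split.
  under eq_fun do rewrite ReM.
  apply: (is_derive_eq (is_deriveB (is_deriveM a1 a2) (is_deriveM b1 b2))).
  rewrite ReD !ReM /GRing.scale /=; ring.
under eq_fun do rewrite ImM.
apply: (is_derive_eq (is_deriveD (is_deriveM a1 b2) (is_deriveM b1 a2))).
rewrite ImD !ImM /GRing.scale /=; ring.
Qed.

Lemma cderJ c t d : cder c t d -> cder (fun s => Num.conj (c s)) t (Num.conj d).
Proof.
have rJ x : complex.Re (Num.conj x : R[i]) = complex.Re x by case: x.
have iJ x : complex.Im (Num.conj x : R[i]) = - complex.Im x by case: x.
move=> [h1 h2]; split; first by rewrite rJ; under eq_fun do rewrite rJ.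
by rewrite iJ; under eq_fun do rewrite iJ; exact: is_deriveN.
Qed.

Lemma cder_real (p : R -> R) t (d : R) : is_derive t 1 p d ->
  cder (fun s => (p s)%:C) t d%:C.
Proof. by move=> h; split=> //=; apply: is_derive_cst. Qed.

(** The inverse is the conjugate divided by the squared modulus, which is a real
function. *)
Lemma cderV c t d : cder c t d -> c t != 0 ->
  cder (fun s => (c s)^-1) t (- d / (c t) ^+ 2).
Proof.
move=> h ct0.
pose n s := complex.Re (c s) * complex.Re (c s) + complex.Im (c s) * complex.Im (c s).
have nE s : (n s)%:C = c s * Num.conj (c s).
  by rewrite -normCK -add_Re2_Im2.
have n0 : n t != 0.
  apply: contraNneq ct0 => n0; have := nE t; rewrite n0 => /esym/eqP.
  by rewrite -normCK expf_eq0 /= normr_eq0.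
have dn : exists d' : R, is_derive t 1 n d'.
  by case: h => h1 h2; eexists; exact: (is_deriveD (is_deriveM h1 h1) (is_deriveM h2 h2)).
case: dn => d' hd'.
have hn : cder (fun s => (n s)%:C) t (d * Num.conj (c t) + c t * Num.conj d).
  under eq_fun do rewrite nE.
  exact: cderM h (cderJ h).
have hV := cder_real (is_deriveV n0 hd').
have e : d'%:C = d * Num.conj (c t) + c t * Num.conj d.
  exact: cder_unique (cder_real hd') hn.
have hc : (fun s => (c s)^-1) = (fun s => Num.conj (c s) * ((n s)^-1)%:C).
  apply/funext => s; have [->|cs0] := eqVneq (c s) 0.
    by rewrite rmorph0 mul0r invr0.
  have -> : ((n s)^-1)%:C = (c s * Num.conj (c s))^-1 by rewrite -nE fmorphV.
  by rewrite invfM mulrCA divff ?mulr1 // conjC_eq0.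
rewrite hc.
have := cderM (cderJ h) hV.
congr cder.
have -> : ((n t)^-1)%:C = (c t * Num.conj (c t))^-1 by rewrite -nE fmorphV.
have -> : (- (n t) ^- 2 *: d')%:C = - (c t * Num.conj (c t)) ^- 2 * d'%:C.
  by rewrite -nE /GRing.scale /= rmorphM rmorphN fmorphV rmorphXn.
rewrite e.
have cj0 : Num.conj (c t) != 0 by rewrite conjC_eq0.
field.
by rewrite cj0 ct0.
Qed.

End Curves.

Section MeanValue.
Context {R : realType}.

(** The two signs of [u] are treated at once, as needed to compare values on both
sides of a base point. *)
Lemma MVT0 (phi dphi : R -> R) (u : R) :
  (forall w : R, `|w| <= `|u| -> is_derive w 1 phi (dphi w)) ->
  exists2 w, `|w| <= `|u| & phi u - phi 0 = dphi w * u.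
Proof.
move=> h.
have [->|u0] := eqVneq u 0.
  by exists 0 => //; rewrite mulr0 subrr.
have cont (w : R) : `|w| <= `|u| -> {for w, continuous phi}.
  by move=> /h hw; apply: differentiable_continuous; apply/derivable1_diffP; case: hw.
have [u_gt0|u_lt0|u_eq0] := ltgtP 0 u; last by rewrite u_eq0 eqxx in u0.
- have [||w /andP[]] := @MVT _ phi dphi 0 u u_gt0.
  + move=> x /andP[x1 x2]; apply: h; move: x1 x2; rewrite !bnd_simp => x1 x2.
    by rewrite !gtr0_norm // ltW.
  + apply: continuous_in_subspaceT => x /set_mem /= /andP[]; rewrite !bnd_simp => x1 x2.
    by apply: cont; rewrite !ger0_norm // ltW.
  rewrite !bnd_simp => w1 w2 e; exists w; last by rewrite e subr0.
  by rewrite !gtr0_norm // ltW.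
- have [||w /andP[]] := @MVT _ phi dphi u 0 u_lt0.
  + move=> x /andP[x1 x2]; apply: h; move: x1 x2; rewrite !bnd_simp => x1 x2.
    by rewrite !ltr0_norm // lerN2 ltW.
  + apply: continuous_in_subspaceT => x /set_mem /= /andP[]; rewrite !bnd_simp => x1 x2.
    by apply: cont; rewrite !ler0_norm // ?lerN2 // ltW.
  rewrite !bnd_simp => w1 w2 e; exists w; last first.
    by rewrite -opprB e sub0r mulrN opprK.
  by rewrite !ltr0_norm // lerN2 ltW.
Qed.

End MeanValue.

(** * Chain rule and symmetry of second derivatives over the reals *)

Section Paths.
Context {R : realType} {V : normedModType R[i]}.
Implicit Types (g dg : V -> R) (z v : V).

(** A factor that vanishes at 0 turns the difference quotient of the product into
its own quotient times the other factor, which then only has to be continuous. *)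
Lemma is_derive_mul_vanishing (c rho : R -> R) (c' : R) :
  c 0 = 0 -> is_derive (0 : R) 1 c c' -> {for 0, continuous rho} ->
  is_derive (0 : R) 1 (fun t => c t * rho t) (c' * rho 0).
Proof.
move=> c0 [dc <-] hrho.
have cv : (fun h : R => h^-1 *: (((fun t => c t * rho t) \o shift 0) (h *: 1) -
    c 0 * rho 0)) @ 0^' --> 'D_1 c 0 * rho 0.
  have -> : (fun h : R => h^-1 *: (((fun t => c t * rho t) \o shift 0) (h *: 1) -
    c 0 * rho 0)) = (fun h : R => h^-1 *: ((c \o shift 0) (h *: 1) - c 0) * rho h).
    apply/funext => h /=; rewrite c0 mul0r !subr0 /GRing.scale /= mulr1 addr0.
    by rewrite mulrA.
  apply: cvgM; first exact: dc.
  exact: (@cvg_within_filter _ _ rho (nbhs (0 : R)) _ _ _ hrho).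
by split; [apply/cvg_ex; eexists; exact: cv | exact: cvg_lim cv].
Qed.

Lemma is_derive_line g dg z v (t : R) :
  is_derive (0 : R) 1 (fun s => g ((z + t%:C *: v) + s%:C *: v)) (dg (z + t%:C *: v)) ->
  is_derive t 1 (fun s => g (z + s%:C *: v)) (dg (z + t%:C *: v)).
Proof.
move=> h.
have hs : is_derive t 1 (fun s : R => s - t) 1.
  apply: (is_derive_eq (is_deriveB (is_derive_id t 1) (is_derive_cst t t 1))).
  by rewrite subr0.
have h' : is_derive (t - t : R) 1 (fun s => g ((z + t%:C *: v) + s%:C *: v))
   (dg (z + t%:C *: v)) by rewrite subrr.
have := @is_derive1_comp R (fun s => g ((z + t%:C *: v) + s%:C *: v)) (fun s => s - t) t _ _ h' hs; rewrite mulr1.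
rewrite (_ : _ \o _ = (fun s => g (z + s%:C *: v))) //; apply/funext => s /=.
by rewrite -addrA -scalerDl -rmorphD subrKC.
Qed.

Lemma MVT_line g dg z v (u : R) :
  (forall w : R, `|w| <= `|u| -> is_derive (0 : R) 1
     (fun s => g ((z + w%:C *: v) + s%:C *: v)) (dg (z + w%:C *: v))) ->
  exists2 w : R, `|w| <= `|u| &
    g (z + u%:C *: v) - g z = dg (z + w%:C *: v) * u.
Proof.
move=> h; have [w /h/is_derive_line hw|w wu] := @MVT0 R
  (fun s => g (z + s%:C *: v)) (fun s => dg (z + s%:C *: v)) u.
  exact: hw.
by rewrite scale0r addr0 => e; exists w.
Qed.

(** The base point [s t] moves with [t]: by the mean value theorem the increment
is [c t] times a value of [dg] at a point close to [z]. *)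
Lemma is_derive_step g dg z v (s : R -> V) (c : R -> R) (c' : R) :
  (\forall x \near z, is_derive (0 : R) 1 (fun t => g (x + t%:C *: v)) (dg x)) ->
  {for z, continuous dg} -> s @ (0 : R) --> z -> c 0 = 0 ->
  is_derive (0 : R) 1 c c' ->
  is_derive (0 : R) 1 (fun t => g (s t + (c t)%:C *: v) - g (s t)) (c' * dg z).
Proof.
move=> hg hdg hs c0 hc.
pose k t := g (s t + (c t)%:C *: v) - g (s t).
pose rho t := if c t == 0 then dg z else k t / c t.
have kE : k = (fun t => c t * rho t).
  apply/funext => t; rewrite /rho; case: ifPn => [/eqP ct0|ct0].
    by rewrite /k ct0 scale0r addr0 subrr mul0r.
  by rewrite mulrCA divff // mulr1.
rewrite -/k kE; have -> : dg z = rho 0 by rewrite /rho c0 eqxx.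
apply: is_derive_mul_vanishing => //.
have rho0 : rho 0 = dg z by rewrite /rho c0 eqxx.
apply/cvgrPdist_lt => /= e e0; rewrite rho0.
have nP : \forall x \near z,
    is_derive (0 : R) 1 (fun t => g (x + t%:C *: v)) (dg x) /\ `|dg z - dg x| < e.
  near=> x; split; first by near: x.
  by near: x; move/cvgrPdist_lt : hdg => /(_ e e0).
have cv : (fun p : R * R => s p.1 + p.2%:C *: v) @ ((0 : R), (0 : R)) --> z.
  rewrite -[X in _ --> X]addr0 -(scale0r v); apply: cvgD.
    by apply: cvg_comp hs; exact: cvg_fst.
  apply: cvgZ; last exact: cvg_cst.
  apply: (@cvg_comp _ _ _ snd (fun t : R => t%:C) _ (nbhs (0 : R)) _ _).
    exact: cvg_snd.
  exact: continuous_real_complex.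
have [[A B] /= [nA nB] AB] := cv _ nP.
have [d /= d0 dB] := (@nbhs_ballP R R 0 B).1 nB.
have cc : {for 0, continuous c}.
  by apply: differentiable_continuous; apply/derivable1_diffP; case: hc.
near=> t.
have At : A t by near: t.
have ct : `|c t| < d.
  near: t; move/cvgrPdist_lt : cc => /(_ d d0); apply: filterS => t.
  by rewrite c0 sub0r normrN.
have hB (w : R) : `|w| <= `|c t| -> B w.
  by move=> hw; apply: dB; rewrite /ball /= sub0r normrN; exact: le_lt_trans hw ct.
rewrite /rho; case: ifPn => [_|ct0]; first by rewrite subrr normr0.
have [|w hw e1] := @MVT_line g dg (s t) v (c t).
  by move=> w /hB Bw; case: (AB (t, w) (conj At Bw)).
rewrite /k e1 mulfK //.
by case: (AB (t, w) (conj At (hB _ hw))).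
Unshelve. all: by end_near.
Qed.

(** Moving along one direction at a time reduces the chain rule to the mean
value theorem on segments. *)
Lemma is_derive_path (J : Type) (r : seq J) g (dg : J -> V -> R) z
    (u : J -> V) (c : J -> R -> R) (c' : J -> R) :
  (forall j, \forall x \near z,
     is_derive (0 : R) 1 (fun t => g (x + t%:C *: u j)) (dg j x)) ->
  (forall j, {for z, continuous (dg j)}) ->
  (forall j, c j 0 = 0) -> (forall j, is_derive (0 : R) 1 (c j) (c' j)) ->
  is_derive (0 : R) 1 (fun t => g (z + \sum_(j <- r) (c j t)%:C *: u j))
    (\sum_(j <- r) c' j * dg j z).
Proof.
move=> hg hdg c0 hc.
have cvs s : (fun t : R => z + \sum_(j <- s) (c j t)%:C *: u j) @ (0 : R) --> z.
  rewrite -[X in _ --> X]addr0; apply: cvgD; first exact: cvg_cst.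
  have cc j : (fun t : R => (c j t)%:C *: u j) @ (0 : R) --> (0 : V).
    have cj : c j @ (0 : R) --> c j 0.
      by apply: differentiable_continuous; apply/derivable1_diffP; case: (hc j).
    rewrite c0 in cj.
    rewrite -(scale0r (u j)); apply: cvgZ; last exact: cvg_cst.
    apply: (@cvg_comp _ _ _ (c j) (fun t : R => t%:C) _ (nbhs (0 : R)) _ _).
      by [].
    exact: continuous_real_complex.
  elim: s => [|j s IH].
    rewrite (_ : (fun t : R => _) = fun=> 0); first exact: cvg_cst.
    by apply/funext => t; rewrite big_nil.
  rewrite (_ : (fun t : R => _) = fun t : R => (c j t)%:C *: u j + \sum_(i <- s) (c i t)%:C *: u i).
    have := cvgD (cc j) IH; rewrite addr0 => H; exact: (H (nbhs_filter _)).
  by apply/funext => t; rewrite big_cons.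
elim: r => [|j r IH].
  under eq_fun do rewrite big_nil; rewrite big_nil; exact: is_derive_cst.
rewrite big_cons.
have h := is_derive_step (hg j) (hdg j) (cvs r) (c0 j) (hc j).
have := is_deriveD h IH; rewrite (_ : _ + _ = (fun t => g (z + \sum_(i <- j :: r) (c i t)%:C *: u i))) //.
apply/funext => t; rewrite big_cons [X in g (z + X)]addrC addrA.
exact: subrK.
Qed.

(* The second difference of g over a small parallelogram. *)
Let diff2 g z u v (t : R) :=
  g (z + t%:C *: u + t%:C *: v) - g (z + t%:C *: u) - g (z + t%:C *: v) + g z.

(** The mean value theorem along [u], applied to the first difference along [v],
and then along [v]. *)
Lemma near_diff2 g (du duv : V -> R) z u v (e : R) : 0 < e ->
  (\forall x \near z, is_derive (0 : R) 1 (fun t => g (x + t%:C *: u)) (du x)) ->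
  (\forall x \near z, is_derive (0 : R) 1 (fun t => du (x + t%:C *: v)) (duv x)) ->
  {for z, continuous duv} ->
  \forall t \near (0 : R), exists2 p, `|duv z - duv p| < e &
    diff2 g z u v t = duv p * t * t.
Proof.
move=> e0 hu huv hc.
have nP : \forall x \near z, [/\
    is_derive (0 : R) 1 (fun t => g (x + t%:C *: u)) (du x),
    is_derive (0 : R) 1 (fun t => du (x + t%:C *: v)) (duv x) &
    `|duv z - duv x| < e].
  near=> x; split; [by near: x | by near: x |].
  by near: x; move/cvgrPdist_lt : hc => /(_ e e0).
have cv : (fun p : R * R => z + p.1%:C *: u + p.2%:C *: v) @ ((0 : R), (0 : R)) --> z.
  rewrite -[X in _ --> X]addr0 -(scale0r v); apply: cvgD; last first.
    apply: cvgZ; last exact: cvg_cst.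
    apply: (@cvg_comp _ _ _ snd (fun t : R => t%:C) _ (nbhs (0 : R)) _ _).
      exact: cvg_snd.
    exact: continuous_real_complex.
  rewrite -[X in _ --> X]addr0 -(scale0r u); apply: cvgD; first exact: cvg_cst.
  apply: cvgZ; last exact: cvg_cst.
  apply: (@cvg_comp _ _ _ fst (fun t : R => t%:C) _ (nbhs (0 : R)) _ _).
    exact: cvg_fst.
  exact: continuous_real_complex.
have [[A B] /= [nA nB] AB] := cv _ nP.
have nAB : nbhs (0 : R) (A `&` B) by exact: filterI.
have [d /= d0 dB] := (@nbhs_ballP R R 0 (A `&` B)).1 nAB.
exists d => //= t; rewrite /ball_ /= sub0r normrN => td.
have hP w w' : `|w| <= `|t| -> `|w'| <= `|t| -> [/\
    is_derive (0 : R) 1 (fun t => g (z + w%:C *: u + w'%:C *: v + t%:C *: u)) (du (z + w%:C *: u + w'%:C *: v)),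
    is_derive (0 : R) 1 (fun t => du (z + w%:C *: u + w'%:C *: v + t%:C *: v)) (duv (z + w%:C *: u + w'%:C *: v)) &
    `|duv z - duv (z + w%:C *: u + w'%:C *: v)| < e].
  move=> hw hw'; apply: (AB (w, w')); split=> /=.
    by case: (dB w) => //; rewrite /ball /= sub0r normrN; exact: le_lt_trans td.
  by case: (dB w') => //; rewrite /ball /= sub0r normrN; exact: le_lt_trans td.
have [|w hw e1] := @MVT_line (fun x => g (x + t%:C *: v) - g x)
   (fun x => du (x + t%:C *: v) - du x) z u t.
  move=> w hw; have [h1 _ _] := hP w t hw (lexx _).
  have [h2 _ _] := hP w 0 hw (ltac:(by rewrite normr0)).
  rewrite scale0r addr0 in h2.
  have := is_deriveB h1 h2; congr is_derive; apply/funext => s.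
  by rewrite [in RHS](addrAC (z + w%:C *: u)).
have [|w' hw' e2] := @MVT_line du duv (z + w%:C *: u) v t.
  by move=> w' hw'; have [_ ? _] := hP w w' hw hw'.
exists (z + w%:C *: u + w'%:C *: v); first by have [] := hP w w' hw hw'.
rewrite -e2 -e1 /diff2; ring.
Unshelve. all: by end_near.
Qed.

(** Both mixed derivatives are limits of the same second difference quotient. *)
Lemma mixed_derivatives_eq g (du dv duv dvu : V -> R) z u v :
  (\forall x \near z, is_derive (0 : R) 1 (fun t => g (x + t%:C *: u)) (du x)) ->
  (\forall x \near z, is_derive (0 : R) 1 (fun t => g (x + t%:C *: v)) (dv x)) ->
  (\forall x \near z, is_derive (0 : R) 1 (fun t => du (x + t%:C *: v)) (duv x)) ->
  (\forall x \near z, is_derive (0 : R) 1 (fun t => dv (x + t%:C *: u)) (dvu x)) ->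
  {for z, continuous duv} -> {for z, continuous dvu} -> duv z = dvu z.
Proof.
move=> hu hv huv hvu c1 c2; apply/eqP; rewrite -subr_eq0 -normr_eq0.
apply/negPn/negP => n0.
set e := `|duv z - dvu z| / 2.
have e0 : 0 < e by rewrite divr_gt0 // lt_neqAle eq_sym n0 /=.
have n1 := near_diff2 e0 hu huv c1.
have n2 := near_diff2 e0 hv hvu c2.
have [d /= d0 dB] := (@nbhs_ballP R R 0 _).1 (filterI n1 n2).
have [|[p h1 e1] [p' h2 e2]] := dB (d / 2).
  by rewrite /ball /= sub0r normrN gtr0_norm ?divr_gt0 // ltr_pdivrMr // mulr_natr mulr2n ltrDl.
have sym : diff2 g z u v (d / 2) = diff2 g z v u (d / 2).
  by rewrite /diff2 [z + _ + _]addrAC; ring.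
have t0 : d / 2 != 0 by rewrite gt_eqF // divr_gt0.
have pp : duv p = dvu p'.
  by apply: (mulIf t0); apply: (mulIf t0); rewrite -e1 -e2.
have : `|duv z - dvu z| < e + e.
  rewrite -(subrKA (duv p)) {2}pp; apply: (le_lt_trans (ler_normD _ _)).
  by rewrite ltrD // distrC.
by rewrite /e -splitr ltxx.
Qed.

End Paths.

(** * Wirtinger operators and differentiability classes *)

Section DirectionalDerivatives.
Context {R : realType} {V : normedModType R[i]}.
Implicit Types (A : set V) (f g : V -> R[i]) (z v w : V).

Lemma dir_derivableP f z v :
  dir_derivable f z v -> cder (line f z v) 0 (dir_deriv v f z).
Proof.
by move=> [h1 h2]; split; rewrite /dir_deriv /= derive1E; exact: derivableP.
Qed.

Lemma cder_derivable f z v d : cder (line f z v) 0 d -> dir_derivable f z v.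
Proof. by move=> [[h1 _] [h2 _]]; split. Qed.

Lemma cder_dir_deriv f z v d : cder (line f z v) 0 d -> dir_deriv v f z = d.
Proof.
by move=> h; apply: (cder_unique _ h); exact: dir_derivableP (cder_derivable h).
Qed.

Lemma dir_deriv_near f g z v : (\forall x \near z, f x = g x) ->
  dir_derivable f z v -> cder (line g z v) 0 (dir_deriv v f z).
Proof.
move=> h /dir_derivableP; apply: cder_near.
exact: near_line h.
Qed.

Definition derivable_at f z := forall v, dir_derivable f z v.

Lemma derivable_at_near f g z : (\forall x \near z, f x = g x) ->
  derivable_at f z -> derivable_at g z.
Proof. by move=> h df v; exact: cder_derivable (dir_deriv_near h (df v)). Qed.

Lemma dir_deriv_eq f g z v : (\forall x \near z, f x = g x) ->
  derivable_at f z -> dir_deriv v f z = dir_deriv v g z.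
Proof. by move=> h df; rewrite (cder_dir_deriv (dir_deriv_near h (df v))). Qed.

Lemma derivable_cst (a : R[i]) z : derivable_at (fun=> a) z.
Proof. by move=> v; apply: (@cder_derivable (fun=> a) z v 0); exact: cder_cst. Qed.

Lemma dir_deriv_cst (a : R[i]) z v : dir_deriv v (fun=> a) z = 0.
Proof. exact/cder_dir_deriv/cder_cst. Qed.

Lemma line0 f z v : line f z v 0 = f z.
Proof. by rewrite /line scale0r addr0. Qed.

Section Pointwise.
Variables (f g : V -> R[i]) (z : V).
Hypotheses (df : derivable_at f z) (dg : derivable_at g z).

Let cf v := dir_derivableP (df v).
Let cg v := dir_derivableP (dg v).

Let cD v : cder (line (fun x => f x + g x) z v) 0
  (dir_deriv v f z + dir_deriv v g z).
Proof. exact: cderD (cf v) (cg v). Qed.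
Lemma derivable_add : derivable_at (fun x => f x + g x) z.
Proof. by move=> v; exact: cder_derivable (cD v). Qed.
Lemma dir_derivD v :
  dir_deriv v (fun x => f x + g x) z = dir_deriv v f z + dir_deriv v g z.
Proof. exact: cder_dir_deriv (cD v). Qed.

Let cM v : cder (line (fun x => f x * g x) z v) 0
  (dir_deriv v f z * g z + f z * dir_deriv v g z).
Proof. by have := cderM (cf v) (cg v); rewrite !line0. Qed.
Lemma derivable_mul : derivable_at (fun x => f x * g x) z.
Proof. by move=> v; exact: cder_derivable (cM v). Qed.
Lemma dir_derivM v : dir_deriv v (fun x => f x * g x) z =
  dir_deriv v f z * g z + f z * dir_deriv v g z.
Proof. exact: cder_dir_deriv (cM v). Qed.

Let cJ v : cder (line (fun x => Num.conj (f x)) z v) 0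
  (Num.conj (dir_deriv v f z)).
Proof. exact: cderJ (cf v). Qed.
Lemma derivable_conj : derivable_at (fun x => Num.conj (f x)) z.
Proof. by move=> v; exact: cder_derivable (cJ v). Qed.
Lemma dir_derivJ v :
  dir_deriv v (fun x => Num.conj (f x)) z = Num.conj (dir_deriv v f z).
Proof. exact: cder_dir_deriv (cJ v). Qed.

Hypothesis f0 : f z != 0.
Let cV v : cder (line (fun x => (f x)^-1) z v) 0 (- dir_deriv v f z / f z ^+ 2).
Proof. by have := cderV (cf v); rewrite !line0; apply. Qed.
Lemma derivable_inv : derivable_at (fun x => (f x)^-1) z.
Proof. by move=> v; exact: cder_derivable (cV v). Qed.
Lemma dir_derivV v :
  dir_deriv v (fun x => (f x)^-1) z = - dir_deriv v f z / f z ^+ 2.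
Proof. exact: cder_dir_deriv (cV v). Qed.

End Pointwise.

Lemma derivable_sum (I : Type) (r : seq I) (F : I -> V -> R[i]) z :
  (forall i, derivable_at (F i) z) ->
  derivable_at (fun x => \sum_(i <- r) F i x) z.
Proof.
move=> dF; elim: r => [|i r IH].
  rewrite (_ : (fun x => _) = fun=> 0); first exact: derivable_cst.
  by apply/funext => x; rewrite big_nil.
rewrite (_ : (fun x => _) = fun x => F i x + \sum_(i <- r) F i x).
  exact: derivable_add.
by apply/funext => x; rewrite big_cons.
Qed.

Lemma dir_deriv_sum (I : Type) (r : seq I) (F : I -> V -> R[i]) z v :
  (forall i, derivable_at (F i) z) ->
  dir_deriv v (fun x => \sum_(i <- r) F i x) z = \sum_(i <- r) dir_deriv v (F i) z.
Proof.
move=> dF; elim: r => [|i r IH].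
  rewrite big_nil (_ : (fun x => _) = fun=> 0); first exact: dir_deriv_cst.
  by apply/funext => x; rewrite big_nil.
have -> : (fun x => \sum_(j <- i :: r) F j x) = fun x => F i x + \sum_(j <- r) F j x.
  by apply/funext => x; rewrite big_cons.
rewrite big_cons -IH; exact: dir_derivD (dF i) (derivable_sum r dF) v.
Qed.

End DirectionalDerivatives.

(** The Wirtinger operators [del] and [delbar] are both of this form, which
lets their common rules be proved once; [s] is [- 'i] and ['i] respectively. *)
Definition wirt {R : realType} {V : normedModType R[i]} (s : R[i]) (v : V)
    (f : V -> R[i]) : V -> R[i] :=
  fun z => (dir_deriv v f z + s * dir_deriv ('i%C *: v) f z) / 2.

Section Wirtinger.
Context {R : realType} {V : normedModType R[i]}.
Implicit Types (f g : V -> R[i]) (z v w : V) (s : R[i]).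

Lemma delE v f z : del v f z = wirt (- 'i%C) v f z.
Proof. by rewrite /del /wirt mulNr. Qed.

Lemma delbarE v f z : delbar v f z = wirt 'i%C v f z.
Proof. by []. Qed.

Lemma wirt_near s v f g z : (\forall x \near z, f x = g x) ->
  derivable_at f z -> wirt s v f z = wirt s v g z.
Proof. by move=> h df; rewrite /wirt !(dir_deriv_eq _ h df). Qed.

Lemma wirt_cst s v a z : wirt s v (fun=> a) z = 0.
Proof. by rewrite /wirt !dir_deriv_cst mulr0 addr0 mul0r. Qed.

Lemma wirtD s v f g z : derivable_at f z -> derivable_at g z ->
  wirt s v (fun x => f x + g x) z = wirt s v f z + wirt s v g z.
Proof. by move=> df dg; rewrite /wirt !dir_derivD //; ring. Qed.

Lemma wirtM s v f g z : derivable_at f z -> derivable_at g z ->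
  wirt s v (fun x => f x * g x) z = wirt s v f z * g z + f z * wirt s v g z.
Proof. by move=> df dg; rewrite /wirt !dir_derivM //; ring. Qed.

Lemma wirtV s v f z : derivable_at f z -> f z != 0 ->
  wirt s v (fun x => (f x)^-1) z = - wirt s v f z / f z ^+ 2.
Proof. by move=> df f0; rewrite /wirt !dir_derivV //; field. Qed.

Lemma wirtJ s v f z : derivable_at f z ->
  wirt s v (fun x => Num.conj (f x)) z = Num.conj (wirt (Num.conj s) v f z).
Proof.
move=> df; rewrite /wirt !dir_derivJ // !(rmorphM, rmorphD) /= conjCK.
by rewrite fmorphV rmorph_nat.
Qed.

Lemma wirt_sum s v (I : Type) (r : seq I) (F : I -> V -> R[i]) z :
  (forall i, derivable_at (F i) z) ->
  wirt s v (fun x => \sum_(i <- r) F i x) z = \sum_(i <- r) wirt s v (F i) z.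
Proof.
move=> dF; rewrite /wirt !dir_deriv_sum // mulr_sumr -big_split mulr_suml /=.
by apply: eq_bigr.
Qed.

Lemma conji : Num.conj ('i%C : R[i]) = - 'i%C.
Proof. by rewrite /Num.conj /=; congr Complex; rewrite oppr0. Qed.

Lemma delJ v f z : derivable_at f z ->
  del v (fun x => Num.conj (f x)) z = Num.conj (delbar v f z).
Proof. by move=> df; rewrite delE wirtJ // rmorphN /= conji opprK. Qed.

Lemma delbarJ v f z : derivable_at f z ->
  delbar v (fun x => Num.conj (f x)) z = Num.conj (del v f z).
Proof. by move=> df; rewrite delE delbarE wirtJ // conji. Qed.

End Wirtinger.

Section DifferentiabilityClasses.
Context {R : realType} {V : normedModType R[i]}.
Implicit Types (A : set V) (f g : V -> R[i]) (z v w : V) (n : nat).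

(** Smoothness is a statement about all words of directions, which does not lend
itself to induction; the classes of finite order do, and smooth functions belong
to all of them. *)
Fixpoint class_Cn n A f : Prop :=
  (forall z, A z -> {for z, continuous f}) /\
  if n is n'.+1 then
    (forall z, A z -> derivable_at f z) /\
    forall v, class_Cn n' A (dir_deriv v f)
  else True.

Lemma Cn_continuous n A f z : class_Cn n A f -> A z -> {for z, continuous f}.
Proof. by case: n => [|n] [h _]; apply: h. Qed.

Lemma Cn_derivable n A f z : class_Cn n.+1 A f -> A z -> derivable_at f z.
Proof. by move=> [_ [h _]]; apply: h. Qed.

Lemma Cn_dir_deriv n A f v : class_Cn n.+1 A f -> class_Cn n A (dir_deriv v f).
Proof. by move=> [_ [_ h]]; exact: h. Qed.

Lemma CnW n A f : class_Cn n.+1 A f -> class_Cn n A f.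
Proof.
elim: n f => [|n IH] f h; [by split=> // z; exact: Cn_continuous h|].
split; [by move=> z; exact: Cn_continuous h|].
split; [by move=> z; exact: Cn_derivable h|].
by move=> v; apply: IH; exact: Cn_dir_deriv.
Qed.

Lemma Cn_sub n A A' f : A' `<=` A -> class_Cn n A f -> class_Cn n A' f.
Proof.
move=> s; elim: n f => [|n IH] f h; [by split=> // z /s; exact: Cn_continuous h|].
split; [by move=> z /s; exact: Cn_continuous h|].
split; [by move=> z /s; exact: Cn_derivable h|].
by move=> v; apply: IH; exact: Cn_dir_deriv.
Qed.

Lemma smooth_Cn n A f : smooth_on A f -> class_Cn n A f.
Proof.
elim: n f => [|n IH] f h; [by split=> // z Az; case: (h [::] z Az)|].
split; [by move=> z Az; case: (h [::] z Az)|].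
split; [by move=> z Az v; case: (h [::] z Az) => _; apply|].
by move=> v; apply: IH => s z Az; have := h (rcons s v) z Az; rewrite foldr_rcons.
Qed.

Lemma Cn_eq n A f g : open A -> (forall z, A z -> f z = g z) ->
  class_Cn n A f -> class_Cn n A g.
Proof.
move=> oA; have nr z : A z -> forall h k : V -> R[i], (forall z, A z -> h z = k z) ->
    \forall x \near z, h x = k x.
  by move=> Az h k hk; apply: filterS (open_nbhs_nbhs (conj oA Az)).
have cont (h k : V -> R[i]) : (forall z, A z -> h z = k z) -> forall z, A z ->
    {for z, continuous h} -> {for z, continuous k}.
  move=> hk z Az ch; suff: k @ z --> k z by [].
  rewrite -hk //.
  apply: cvg_trans ch; apply: near_eq_cvg.
  exact: (nr z Az _ _ hk).
elim: n f g => [|n IH] f g fg h.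
  by split=> // z Az; exact: cont (Cn_continuous h Az).
split; [by move=> z Az; exact: cont (Cn_continuous h Az)|].
split; [by move=> z Az; exact: derivable_at_near (nr z Az _ _ fg) (Cn_derivable h Az)|].
move=> v; apply: IH (Cn_dir_deriv v h) => z Az.
exact: dir_deriv_eq (nr z Az _ _ fg) (Cn_derivable h Az).
Qed.

Lemma Cn_cst n A a : class_Cn n A (fun=> a).
Proof.
elim: n a => [|n IH] a; [by split=> // z _; exact: cvg_cst|].
split; [by move=> z _; exact: cvg_cst|].
split; [by move=> z _; exact: derivable_cst|].
move=> v; rewrite (_ : dir_deriv v _ = fun=> 0) //.
by apply/funext => z; exact: dir_deriv_cst.
Qed.

Lemma CnD n A f g : open A -> class_Cn n A f -> class_Cn n A g ->
  class_Cn n A (fun x => f x + g x).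
Proof.
move=> oA; elim: n f g => [|n IH] f g hf hg.
  by split=> // z Az; exact: (cvgD (Cn_continuous hf Az) (Cn_continuous hg Az)).
split; [by move=> z Az; exact: (cvgD (Cn_continuous hf Az) (Cn_continuous hg Az))|].
split; [by move=> z Az; exact: derivable_add (Cn_derivable hf Az) (Cn_derivable hg Az)|].
move=> v; apply: Cn_eq (IH _ _ (Cn_dir_deriv v hf) (Cn_dir_deriv v hg)) => // z Az.
by rewrite dir_derivD //; [exact: Cn_derivable hf Az | exact: Cn_derivable hg Az].
Qed.

Lemma CnM n A f g : open A -> class_Cn n A f -> class_Cn n A g ->
  class_Cn n A (fun x => f x * g x).
Proof.
move=> oA; elim: n f g => [|n IH] f g hf hg.
  by split=> // z Az; exact: (cvgM (Cn_continuous hf Az) (Cn_continuous hg Az)).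
split; [by move=> z Az; exact: (cvgM (Cn_continuous hf Az) (Cn_continuous hg Az))|].
split; [by move=> z Az; exact: derivable_mul (Cn_derivable hf Az) (Cn_derivable hg Az)|].
move=> v; apply: Cn_eq (CnD oA (IH _ _ (Cn_dir_deriv v hf) (CnW hg))
   (IH _ _ (CnW hf) (Cn_dir_deriv v hg))) => // z Az.
by rewrite dir_derivM //; [exact: Cn_derivable hf Az | exact: Cn_derivable hg Az].
Qed.

Lemma continuous_conj f z : {for z, continuous f} ->
  {for z, continuous (fun x => Num.conj (f x))}.
Proof.
move=> hf; have hc : {for f z, continuous (fun x : R[i] => Num.conj x)}; last first.
  exact: (cvg_comp f _ hf hc).
apply/(@cvgrPdist_lt _ _ _ (nbhs _) _) => /= e e0.
apply/nbhs_normP; exists e => //= y.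
by rewrite /ball_ /= -rmorphB norm_conjC.
Qed.

Lemma CnJ n A f : open A -> class_Cn n A f ->
  class_Cn n A (fun x => Num.conj (f x)).
Proof.
move=> oA; elim: n f => [|n IH] f hf.
  by split=> // z Az; exact: continuous_conj (Cn_continuous hf Az).
split; [by move=> z Az; exact: continuous_conj (Cn_continuous hf Az)|].
split; [by move=> z Az; exact: derivable_conj (Cn_derivable hf Az)|].
move=> v; apply: Cn_eq (IH _ (Cn_dir_deriv v hf)) => // z Az.
by rewrite dir_derivJ //; exact: Cn_derivable hf Az.
Qed.

Lemma CnV n A f : open A -> class_Cn n A f -> (forall z, A z -> f z != 0) ->
  class_Cn n A (fun x => (f x)^-1).
Proof.
move=> oA hf f0.
have cV z : A z -> {for z, continuous (fun x => (f x)^-1)}.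
  by move=> Az; exact: (cvgV (f0 z Az) (Cn_continuous hf Az)).
elim: n hf => [|n IH] hf; first by split.
split=> //.
split; [by move=> z Az; exact: derivable_inv (Cn_derivable hf Az) (f0 z Az)|].
move=> v; have h := IH (CnW hf).
have hN := CnM oA (Cn_cst n A (-1)) (Cn_dir_deriv v hf).
apply: Cn_eq (CnM oA hN (CnM oA h h)) => // z Az.
rewrite dir_derivV //; [|exact: Cn_derivable hf Az|exact: f0].
by rewrite /= mulN1r -expr2 exprVn.
Qed.

Lemma Cn_sum n A (I : Type) (r : seq I) (P : pred I) (F : I -> V -> R[i]) :
  open A -> (forall i, class_Cn n A (F i)) ->
  class_Cn n A (fun x => \sum_(i <- r | P i) F i x).
Proof.
move=> oA hF; elim: r => [|i r IH].
  by apply: Cn_eq (Cn_cst n A 0) => // z _; rewrite big_nil.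
apply: (@Cn_eq _ _ (fun x => (if P i then F i x else 0) + \sum_(i <- r | P i) F i x)) => //.
  by move=> z _; rewrite big_cons; case: ifP => //; rewrite add0r.
by apply: CnD => //; case: (P i) => //; exact: Cn_cst.
Qed.

Lemma Cn_prod n A (I : Type) (r : seq I) (F : I -> V -> R[i]) :
  open A -> (forall i, class_Cn n A (F i)) ->
  class_Cn n A (fun x => \prod_(i <- r) F i x).
Proof.
move=> oA hF; elim: r => [|i r IH].
  by apply: Cn_eq (Cn_cst n A 1) => // z _; rewrite big_nil.
apply: (@Cn_eq _ _ (fun x => F i x * \prod_(i <- r) F i x)) => //; last exact: CnM.
by move=> z _; rewrite big_cons.
Qed.

Lemma Cn_wirt s n A f v : open A -> class_Cn n.+1 A f -> class_Cn n A (wirt s v f).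
Proof.
move=> oA h; apply: (CnM oA _ (Cn_cst n A _)).
apply: (CnD oA); first exact: Cn_dir_deriv.
by apply: CnM => //; [exact: Cn_cst | exact: Cn_dir_deriv].
Qed.

Lemma Cn_del n A f v : open A -> class_Cn n.+1 A f -> class_Cn n A (del v f).
Proof.
by move=> oA h; apply: Cn_eq (Cn_wirt (- 'i%C) v oA h) => // z _; rewrite delE.
Qed.

Lemma Cn_delbar n A f v : open A -> class_Cn n.+1 A f -> class_Cn n A (delbar v f).
Proof. exact: Cn_wirt. Qed.

End DifferentiabilityClasses.

(** * Chain rule and commutation of Wirtinger operators *)

(* From here on only the rules are used; keeping the operators folded keeps
unification fast. *)
Opaque dir_deriv.

Section ChainRule.
Context {R : realType} {V : normedModType R[i]}.
Implicit Types (A : set V) (f : V -> R[i]) (z u v w : V).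

(** Continuous differentiability at a point: what the chain rule asks of the outer
function. *)
Definition C1_at f z := forall v, (\forall x \near z, dir_derivable f x v) /\
  {for z, continuous (dir_deriv v f)}.

Lemma Cn_C1_at A f z : open A -> class_Cn 1 A f -> A z -> C1_at f z.
Proof.
move=> oA h Az v; split.
  apply: filterS (open_nbhs_nbhs (conj oA Az)) => x Ax; exact: (Cn_derivable h Ax).
exact: Cn_continuous (Cn_dir_deriv v h) Az.
Qed.

Lemma cder_path (J : Type) (r : seq J) f z (u : J -> V) (c : J -> R -> R)
    (c' : J -> R) :
  C1_at f z -> (forall j, c j 0 = 0) ->
  (forall j, is_derive (0 : R) 1 (c j) (c' j)) ->
  cder (fun t => f (z + \sum_(j <- r) (c j t)%:C *: u j)) 0
    (\sum_(j <- r) (c' j)%:C * dir_deriv (u j) f z).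
Proof.
move=> hf c0 hc.
have ReZ : complex.Re (\sum_(j <- r) (c' j)%:C * dir_deriv (u j) f z) =
    \sum_(j <- r) c' j * complex.Re (dir_deriv (u j) f z).
  by elim: r => [|j s IH]; rewrite ?big_nil // !big_cons ReD ReM /= mul0r subr0 IH.
have ImZ : complex.Im (\sum_(j <- r) (c' j)%:C * dir_deriv (u j) f z) =
    \sum_(j <- r) c' j * complex.Im (dir_deriv (u j) f z).
  by elim: r {ReZ} => [|j s IH]; rewrite ?big_nil // !big_cons ImD ImM /= mul0r addr0 IH.
split.
  rewrite ReZ.
  apply: (@is_derive_path _ _ _ r (fun x => complex.Re (f x))
     (fun j x => complex.Re (dir_deriv (u j) f x))) => // j.
    by have [h _] := hf (u j); apply: filterS h => x /dir_derivableP [].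
  have [_ h] := hf (u j).
  by apply: continuous_comp h _; exact: continuous_Re.
rewrite ImZ.
apply: (@is_derive_path _ _ _ r (fun x => complex.Im (f x))
   (fun j x => complex.Im (dir_deriv (u j) f x))) => // j.
  by have [h _] := hf (u j); apply: filterS h => x /dir_derivableP [].
have [_ h] := hf (u j).
by apply: continuous_comp h _; exact: continuous_Im.
Qed.

Lemma mixed_dir_deriv A f z u v : open A -> class_Cn 2 A f -> A z ->
  dir_deriv u (dir_deriv v f) z = dir_deriv v (dir_deriv u f) z.
Proof.
move=> oA hf Az.
have near_A (P : V -> Prop) : (forall x, A x -> P x) -> \forall x \near z, P x.
  by move=> h; apply: filterS (open_nbhs_nbhs (conj oA Az)).
have d1 w x : A x -> cder (line f x w) 0 (dir_deriv w f x).
  by move=> Ax; apply: dir_derivableP; exact: (Cn_derivable hf Ax).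
have d2 w w' x : A x -> cder (line (dir_deriv w f) x w') 0 (dir_deriv w' (dir_deriv w f) x).
  by move=> Ax; apply: dir_derivableP; exact: (Cn_derivable (Cn_dir_deriv w hf) Ax).
have c2 w w' : {for z, continuous (dir_deriv w' (dir_deriv w f))}.
  exact: (Cn_continuous (Cn_dir_deriv w' (Cn_dir_deriv w hf)) Az).
have e1 : complex.Re (dir_deriv u (dir_deriv v f) z) = complex.Re (dir_deriv v (dir_deriv u f) z).
  apply: (@mixed_derivatives_eq R V (fun x => complex.Re (f x))
    (fun x => complex.Re (dir_deriv v f x)) (fun x => complex.Re (dir_deriv u f x))
    (fun x => complex.Re (dir_deriv u (dir_deriv v f) x))
    (fun x => complex.Re (dir_deriv v (dir_deriv u f) x)) z v u).
  1-2: by apply: near_A => x Ax; exact: (d1 _ x Ax).1.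
  1-2: by apply: near_A => x Ax; exact: (d2 _ _ x Ax).1.
  1-2: by apply: continuous_comp; [exact: c2 | exact: continuous_Re].
have e2 : complex.Im (dir_deriv u (dir_deriv v f) z) = complex.Im (dir_deriv v (dir_deriv u f) z).
  apply: (@mixed_derivatives_eq R V (fun x => complex.Im (f x))
    (fun x => complex.Im (dir_deriv v f x)) (fun x => complex.Im (dir_deriv u f x))
    (fun x => complex.Im (dir_deriv u (dir_deriv v f) x))
    (fun x => complex.Im (dir_deriv v (dir_deriv u f) x)) z v u).
  1-2: by apply: near_A => x Ax; exact: (d1 _ x Ax).2.
  1-2: by apply: near_A => x Ax; exact: (d2 _ _ x Ax).2.
  1-2: by apply: continuous_comp; [exact: c2 | exact: continuous_Im].
move: e1 e2; move: (dir_deriv u _ z) (dir_deriv v _ z) => [? ?] [? ?] /= -> ->.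
by [].
Qed.

Lemma dir_deriv_wirt s A f z u v : open A -> class_Cn 2 A f -> A z ->
  dir_deriv u (wirt s v f) z = wirt s v (dir_deriv u f) z.
Proof.
move=> oA hf Az.
have d w : derivable_at (dir_deriv w f) z.
  exact: (Cn_derivable (Cn_dir_deriv w hf) Az).
have dc (a : R[i]) : derivable_at (fun=> a) z := derivable_cst a z.
have dm := derivable_mul (dc s) (d ('i%C *: v)).
rewrite /wirt (dir_derivM (derivable_add (d v) dm) (dc _)) (dir_derivD (d v) dm).
rewrite (dir_derivM (dc s) (d ('i%C *: v))) !dir_deriv_cst.
rewrite -(mixed_dir_deriv u v oA hf Az) -(mixed_dir_deriv u ('i%C *: v) oA hf Az).
move: (dir_deriv u _ z) (dir_deriv u _ z) => a b.
ring.
Qed.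

(** Consequence of the symmetry of second derivatives; it makes the curvature a
commutator and kills [delbar (del f)] for holomorphic [f]. *)
Lemma wirt_wirt s s' A f z u v : open A -> class_Cn 2 A f -> A z ->
  wirt s u (wirt s' v f) z = wirt s' v (wirt s u f) z.
Proof.
move=> oA hf Az.
rewrite {1}/wirt (dir_deriv_wirt s' u v oA hf Az).
rewrite (dir_deriv_wirt s' ('i%C *: u) v oA hf Az).
have d w : derivable_at (dir_deriv w f) z.
  exact: (Cn_derivable (Cn_dir_deriv w hf) Az).
have dc (a : R[i]) : derivable_at (fun=> a) z := derivable_cst a z.
pose dm := derivable_mul (dc s) (d ('i%C *: u)).
pose dp := derivable_add (d u) dm.
have e w : dir_deriv w (wirt s u f) z =
    (dir_deriv w (dir_deriv u f) z + s * dir_deriv w (dir_deriv ('i%C *: u) f) z) / 2.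
  rewrite /wirt (dir_derivM dp (dc _)) (dir_derivD (d u) dm).
  rewrite (dir_derivM (dc s) (d ('i%C *: u))) !dir_deriv_cst.
  by rewrite mulr0 addr0 mul0r add0r.
have -> : wirt s' v (wirt s u f) z = (dir_deriv v (wirt s u f) z +
    s' * dir_deriv ('i%C *: v) (wirt s u f) z) / 2 by [].
rewrite (e v) (e ('i%C *: v)) /wirt.
move: (dir_deriv v (dir_deriv u f) z) (dir_deriv v (dir_deriv ('i%C *: u) f) z).
move: (dir_deriv ('i%C *: v) (dir_deriv u f) z).
move: (dir_deriv ('i%C *: v) (dir_deriv ('i%C *: u) f) z) => a b c d'.
ring.
Qed.

End ChainRule.

Section ChainRuleC2.
Context {R : realType}.
Implicit Types (f : 'rV[R[i]]_2 -> R[i]).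

Lemma row2_real_coordinates (x y : 'rV[R[i]]_2) : y = x +
  \sum_(p : 'I_2 * bool) (if p.2 then complex.Im (y 0 p.1 - x 0 p.1)
     else complex.Re (y 0 p.1 - x 0 p.1))%:C *:
     ((if p.2 then 'i%C else 1) *: evec p.1 : 'rV[R[i]]_2).
Proof.
rewrite -(pair_bigA _ (fun a (b : bool) => (if b then complex.Im (y 0 a - x 0 a)
     else complex.Re (y 0 a - x 0 a))%:C *:
     ((if b then 'i%C else 1) *: evec a : 'rV[R[i]]_2))) /=.
apply/rowP => k; rewrite mxE summxE (bigD1 k) //= [X in _ + (_ + X)]big1 ?addr0; last first.
  move=> a ak; rewrite summxE big_bool !mxE /= [k == a]eq_sym (negbTE ak).
  by rewrite !mulr0 addr0.
rewrite summxE big_bool !mxE /= eqxx !mulr1.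
by rewrite [_ * 'i%C]mulrC [X in _ + X]addrC -complexE addrC subrK.
Qed.

(** The derivative of [f] along any curve splits into a part linear in the
velocity, given by [del f], and a part antilinear in it, given by [delbar f]. *)
Lemma cder_comp f (gam : R -> 'rV[R[i]]_2) (gam' : 'I_2 -> R[i]) :
  C1_at f (gam 0) -> (forall a, cder (fun t => gam t 0 a) 0 (gam' a)) ->
  cder (fun t => f (gam t)) 0
    (\sum_a (del (evec a) f (gam 0) * gam' a +
             delbar (evec a) f (gam 0) * Num.conj (gam' a))).
Proof.
move=> hf hg.
pose c (p : 'I_2 * bool) (t : R) := if p.2 then complex.Im (gam t 0 p.1 - gam 0 0 p.1)
     else complex.Re (gam t 0 p.1 - gam 0 0 p.1).
pose c' (p : 'I_2 * bool) := if p.2 then complex.Im (gam' p.1) else complex.Re (gam' p.1).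
have c0 p : c p 0 = 0 by rewrite /c subrr; case: ifP.
have hc p : is_derive (0 : R) 1 (c p) (c' p).
  have [h1 h2] := cderD (hg p.1) (cder_cst (- gam 0 0 p.1) 0).
  by rewrite addr0 in h1 h2; rewrite /c /c'; case: ifP => _.
have := @cder_path R _ _ (index_enum _) f (gam 0)
  (fun p => (if p.2 then 'i%C else 1) *: evec p.1 : 'rV[R[i]]_2) c c' hf c0 hc.
rewrite (_ : (fun t => f _) = fun t => f (gam t)); last first.
  by apply/funext => t; rewrite -row2_real_coordinates.
congr (cder _ _ _).
rewrite -(pair_bigA _ (fun a (b : bool) => (c' (a, b))%:C *
  dir_deriv ((if b then 'i%C else 1) *: evec a : 'rV[R[i]]_2) f (gam 0))) /=.
apply: eq_bigr => a _; rewrite big_bool /c' /= scale1r /del /delbar.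
set p := dir_deriv _ _ _; set q := dir_deriv _ _ _.
rewrite {3}[gam' a]complexE [in Num.conj _](complexE (gam' a)).
rewrite rmorphD rmorphM /= conji.
have cr (x : R) : Num.conj (x%:C) = x%:C :> R[i] by exact: conjc_real.
rewrite !cr; have i2 : 'i%C * 'i%C = -1 :> R[i] by rewrite -expr2 sqr_i.
by field: i2.
Qed.

End ChainRuleC2.

(** * Calculus of matrix-valued functions *)

Section Composition.
Context {R : realType} {W : normedModType R[i]}.
Variables (f : 'rV[R[i]]_2 -> R[i]) (phi : W -> 'rV[R[i]]_2) (z : W).
Hypotheses (hf : C1_at f (phi z)) (hphi : forall a, derivable_at (fun x => phi x 0 a) z).

Lemma cder_line_comp v : cder (line (f \o phi) z v) 0
  (\sum_a (del (evec a) f (phi z) * dir_deriv v (fun x => phi x 0 a) z +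
     delbar (evec a) f (phi z) * Num.conj (dir_deriv v (fun x => phi x 0 a) z))).
Proof.
have e0 : phi (z + (0 : R)%:C *: v) = phi z by rewrite scale0r addr0.
have := @cder_comp R f (fun t => phi (z + t%:C *: v))
  (fun a => dir_deriv v (fun x => phi x 0 a) z).
rewrite e0; apply => // a.
exact: (dir_derivableP (hphi a v)).
Qed.

Lemma derivable_comp : derivable_at (f \o phi) z.
Proof. by move=> v; exact: cder_derivable (cder_line_comp v). Qed.

(** Without holomorphy of [phi], the conjugate coordinates contribute through the
conjugate operator. *)
Lemma wirt_comp s v : wirt s v (f \o phi) z =
  \sum_a (del (evec a) f (phi z) * wirt s v (fun x => phi x 0 a) z +
     delbar (evec a) f (phi z) * Num.conj (wirt (Num.conj s) v (fun x => phi x 0 a) z)).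
Proof.
have e w := cder_dir_deriv (cder_line_comp w).
rewrite {1}/wirt (e v) (e ('i%C *: v)) mulr_sumr -big_split mulr_suml /=.
apply: eq_bigr => a _.
rewrite /wirt !(rmorphM, rmorphD) /= conjCK fmorphV rmorph_nat.
move: (dir_deriv v _ z) (dir_deriv ('i%C *: v) _ z) => p q.
by field.
Qed.

Hypothesis hol : forall a v, delbar v (fun x => phi x 0 a) z = 0.

Lemma del_comp v : del v (f \o phi) z =
  \sum_a del (evec a) f (phi z) * del v (fun x => phi x 0 a) z.
Proof.
rewrite delE wirt_comp; apply: eq_bigr => a _.
by rewrite -delE rmorphN /= conji opprK -delbarE hol rmorph0 mulr0 addr0.
Qed.

Lemma delbar_comp v : delbar v (f \o phi) z =
  \sum_a delbar (evec a) f (phi z) * Num.conj (del v (fun x => phi x 0 a) z).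
Proof.
rewrite delbarE wirt_comp; apply: eq_bigr => a _.
by rewrite -delbarE hol mulr0 add0r conji -delE.
Qed.

End Composition.

Section DirectionC2.
Context {R : realType}.

Lemma dir_deriv_wirtinger (f : 'rV[R[i]]_2 -> R[i]) (z v : 'rV[R[i]]_2) : C1_at f z ->
  dir_deriv v f z = \sum_a (del (evec a) f z * v 0 a +
    delbar (evec a) f z * Num.conj (v 0 a)).
Proof.
move=> hf.
have e0 : z + (0 : R)%:C *: v = z by rewrite scale0r addr0.
apply: cder_dir_deriv.
have := @cder_comp R f (fun t => z + t%:C *: v) (fun a => v 0 a).
rewrite e0; apply => // a.
have h := cderD (cder_cst (z 0 a) 0) (cderM (cder_real (is_derive_id (0 : R) 1)) (cder_cst (v 0 a) 0)).
rewrite add0r mulr0 addr0 mul1r in h.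
by move: h; congr (cder _ _ _); apply/funext => t; rewrite !mxE.
Qed.

End DirectionC2.

Section AffineCurve.
Context {R : realType}.

Lemma dir_deriv_affine (a b z v : R[i]) : cder (line (fun x : R[i] => a + x * b) z v) 0 (v * b).
Proof.
have h := cderD (cder_cst a 0) (cderM (cderD (cder_cst z 0)
  (cderM (cder_real (is_derive_id (0 : R) 1)) (cder_cst v 0))) (cder_cst b 0)).
rewrite mul1r mulr0 addr0 mulr0 addr0 !add0r in h.
exact: h.
Qed.

Lemma wirt_affine (s a b z v : R[i]) :
  derivable_at (fun x : R[i] => a + x * b) z /\
  wirt s v (fun x : R[i] => a + x * b) z = (1 + s * 'i%C) / 2 * (v * b).
Proof.
split=> [w|]; first exact: cder_derivable (dir_deriv_affine a b z w).
rewrite /wirt (cder_dir_deriv (dir_deriv_affine a b z v)).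
rewrite (cder_dir_deriv (dir_deriv_affine a b z ('i%C *: v))).
by rewrite /GRing.scale /=; ring.
Qed.

End AffineCurve.

Section MatrixCalculus.
Context {R : realType} {V : normedModType R[i]}.
Implicit Types (A : set V) (z v w : V).

Definition derivable_mx {p q} (F : V -> 'M[R[i]]_(p, q)) z :=
  forall i j, derivable_at (fun x => F x i j) z.

Definition wirt_mx {p q} (s : R[i]) v (F : V -> 'M[R[i]]_(p, q)) : V -> 'M[R[i]]_(p, q) :=
  fun z => \matrix_(i, j) wirt s v (fun x => F x i j) z.

Definition class_Cn_mx {p q} n A (F : V -> 'M[R[i]]_(p, q)) :=
  forall i j, class_Cn n A (fun x => F x i j).

Lemma del_mxE p q v (F : V -> 'M[R[i]]_(p, q)) z :
  del_mx v F z = wirt_mx (- 'i%C) v F z.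
Proof. by apply/matrixP => i j; rewrite !mxE delE. Qed.

Lemma delbar_mxE p q v (F : V -> 'M[R[i]]_(p, q)) z :
  delbar_mx v F z = wirt_mx 'i%C v F z.
Proof. by apply/matrixP => i j; rewrite !mxE delbarE. Qed.

Lemma wirt_mx_near p q s v (F G : V -> 'M[R[i]]_(p, q)) z :
  (\forall x \near z, F x = G x) -> derivable_mx F z ->
  wirt_mx s v F z = wirt_mx s v G z.
Proof.
move=> h dF; apply/matrixP => i j; rewrite !mxE.
by apply: wirt_near (dF i j); apply: filterS h => x ->.
Qed.

Lemma derivable_mx_near p q (F G : V -> 'M[R[i]]_(p, q)) z :
  (\forall x \near z, F x = G x) -> derivable_mx F z -> derivable_mx G z.
Proof.
move=> h dF i j; apply: derivable_at_near (dF i j).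
by apply: filterS h => x ->.
Qed.

Lemma wirt_mx_cst p q s v (a : 'M[R[i]]_(p, q)) z : wirt_mx s v (fun=> a) z = 0.
Proof. by apply/matrixP => i j; rewrite !mxE wirt_cst. Qed.

Lemma derivable_mx_cst p q (a : 'M[R[i]]_(p, q)) z : derivable_mx (fun=> a) z.
Proof. by move=> i j; exact: derivable_cst. Qed.

Lemma derivable_mxD p q (F G : V -> 'M[R[i]]_(p, q)) z :
  derivable_mx F z -> derivable_mx G z -> derivable_mx (fun x => F x + G x) z.
Proof.
move=> dF dG i j; under eq_fun do rewrite mxE.
exact: derivable_add (dF i j) (dG i j).
Qed.

Lemma wirt_mxD p q s v (F G : V -> 'M[R[i]]_(p, q)) z :
  derivable_mx F z -> derivable_mx G z ->
  wirt_mx s v (fun x => F x + G x) z = wirt_mx s v F z + wirt_mx s v G z.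
Proof.
move=> dF dG; apply/matrixP => i j; rewrite !mxE.
under eq_fun do rewrite mxE.
exact: wirtD (dF i j) (dG i j).
Qed.

Lemma derivable_mxM p q r (F : V -> 'M[R[i]]_(p, q)) (G : V -> 'M[R[i]]_(q, r)) z :
  derivable_mx F z -> derivable_mx G z -> derivable_mx (fun x => F x *m G x) z.
Proof.
move=> dF dG i j; under eq_fun do rewrite mxE.
by apply: derivable_sum => k; exact: derivable_mul (dF i k) (dG k j).
Qed.

Lemma wirt_mxM p q r s v (F : V -> 'M[R[i]]_(p, q)) (G : V -> 'M[R[i]]_(q, r)) z :
  derivable_mx F z -> derivable_mx G z ->
  wirt_mx s v (fun x => F x *m G x) z =
    wirt_mx s v F z *m G z + F z *m wirt_mx s v G z.
Proof.
move=> dF dG; apply/matrixP => i j; rewrite !mxE -big_split /=.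
under eq_fun do rewrite mxE.
rewrite wirt_sum; last by move=> k; exact: derivable_mul (dF i k) (dG k j).
by apply: eq_bigr => k _; rewrite !mxE (wirtM _ _ (dF i k) (dG k j)).
Qed.

Lemma derivable_mxJ p q (F : V -> 'M[R[i]]_(p, q)) z :
  derivable_mx F z -> derivable_mx (fun x => (F x)^t*) z.
Proof.
move=> dF i j; under eq_fun do rewrite !mxE.
exact: derivable_conj (dF j i).
Qed.

Lemma wirt_mxJ p q s v (F : V -> 'M[R[i]]_(p, q)) z : derivable_mx F z ->
  wirt_mx s v (fun x => (F x)^t*) z = (wirt_mx (Num.conj s) v F z)^t*.
Proof.
move=> dF; apply/matrixP => i j; rewrite !mxE.
under eq_fun do rewrite !mxE.
exact: wirtJ (dF j i).
Qed.

Lemma wirt_invmx n s v (F : V -> 'M[R[i]]_n) z :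
  (\forall x \near z, F x \in unitmx) -> derivable_mx F z ->
  derivable_mx (fun x => invmx (F x)) z ->
  wirt_mx s v (fun x => invmx (F x)) z =
    - (invmx (F z) *m wirt_mx s v F z *m invmx (F z)).
Proof.
move=> hU dF dI.
have Uz : F z \in unitmx := nbhs_singleton hU.
have h : wirt_mx s v (fun x => F x *m invmx (F x)) z = 0.
  rewrite -(wirt_mx_cst s v 1%:M z); apply: wirt_mx_near (derivable_mxM dF dI).
  by apply: filterS hU => x Ux; rewrite mulmxV.
move: h; rewrite wirt_mxM // => /eqP; rewrite addrC addr_eq0 => /eqP h.
have := congr1 (mulmx (invmx (F z))) h; rewrite (mulKmx Uz) mulmxN mulmxA.
exact: id.
Qed.

Lemma Cn_mx_derivable p q n A (F : V -> 'M[R[i]]_(p, q)) z :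
  class_Cn_mx n.+1 A F -> A z -> derivable_mx F z.
Proof. by move=> h Az i j; exact: Cn_derivable (h i j) Az. Qed.

Lemma Cn_mxW p q n A (F : V -> 'M[R[i]]_(p, q)) :
  class_Cn_mx n.+1 A F -> class_Cn_mx n A F.
Proof. by move=> h i j; exact: CnW. Qed.

Lemma Cn_mx_sub p q n A A' (F : V -> 'M[R[i]]_(p, q)) : A' `<=` A ->
  class_Cn_mx n A F -> class_Cn_mx n A' F.
Proof. by move=> s h i j; exact: Cn_sub s (h i j). Qed.

Lemma Cn_mxM p q r n A (F : V -> 'M[R[i]]_(p, q)) (G : V -> 'M[R[i]]_(q, r)) :
  open A -> class_Cn_mx n A F -> class_Cn_mx n A G ->
  class_Cn_mx n A (fun x => F x *m G x).
Proof.
move=> oA hF hG i j; under eq_fun do rewrite mxE.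
by apply: Cn_sum => // k; apply: CnM (hF i k) (hG k j).
Qed.

Lemma Cn_mxJ p q n A (F : V -> 'M[R[i]]_(p, q)) : open A ->
  class_Cn_mx n A F -> class_Cn_mx n A (fun x => (F x)^t*).
Proof.
move=> oA hF i j; under eq_fun do rewrite !mxE.
exact: CnJ (hF j i).
Qed.

Lemma Cn_mx_wirt p q s n A v (F : V -> 'M[R[i]]_(p, q)) : open A ->
  class_Cn_mx n.+1 A F -> class_Cn_mx n A (wirt_mx s v F).
Proof.
move=> oA h i j; under eq_fun do rewrite mxE.
exact: Cn_wirt (h i j).
Qed.

Lemma Cn_det n k A (F : V -> 'M[R[i]]_k) : open A -> class_Cn_mx n A F ->
  class_Cn n A (fun x => \det (F x)).
Proof.
move=> oA hF; rewrite /determinant; apply: Cn_sum => // s.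
apply: CnM => //; first exact: Cn_cst.
by apply: Cn_prod.
Qed.

Lemma Cn_invmx n k A (F : V -> 'M[R[i]]_k) : open A -> class_Cn_mx n A F ->
  (forall z, A z -> F z \in unitmx) -> class_Cn_mx n A (fun x => invmx (F x)).
Proof.
move=> oA hF U i j.
apply: (@Cn_eq _ _ _ _ (fun x => (\det (F x))^-1 * cofactor (F x) j i)) => //.
  by move=> z Az; rewrite /invmx U // !mxE.
apply: CnM => //.
  by apply: CnV (Cn_det oA hF) _ => // z Az; have := U z Az; rewrite unitmxE unitfE.
apply: CnM => //; first exact: Cn_cst.
apply: Cn_det => // a b; under eq_fun do rewrite !mxE.
exact: hF.
Qed.

Lemma wirt_mx_wirt_mx p q s s' A (F : V -> 'M[R[i]]_(p, q)) z u v : open A ->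
  class_Cn_mx 2 A F -> A z ->
  wirt_mx s u (wirt_mx s' v F) z = wirt_mx s' v (wirt_mx s u F) z.
Proof.
move=> oA hF Az; apply/matrixP => i j; rewrite [LHS]mxE [RHS]mxE.
have e a w : (fun x => wirt_mx a w F x i j) = wirt a w (fun x => F x i j).
  by apply/funext => x; rewrite mxE.
rewrite (e s' v) (e s u).
exact: wirt_wirt oA (hF i j) Az.
Qed.

End MatrixCalculus.

(** * Curvature of a Hermitian metric in a smooth frame *)

Section Adjoint.
Context {R : realType}.

Lemma adjmxM p q r (A : 'M[R[i]]_(p, q)) (B : 'M[R[i]]_(q, r)) :
  (A *m B)^t* = B^t* *m A^t*.
Proof. by rewrite trmx_mul map_mxM. Qed.

Lemma adjmxK p q (A : 'M[R[i]]_(p, q)) : (A^t*)^t* = A.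
Proof. by apply/matrixP => i j; rewrite !mxE conjCK. Qed.

Lemma adjmx_unit n (A : 'M[R[i]]_n) : (A^t* \in unitmx) = (A \in unitmx).
Proof. by rewrite map_unitmx unitmx_tr. Qed.

Lemma adjmx_inv n (A : 'M[R[i]]_n) : (invmx A)^t* = invmx (A^t*).
Proof. by rewrite trmx_inv map_invmx. Qed.

Lemma invmx_eq n (A B : 'M[R[i]]_n) : A *m B = 1%:M -> invmx A = B.
Proof.
move=> h; have [U _] := mulmx1_unit h.
by rewrite -[LHS]mulmx1 -h mulKmx.
Qed.

End Adjoint.

(* Stated over an arbitrary ring so that rewriting does not have to look inside
the complex numbers. *)
Section FrameAlgebra.
Variables (F : comUnitRingType) (n : nat).
Implicit Types B Gam Bs p q S : 'M[F]_n.

Lemma frame_conn_algebra B Gam Bs p q dG :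
  B \in unitmx -> Gam \in unitmx -> Bs \in unitmx ->
  (p *m Gam + B *m dG) *m Bs + B *m Gam *m q =
  (p *m invmx B + B *m (dG *m invmx Gam + Gam *m (q *m invmx Bs) *m invmx Gam) *m
     invmx B) *m (B *m Gam *m Bs).
Proof.
move=> UB UG Us; rewrite !mulmxDl !mulmxDr !mulmxDl !mulmxA !(mulmxKV UB).
by rewrite !(mulmxKV UG) (mulmxKV Us) addrA.
Qed.

Lemma frame_curv_algebra B p q ddB S dS : B \in unitmx ->
  - (ddB *m invmx B + p *m - (invmx B *m q *m invmx B) +
     ((q *m S + B *m dS) *m invmx B + B *m S *m - (invmx B *m q *m invmx B))) =
  B *m - (- (invmx B *m p *m invmx B) *m q + invmx B *m ddB + dS +
     invmx B *m q *m S - S *m (invmx B *m q)) *m invmx B.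
Proof.
move=> UB; rewrite !(mulmxN, mulNmx, mulmxDl, mulmxDr) !mulmxA !(mulmxV UB) !mul1mx.
congr (- _); rewrite -!addrA [in RHS]addrCA; congr (_ + _).
by congr (_ + _); rewrite addrCA.
Qed.

Lemma adjoint_conj_algebra B Bs M Ms Gam : B \in unitmx -> Bs \in unitmx ->
  (B *m M *m invmx B) *m ((B *m Gam *m Bs) *m (invmx Bs *m Ms *m Bs) *m
    (invmx Bs *m invmx Gam *m invmx B)) =
  B *m (M *m (Gam *m Ms *m invmx Gam)) *m invmx B.
Proof. by move=> U Us; rewrite !mulmxA (mulmxKV U) !(mulmxK Us). Qed.

End FrameAlgebra.

Section SmoothFrame.
Context {R : realType} {V : normedModType R[i]} {r : nat}.
Implicit Types (B Gam G : V -> 'M[R[i]]_r) (v w : V).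

Lemma del_mx_fun p q v (F : V -> 'M[R[i]]_(p, q)) : del_mx v F = wirt_mx (- 'i%C) v F.
Proof. by apply/funext => z; exact: del_mxE. Qed.

Lemma delbar_mx_fun p q v (F : V -> 'M[R[i]]_(p, q)) : delbar_mx v F = wirt_mx 'i%C v F.
Proof. by apply/funext => z; exact: delbar_mxE. Qed.

Lemma Cn_chern_conn n (A : set V) G v : open A -> class_Cn_mx n.+1 A G ->
  (forall x, A x -> G x \in unitmx) -> class_Cn_mx n A (chern_conn v G).
Proof.
move=> oA hG U; rewrite /chern_conn del_mx_fun.
by apply: Cn_mxM (Cn_mx_wirt _ _ oA hG) (Cn_invmx oA (Cn_mxW hG) U).
Qed.

(** If the frame with Gram matrix [Gam] is expressed through [B] in a
holomorphic frame, [frame_dbar B] is the (0,1)-part of the connection in it. *)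
Definition frame_dbar B w : V -> 'M[R[i]]_r :=
  fun x => invmx (B x) *m delbar_mx w B x.

Lemma frame_dbarE B w x : frame_dbar B w x = invmx (B x) *m delbar_mx w B x.
Proof. by []. Qed.

Lemma frame_dbar_cst (a : 'M[R[i]]_r) w x : frame_dbar (fun=> a) w x = 0.
Proof. by rewrite frame_dbarE delbar_mxE wirt_mx_cst mulmx0. Qed.

Lemma Cn_frame_dbar n (A : set V) B w : open A -> class_Cn_mx n.+1 A B ->
  (forall x, A x -> B x \in unitmx) -> class_Cn_mx n A (frame_dbar B w).
Proof.
move=> oA hB U; rewrite /frame_dbar delbar_mx_fun.
exact: Cn_mxM oA (Cn_invmx oA (Cn_mxW hB) U) (Cn_mx_wirt _ _ oA hB).
Qed.

(** The (1,0)-part of the same connection: compatibility with the metric determines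
it from the (0,1)-part. *)
Definition frame_conn B Gam v : V -> 'M[R[i]]_r := fun x =>
  chern_conn v Gam x + Gam x *m (frame_dbar B v x)^t* *m invmx (Gam x).

(** The opposite of [del b + delbar S + [b, S]], where [b] and [S] are the two parts of
the connection. *)
Definition frame_curv B Gam v w : V -> 'M[R[i]]_r := fun x =>
  - (del_mx v (frame_dbar B w) x + delbar_mx w (frame_conn B Gam v) x +
     frame_dbar B w x *m frame_conn B Gam v x -
     frame_conn B Gam v x *m frame_dbar B w x).

Lemma chern_conn_frame (A : set V) B Gam G v x :
  open A -> class_Cn_mx 1 A B -> (forall x, A x -> B x \in unitmx) ->
  (forall x, A x -> derivable_mx Gam x) -> (forall x, A x -> Gam x \in unitmx) ->
  (forall x, A x -> G x = B x *m Gam x *m (B x)^t*) -> A x ->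
  chern_conn v G x = del_mx v B x *m invmx (B x) +
    B x *m frame_conn B Gam v x *m invmx (B x).
Proof.
move=> oA hB UB dG UG GE Ax.
have nA : \forall y \near x, A y by exact: open_nbhs_nbhs.
have dB : derivable_mx B x := Cn_mx_derivable hB Ax.
have UBs : (B x)^t* \in unitmx by rewrite adjmx_unit UB.
have UGx : G x \in unitmx by rewrite (GE _ Ax) !unitmx_mul (UB _ Ax) (UG _ Ax) UBs.
rewrite /chern_conn; apply: (canLR (mulmxK UGx)).
have -> : del_mx v G x = wirt_mx (- 'i%C) v (fun x => B x *m Gam x *m (B x)^t*) x.
  rewrite del_mxE; apply/esym/wirt_mx_near.
    by apply: filterS nA => y /GE ->.
  by apply: derivable_mxM (derivable_mxJ dB); exact: derivable_mxM dB (dG _ Ax).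
rewrite (wirt_mxM _ _ (derivable_mxM dB (dG _ Ax)) (derivable_mxJ dB)).
rewrite (wirt_mxM _ _ dB (dG _ Ax)) (wirt_mxJ _ _ dB) rmorphN /= conji opprK.
rewrite -!del_mxE -delbar_mxE (GE _ Ax).
rewrite /frame_conn /chern_conn /frame_dbar adjmxM adjmx_inv.
exact: frame_conn_algebra (UB _ Ax) (UG _ Ax) UBs.
Qed.

(** The Chern curvature computed in a smooth frame.  The derivatives of [B]
alone combine into [del (frame_dbar B)] because they commute. *)
Lemma chern_curv_frame (A : set V) B Gam G v w z :
  open A -> class_Cn_mx 2 A B -> (forall x, A x -> B x \in unitmx) ->
  (forall x, A x -> derivable_mx Gam x) -> (forall x, A x -> Gam x \in unitmx) ->
  (forall x, A x -> G x = B x *m Gam x *m (B x)^t*) -> A z ->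
  derivable_mx (frame_conn B Gam v) z ->
  chern_curv v w G z = B z *m frame_curv B Gam v w z *m invmx (B z).
Proof.
move=> oA hB UB dG UG GE Az dS.
have nA : \forall y \near z, A y by exact: open_nbhs_nbhs.
have dB : derivable_mx B z := Cn_mx_derivable hB Az.
have dI : derivable_mx (fun x => invmx (B x)) z.
  exact: Cn_mx_derivable (Cn_invmx oA hB UB) Az.
have dW s u : derivable_mx (wirt_mx s u B) z.
  exact: Cn_mx_derivable (Cn_mx_wirt s u oA hB) Az.
have nU : \forall y \near z, B y \in unitmx by apply: filterS nA => y /UB.
rewrite /chern_curv.
have d1 : derivable_mx (fun x => del_mx v B x *m invmx (B x)) z.
  by rewrite del_mx_fun; exact: derivable_mxM (dW _ _) dI.
have d2 : derivable_mx (fun x => B x *m frame_conn B Gam v x *m invmx (B x)) z.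
  exact: derivable_mxM (derivable_mxM dB dS) dI.
have -> : delbar_mx w (chern_conn v G) z = wirt_mx 'i%C w (fun x =>
    del_mx v B x *m invmx (B x) + B x *m frame_conn B Gam v x *m invmx (B x)) z.
  rewrite delbar_mxE; apply/esym/wirt_mx_near; last exact: derivable_mxD.
  by apply: filterS nA => y Ay; rewrite (chern_conn_frame v oA (Cn_mxW hB) UB dG UG GE Ay).
rewrite (wirt_mxD _ _ d1 d2) del_mx_fun (wirt_mxM _ _ (dW _ _) dI).
rewrite (wirt_mxM _ _ (derivable_mxM dB dS) dI) (wirt_mxM _ _ dB dS).
rewrite (wirt_invmx _ _ nU dB dI).
rewrite /frame_curv {1}/frame_dbar del_mx_fun delbar_mx_fun.
rewrite (wirt_mxM _ _ dI (dW _ _)) (wirt_invmx _ _ nU dB dI).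
rewrite (wirt_mx_wirt_mx _ _ w v oA hB Az) /frame_dbar !delbar_mxE.
exact: frame_curv_algebra (UB _ Az).
Qed.

End SmoothFrame.

Section EndoNorm.
Context {R : realType} {r : nat}.

(** A change of frame conjugates the endomorphism and its adjoint alike, hence
preserves the trace of their product. *)
Lemma endo_norm_conj (a Gam M : 'M[R[i]]_r) : a \in unitmx -> Gam \in unitmx ->
  endo_norm (a *m Gam *m a^t*) (a *m M *m invmx a) = endo_norm Gam M.
Proof.
move=> Ua UG; rewrite /endo_norm; congr (Num.sqrt (complex.Re _)).
have Uas : a^t* \in unitmx by rewrite adjmx_unit.
have -> : invmx (a *m Gam *m a^t*) = invmx (a^t*) *m invmx Gam *m invmx a.
  apply: invmx_eq; rewrite !mulmxA (mulmxK Uas) (mulmxK UG).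
  exact: mulmxV.
have -> : (a *m M *m invmx a)^t* = invmx (a^t*) *m M^t* *m a^t*.
  by rewrite !adjmxM adjmx_inv mulmxA.
rewrite (adjoint_conj_algebra _ _ _ Ua Uas) mxtrace_mulC.
by rewrite [invmx a *m _]mulmxA (mulVmx Ua) mul1mx.
Qed.

End EndoNorm.

(** * Invariance of the norm of the contracted curvature *)

Section HoloOn.
Context {R : realType} {V : normedModType R[i]}.

Lemma holo_Cn n (A : set V) f : holo_on A f -> class_Cn n A f.
Proof. by case=> h _; exact: smooth_Cn. Qed.

Lemma smooth_Cn_mx p q n (A : set V) (F : V -> 'M[R[i]]_(p, q)) :
  smooth_mx_on A F -> class_Cn_mx n A F.
Proof. by move=> h i j; exact: smooth_Cn (h i j). Qed.

Lemma holo_Cn_mx p q n (A : set V) (F : V -> 'M[R[i]]_(p, q)) :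
  holo_mx_on A F -> class_Cn_mx n A F.
Proof. by move=> h i j; exact: holo_Cn (h i j). Qed.

Lemma holo_delbar_mx p q (A : set V) (F : V -> 'M[R[i]]_(p, q)) v z :
  holo_mx_on A F -> A z -> delbar_mx v F z = 0.
Proof.
by move=> h Az; apply/matrixP => i j; rewrite !mxE; have [_ ->] := h i j.
Qed.

End HoloOn.

Section ChartLemmas.
Context {R : realType} (X : surface R).
Implicit Types (c : chart R X) (W : set X).

Lemma cimgP c W z : atlas c -> cimg c W z ->
  [/\ cdom c (cinv c z), W (cinv c z) & cmap c (cinv c z) = z].
Proof.
by move=> /atlas_chart [_ h _ _] [x [cx Wx] <-]; rewrite !h.
Qed.

Lemma cimg_mem c W x : cdom c x -> W x -> cimg c W (cmap c x).
Proof. by move=> cx Wx; exists x. Qed.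

Lemma cmapK c x : atlas c -> cdom c x -> cinv c (cmap c x) = x.
Proof. by move=> /atlas_chart [_ h _ _]; exact: h. Qed.

Lemma cimg_open c W : atlas c -> open W -> open (cimg c W).
Proof.
move=> ac oW; have [[od oi] hK hc hi] := atlas_chart ac.
rewrite openE => z Wz.
have [cz Wcz ez] := cimgP ac Wz.
have Tz : cimg c setT z by rewrite -ez; exact: cimg_mem.
have n1 : nbhs z (cimg c setT) by exact: open_nbhs_nbhs.
have n2 : nbhs z (cinv c @^-1` W) by apply: (hi z Tz); exact: open_nbhs_nbhs.
apply: filterS (filterI n1 n2) => y [Ty /= Wy].
by have [cy _ <-] := cimgP ac Ty; exact: cimg_mem.
Qed.

End ChartLemmas.

(** Contraction with the inverse metric is compatible with changes of coordinates:
the Jacobians can be moved from the form to the inverse metric. *)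
Lemma sum_sandwich (R : realType) n r (J h : 'M[R[i]]_n) (F : 'I_n -> 'I_n -> 'M[R[i]]_r) :
  \sum_k \sum_l h l k *:
    (\sum_a \sum_b (J k a * Num.conj (J l b)) *: F a b) =
  \sum_a \sum_b (J^t* *m h *m J) b a *: F a b.
Proof.
transitivity (\sum_k \sum_a \sum_b \sum_l
   ((h l k * (J k a * Num.conj (J l b))) *: F a b)).
  apply: eq_bigr => k _.
  transitivity (\sum_l \sum_a \sum_b (h l k * (J k a * Num.conj (J l b))) *: F a b).
    apply: eq_bigr => l _; rewrite scaler_sumr; apply: eq_bigr => a _.
    by rewrite scaler_sumr; apply: eq_bigr => b _; rewrite scalerA.
  by rewrite exchange_big /=; apply: eq_bigr => a _; rewrite exchange_big.
rewrite exchange_big /=; apply: eq_bigr => a _.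
rewrite exchange_big /=; apply: eq_bigr => b _.
rewrite mxE scaler_suml; apply: eq_bigr => k _.
rewrite mxE mulr_suml scaler_suml; apply: eq_bigr => l _.
by congr (_ *: _); rewrite !mxE mulrA mulrC mulrA.
Qed.

Lemma congruence_change (R : realType) r (A B H : 'M[R[i]]_r) : B \in unitmx ->
  A *m H *m A^t* = (A *m invmx B) *m (B *m H *m B^t*) *m (A *m invmx B)^t*.
Proof.
move=> U; have Us : B^t* \in unitmx by rewrite adjmx_unit.
by rewrite adjmxM adjmx_inv !mulmxA (mulmxKV U) (mulmxK Us).
Qed.

Section Invariance.
Context {R : realType} {X : surface R} {r : nat} (E : hol_bundle X r).
Context (g : hermitian_metric X) (H : X -> 'M[R[i]]_r) (M : set X).
Hypotheses (oM : open M) (HM : bundle_metric E M H).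

(** A vector in the kernel would have norm zero. *)
Lemma posdef_unit n (A : 'M[R[i]]_n) : posdef A -> A \in unitmx.
Proof.
move=> [_ h]; rewrite -row_free_unit -kermx_eq0; apply/negPn/negP => k0.
have [i hi] : exists i, row i (kermx A) != 0.
  apply/existsP; apply: contraNT k0; rewrite negb_exists => /forallP h0.
  by apply/eqP/row_matrixP => i; rewrite row0; apply/eqP; have := h0 i; rewrite negbK.
have := h _ hi; rewrite /herm -row_mul mulmx_ker row0 mul0mx mxE ltxx.
by [].
Qed.

Lemma gram_unit W e x : hframe E W e -> W x -> M x -> gram e H x \in unitmx.
Proof.
move=> he Wx Mx; rewrite /gram !unitmx_mul adjmx_unit (hframe_unit he Wx) /= andbT.
by apply: posdef_unit; case: HM => h _; exact: h.
Qed.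

Lemma gram_Cn n c W e : atlas c -> hframe E W e ->
  class_Cn_mx n (cimg c (M `&` W)) (gram e H \o cinv c).
Proof.
move=> ac he; apply: smooth_Cn_mx => i j; have [_ h] := HM.
exact: (h W e he i j c ac).
Qed.

(** The change of frame is holomorphic, so that [frame_dbar] vanishes in
[chern_curv_frame] and only the conjugation remains. *)
Lemma chern_curv_change_frame c W e W' e' x k l :
  atlas c -> cdom c x -> M x -> hframe E W e -> W x -> hframe E W' e' -> W' x ->
  chern_curv k l (gram e H \o cinv c) (cmap c x) =
  (e x *m invmx (e' x)) *m chern_curv k l (gram e' H \o cinv c) (cmap c x) *m
    invmx (e x *m invmx (e' x)).
Proof.
move=> ac cx Mx he Wx he' Wx'.
pose N := M `&` (W `&` W'); pose A := cimg c N.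
have oA : open A.
  apply: cimg_open => //; apply: openI => //; apply: openI.
    exact: hframe_open he.
  exact: hframe_open he'.
have Az : A (cmap c x) by exact: cimg_mem.
pose a y := e y *m invmx (e' y).
have ha : holo_mx_on A (a \o cinv c).
  move=> i j; have h := hframe_compat he' he.
  have [h1 h2] := h i j c ac.
  have sA z : A z -> cimg c (W' `&` W) z.
    by move=> [y [cy [_ [Wy Wy']]] <-]; exists y.
  by split=> [s z /sA|z /sA]; [exact: h1 | exact: h2].
have aU z : A z -> (a \o cinv c) z \in unitmx.
  move=> /(cimgP ac) [_ [_ [Wz Wz']] _]; rewrite /= /a unitmx_mul unitmx_inv.
  by rewrite (hframe_unit he Wz) (hframe_unit he' Wz').
have GC n : class_Cn_mx n A (gram e' H \o cinv c).
  by apply: Cn_mx_sub (gram_Cn n ac he') => z [y [cy [My [_ Wy']]] <-]; exists y.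
have GU z : A z -> (gram e' H \o cinv c) z \in unitmx.
  by move=> /(cimgP ac) [_ [Mz [_ Wz']] _]; exact: gram_unit he' Wz' Mz.
have GE z : A z -> (gram e H \o cinv c) z =
   (a \o cinv c) z *m (gram e' H \o cinv c) z *m ((a \o cinv c) z)^t*.
  move=> /(cimgP ac) [_ [Mz [_ Wz']] _].
  exact: congruence_change (hframe_unit he' Wz').
have b0 z w : A z -> frame_dbar (a \o cinv c) w z = 0.
  by move=> Az'; rewrite /frame_dbar (holo_delbar_mx _ ha Az') mulmx0.
have S0 z w : A z -> frame_conn (a \o cinv c) (gram e' H \o cinv c) w z =
    chern_conn w (gram e' H \o cinv c) z.
  by move=> Az'; rewrite /frame_conn b0 // trmx0 map_mx0 mulmx0 mul0mx addr0.
have nA : \forall y \near cmap c x, A y by exact: open_nbhs_nbhs.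
have dC w : derivable_mx (chern_conn w (gram e' H \o cinv c)) (cmap c x).
  exact: Cn_mx_derivable (Cn_chern_conn w oA (GC 2) GU) Az.
rewrite (@chern_curv_frame _ _ _ A (a \o cinv c) (gram e' H \o cinv c) _ k l _ oA
  (holo_Cn_mx 2 ha) aU _ GU GE Az).
- rewrite [in LHS]/= (cmapK ac cx) -/(a x); congr (_ *m _ *m _).
  rewrite /frame_curv /chern_curv b0 // mul0mx mulmx0 addr0 subr0; congr (- _).
  rewrite [X in X + _](_ : _ = 0) ?add0r.
    rewrite !delbar_mxE; apply: wirt_mx_near.
      by apply: filterS nA => y /S0.
    by apply: derivable_mx_near (dC k); apply: filterS nA => y /S0.
  rewrite -(wirt_mx_cst (- 'i%C) k (0 : 'M[R[i]]_r) (cmap c x)) del_mxE; apply/esym/wirt_mx_near.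
    by apply: filterS nA => y /b0.
  exact: derivable_mx_cst.
- by move=> z Az'; exact: Cn_mx_derivable (GC 1) Az'.
by apply: derivable_mx_near (dC k); apply: filterS nA => y /S0.
Qed.

(** By the chain rule, holomorphy of the transition map leaving no terms of type
(2,0) or (0,2) and no derivative of the Jacobian. *)
Lemma chern_curv_change_chart c c' W e x k l :
  atlas c -> cdom c x -> atlas c' -> cdom c' x -> M x -> hframe E W e -> W x ->
  chern_curv (evec k) (evec l) (gram e H \o cinv c) (cmap c x) =
  \sum_a \sum_b (jacobian c c' x k a * Num.conj (jacobian c c' x l b)) *:
    chern_curv (evec a) (evec b) (gram e H \o cinv c') (cmap c' x).
Proof.
move=> ac cx ac' cx' Mx he Wx.
pose A := cimg c (M `&` (W `&` cdom c')).
pose A' := cimg c' (M `&` W).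
have oW : open W := hframe_open he.
have oA : open A.
  apply: cimg_open => //; apply: openI => //; apply: openI => //.
  by have [[]] := atlas_chart ac'.
have oA' : open A' by apply: cimg_open => //; exact: openI.
have Az : A (cmap c x) by exact: cimg_mem.
pose phi := cmap c' \o cinv c.
have hphi : holo_mx_on A phi.
  move=> i j; have [h1 h2] := atlas_compat ac ac' i j.
  have sA z : A z -> cimg c (cdom c') z.
    by move=> [y [cy [_ [_ Wy]]] <-]; exists y.
  by split=> [s z /sA|z /sA]; [exact: h1 | exact: h2].
have phiA z : A z -> A' (phi z).
  by move=> /(cimgP ac) [_ [Mz [Wz cz]] _]; exact: cimg_mem.
pose G := gram e H \o cinv c; pose G' := gram e H \o cinv c'.
have GE z : A z -> G z = G' (phi z).
  move=> /(cimgP ac) [_ [Mz [Wz cz]] _].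
  by rewrite /G /G' /phi /= (cmapK ac' cz).
have G'C n : class_Cn_mx n A' G' by exact: gram_Cn ac' he.
have GC n : class_Cn_mx n A G.
  by apply: Cn_mx_sub (gram_Cn n ac he) => z [y [cy [My [Wy _]]] <-]; exists y.
have G'U z : A' z -> G' z \in unitmx.
  by move=> /(cimgP ac') [_ [Mz Wz] _]; exact: gram_unit he Wz Mz.
pose th a := chern_conn (evec a) G'.
have thC n a : class_Cn_mx n A' (th a) := Cn_chern_conn (evec a) oA' (G'C n.+1) G'U.
have dphi a z : A z -> derivable_at (fun y => phi y 0 a) z.
  by move=> Az'; exact: Cn_derivable (holo_Cn 1 (hphi 0 a)) Az'.
have phi_hol a v z : A z -> delbar v (fun y => phi y 0 a) z = 0.
  by move=> Az'; have [_ ->] := hphi 0 a.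
pose J v a := del v (fun y => phi y 0 a).
have nA z : A z -> \forall y \near z, A y by move=> Az'; exact: open_nbhs_nbhs.
have connE v z : A z -> chern_conn v G z = \sum_a J v a z *: th a (phi z).
  move=> Az'; rewrite /chern_conn GE //.
  under eq_bigr do rewrite /th /chern_conn scalemxAl; rewrite -mulmx_suml; congr (_ *m _).
  apply/matrixP => i j; rewrite !mxE summxE.
  have -> : del v (fun w => G w i j) z = del v ((fun w => G' w i j) \o phi) z.
    rewrite !delE; apply: wirt_near; last exact: Cn_derivable (GC 1 i j) Az'.
    by apply: filterS (nA z Az') => y /GE ->.
  rewrite del_comp; last by move=> *; exact: phi_hol.
  - by apply: eq_bigr => a _; rewrite !mxE mulrC.
  - exact: Cn_C1_at oA' (G'C 1 i j) (phiA _ Az').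
  - by move=> a; exact: dphi.
rewrite {1}/chern_curv.
have dth a i j : C1_at (fun w => th a w i j) (phi (cmap c x)).
  exact: Cn_C1_at oA' (thC 1 a i j) (phiA _ Az).
have dthp a i j : derivable_at ((fun w => th a w i j) \o phi) (cmap c x).
  by apply: derivable_comp; [exact: dth | move=> b; exact: dphi].
have dJ v a : derivable_at (J v a) (cmap c x).
  exact: Cn_derivable (Cn_del v oA (holo_Cn 2 (hphi 0 a))) Az.
have Jhol v w a : delbar w (J v a) (cmap c x) = 0.
  rewrite delbarE (_ : J v a = wirt (- 'i%C) v (fun y => phi y 0 a)); last first.
    by apply/funext => y; rewrite /J delE.
  rewrite (wirt_wirt _ _ w v oA (holo_Cn 2 (hphi 0 a)) Az).
  rewrite -(wirt_cst (- 'i%C) v (0 : R[i]) (cmap c x)); apply/esym/wirt_near.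
    by apply: filterS (nA _ Az) => y Ay; rewrite -delbarE phi_hol.
  exact: derivable_cst.
have phix : phi (cmap c x) = cmap c' x by rewrite /phi /= (cmapK ac cx).
apply/matrixP => i j; rewrite !mxE.
have -> : delbar (evec l) (fun w => chern_conn (evec k) G w i j) (cmap c x) =
   delbar (evec l) (fun w => \sum_a J (evec k) a w * ((fun w => th a w i j) \o phi) w) (cmap c x).
  apply/esym; rewrite !delbarE; apply: wirt_near; last first.
    by apply: derivable_sum => a; exact: derivable_mul.
  apply: filterS (nA _ Az) => y Ay; rewrite connE // summxE.
  by apply: eq_bigr => a _; rewrite mxE.
rewrite delbarE wirt_sum; last by move=> a; exact: derivable_mul.
rewrite summxE -sumrN; apply: eq_bigr => a _.
rewrite (wirtM _ _ (dJ _ a) (dthp a i j)) -!delbarE Jhol mul0r add0r.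
rewrite delbar_comp; [|exact: dth|by move=> b; exact: dphi|by move=> *; exact: phi_hol].
rewrite summxE mulr_sumr -sumrN; apply: eq_bigr => b _.
rewrite !mxE phix /J /th /G' /phi /=.
move: (delbar _ _ _) (del (evec k) _ _) (del (evec l) _ _) => p q s; ring.
Qed.

Lemma Lambda_curv_change_chart c c' W e x :
  atlas c -> cdom c x -> atlas c' -> cdom c' x -> M x -> hframe E W e -> W x ->
  Lambda_curv g c e H x = Lambda_curv g c' e H x.
Proof.
move=> ac cx ac' cx' Mx he Wx; rewrite /Lambda_curv; apply: congr1.
set J := jacobian c c' x.
have gE : gmat g c x = J *m gmat g c' x *m J^t* by exact: gmat_change.
have gU : gmat g c x \in unitmx by apply: posdef_unit; exact: gmat_posdef.
have gU' : gmat g c' x \in unitmx by apply: posdef_unit; exact: gmat_posdef.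
have [UJ UJs] : J \in unitmx /\ J^t* \in unitmx.
  by move: gU; rewrite gE !unitmx_mul => /andP[/andP[-> _] ->].
have gI : invmx (gmat g c' x) = J^t* *m invmx (gmat g c x) *m J.
  apply: invmx_eq; apply: (can_inj (mulKmx UJ)).
  rewrite !mulmxA mulmx1 -gE.
  by rewrite mulmxV // mul1mx.
have curvE k l := chern_curv_change_chart k l ac cx ac' cx' Mx he Wx.
pose F a b := chern_curv (evec a) (evec b) (gram e H \o cinv c') (cmap c' x).
transitivity (\sum_k \sum_l invmx (gmat g c x) l k *:
    (\sum_a \sum_b (J k a * Num.conj (J l b)) *: F a b)).
  by apply: eq_bigr => k _; apply: eq_bigr => l _; rewrite curvE.
by rewrite (sum_sandwich J (invmx (gmat g c x)) F) -gI.
Qed.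

Lemma Lambda_curv_change_frame c W e W' e' x :
  atlas c -> cdom c x -> M x -> hframe E W e -> W x -> hframe E W' e' -> W' x ->
  Lambda_curv g c e H x = (e x *m invmx (e' x)) *m Lambda_curv g c e' H x *m
    invmx (e x *m invmx (e' x)).
Proof.
move=> ac cx Mx he Wx he' Wx'; rewrite /Lambda_curv -scalemxAr -scalemxAl.
congr (_ *: _); rewrite mulmx_sumr mulmx_suml; apply: eq_bigr => k _.
rewrite mulmx_sumr mulmx_suml; apply: eq_bigr => l _.
by rewrite -scalemxAr -scalemxAl -(chern_curv_change_frame _ _ ac cx Mx he Wx he' Wx').
Qed.

(** The pointwise norm of the contracted curvature does not depend on the
coordinates and the frame used to compute it. *)
Lemma endo_norm_Lambda_curv c W e c' W' e' x :
  atlas c -> cdom c x -> atlas c' -> cdom c' x -> M x ->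
  hframe E W e -> W x -> hframe E W' e' -> W' x ->
  endo_norm (gram e H x) (Lambda_curv g c e H x) =
  endo_norm (gram e' H x) (Lambda_curv g c' e' H x).
Proof.
move=> ac cx ac' cx' Mx he Wx he' Wx'.
have U := hframe_unit he Wx; have U' := hframe_unit he' Wx'.
rewrite (Lambda_curv_change_frame ac cx Mx he Wx he' Wx').
rewrite (Lambda_curv_change_chart ac cx ac' cx' Mx he' Wx').
rewrite (_ : gram e H x = (e x *m invmx (e' x)) *m gram e' H x *m
    (e x *m invmx (e' x))^t*); last exact: congruence_change.
apply: endo_norm_conj; first by rewrite unitmx_mul U unitmx_inv.
exact: gram_unit he' Wx' Mx.
Qed.

End Invariance.

(** * Local bounds *)

Section LocalBounds.
Context {R : realType} {V : normedModType R[i]} (S : set V) (z0 : V).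
Implicit Types (f g : V -> R[i]).

(** The bound is complex because norms of complex numbers are; as it dominates a norm it
is real as soon as [S] accumulates at [z0]. *)
Definition lbd f : Prop :=
  exists K : R[i], \forall z \near z0, S z -> `|f z| <= K.

Lemma lbd_le f g : (\forall z \near z0, S z -> `|f z| <= `|g z|) -> lbd g -> lbd f.
Proof.
move=> h [K hK]; exists K.
by apply: filterS2 h hK => z h1 h2 Sz; exact: le_trans (h1 Sz) (h2 Sz).
Qed.

Lemma lbd_eq f g : (\forall z \near z0, S z -> f z = g z) -> lbd g -> lbd f.
Proof. by move=> h; apply: lbd_le; apply: filterS h => z h Sz; rewrite h. Qed.

Lemma lbd_eq_on f g : (forall z, S z -> f z = g z) -> lbd g -> lbd f.
Proof. by move=> h; apply: lbd_eq; apply: nearW => z; exact: h. Qed.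

Lemma lbd_continuous f : {for z0, continuous f} -> lbd f.
Proof.
move=> hf; exists (`|f z0| + 1).
have /cvgrPdist_lt/(_ 1 ltr01) h : f @ z0 --> f z0 := hf.
apply: filterS h => z h _.
rewrite -[f z](subrK (f z0)) addrC; apply: le_trans (ler_normD _ _) _.
by rewrite lerD2l distrC ltW.
Qed.

Lemma lbd_cst a : lbd (fun=> a).
Proof. by exists `|a|; apply: nearW => z. Qed.

Lemma lbdD f g : lbd f -> lbd g -> lbd (fun z => f z + g z).
Proof.
move=> [K hK] [K' hK']; exists (K + K'); apply: filterS2 hK hK' => z h h' Sz.
by apply: le_trans (ler_normD _ _) _; rewrite lerD ?h ?h'.
Qed.

Lemma lbdM f g : lbd f -> lbd g -> lbd (fun z => f z * g z).
Proof.
move=> [K hK] [K' hK']; exists (K * K'); apply: filterS2 hK hK' => z h h' Sz.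
by rewrite normrM ler_pM ?h ?h'.
Qed.

Lemma lbdN f : lbd f -> lbd (fun z => - f z).
Proof. by apply: lbd_le; apply: nearW => z _; rewrite normrN. Qed.

Lemma lbdJ f : lbd f -> lbd (fun z => Num.conj (f z)).
Proof. by apply: lbd_le; apply: nearW => z _; rewrite norm_conjC. Qed.

Lemma lbd_sum (I : Type) (r : seq I) (F : I -> V -> R[i]) :
  (forall i, lbd (F i)) -> lbd (fun z => \sum_(i <- r) F i z).
Proof.
move=> hF; elim: r => [|i r IH].
  by apply: lbd_eq (lbd_cst 0); apply: nearW => z _; rewrite big_nil.
by apply: lbd_eq (lbdD (hF i) IH); apply: nearW => z _; rewrite big_cons.
Qed.

Lemma lbd_endo_norm r (G M : V -> 'M[R[i]]_r) :
  lbd (fun z => \tr (M z *m (G z *m (M z)^t* *m invmx (G z)))) ->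
  exists K : R, \forall z \near z0, S z -> endo_norm (G z) (M z) <= K.
Proof.
move=> [K hK]; exists (Num.sqrt (complex.Re K)); apply: filterS hK => z h Sz.
rewrite /endo_norm ler_wsqrtr //.
have := le_trans (normc_ge_Re _) (h Sz); rewrite lecE /= => /andP[_].
exact: le_trans (ler_norm _).
Qed.

End LocalBounds.

Section Powers.
Context {R : realType} {V : normedModType R[i]}.

(** The logarithmic derivative of a power is a multiple of that of the base. *)
Lemma derivable_powR (p : V -> R) (a : R) z :
  (\forall x \near z, 0 < p x) -> derivable_at (fun x => (p x)%:C) z ->
  derivable_at (fun x => (p x `^ a)%:C) z /\
  forall s v, wirt s v (fun x => (p x `^ a)%:C) z =
    a%:C * (wirt s v (fun x => (p x)%:C) z / (p z)%:C) * (p z `^ a)%:C.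
Proof.
move=> p0 dp; have pz : 0 < p z := nbhs_singleton p0.
have h v : cder (line (fun x => (p x `^ a)%:C) z v) 0
    (a%:C * (dir_deriv v (fun x => (p x)%:C) z / (p z)%:C) * (p z `^ a)%:C).
  have [h1 h2] := dir_derivableP (dp v).
  have im0 : complex.Im (dir_deriv v (fun x => (p x)%:C) z) = 0.
    have [_ <-] := h2; have [_ e] := is_derive_cst (0 : R) (0 : R) (1 : R).
    by rewrite -[RHS]e.
  set d := dir_deriv v (fun x => (p x)%:C) z in h1 im0 *.
  have dE : d = (complex.Re d)%:C by rewrite {1}(complexE d) im0 mulr0 addr0.
  have pl : p (z + (0 : R)%:C *: v) = p z by rewrite scale0r addr0.
  have hp := @is_derive1_powR R a (p (z + (0 : R)%:C *: v)).
  rewrite pl in hp.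
  have hp' : is_derive (p (z + (0 : R)%:C *: v)) 1 (fun x : R => x `^ a) (a * p z `^ (a - 1)).
    by rewrite pl; exact: hp.
  have hc := @is_derive1_comp R (fun x : R => x `^ a) (fun t => p (z + t%:C *: v)) 0 _ _ hp' h1.
  have := cder_real hc.
  congr (cder _ _ _); rewrite {2}dE -[(p z)%:C^-1]fmorphV -!rmorphM; congr (_%:C).
  rewrite powRB ?(gt_eqF pz) ?implybT // powRr1 ?ltW //.
  by rewrite -/d; ring.
split=> [v|s v]; first exact: cder_derivable (h v).
rewrite /wirt (cder_dir_deriv (h v)) (cder_dir_deriv (h ('i%C *: v))).
move: (dir_deriv v _ z) (dir_deriv ('i%C *: v) _ z) => x y; ring.
Qed.

End Powers.

(** * Curvature of a metric that is diagonal in a smooth frame *)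

Lemma quotient_rule_algebra (F : fieldType) (x y p d s t : F) : y != 0 ->
  (s * x / y + x * (- (t * y) / y ^+ 2)) * p + x / y * d = x / y * (d + p * (s - t)).
Proof. by move=> y0; field. Qed.

Lemma conj_affine (R : realType) (a b c d : R[i]) : Num.conj (a + b * (c - d)) =
  Num.conj a + Num.conj b * (Num.conj c - Num.conj d).
Proof. by rewrite rmorphD rmorphM rmorphB. Qed.

Section DiagonalMetric.
Context {R : realType} {V : normedModType R[i]} {r : nat}.
Variables (S : set V) (B : V -> 'M[R[i]]_r) (Del : 'I_r -> V -> R[i]).
Variable (L : V -> 'I_r -> V -> R[i]).
Hypotheses (oS : open S) (hB : class_Cn_mx 2 S B)
  (UB : forall z, S z -> B z \in unitmx)
  (Del_neq0 : forall k z, S z -> Del k z != 0)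
  (Del_real : forall k z, S z -> Num.conj (Del k z) = Del k z)
  (Del_derivable : forall k z, S z -> derivable_at (Del k) z)
  (LE : forall v k z, S z -> del v (Del k) z = L v k z * Del k z)
  (L_derivable : forall v k z, S z -> derivable_at (L v k) z).

Let Gam z := diag_mx (\row_k Del k z).
Let b w z := frame_dbar B w z.

(** Entries of the opposite of [frame_curv], written with the logarithmic derivatives [L] of
the diagonal entries [Del]. *)
Definition diag_curv v w (z : V) k l : R[i] :=
  del v (fun x => b w x k l) z + (k == l)%:R * delbar w (L v k) z +
  b w z k l * (L v l z - L v k z) +
  Del k z / Del l z * Num.conj (del w (fun x => b v x l k) z +
    b v z l k * (L w k z - L w l z)) +
  \sum_j (Del j z / Del l z * b w z k j * Num.conj (b v z l j) -
          Del k z / Del j z * Num.conj (b v z j k) * b w z j l).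

Lemma diag_unit z : S z -> Gam z \in unitmx.
Proof.
move=> Sz; rewrite unitmxE det_diag unitfE; apply/prodf_neq0 => k _.
by rewrite mxE Del_neq0.
Qed.

Lemma diag_inv z : S z -> invmx (Gam z) = diag_mx (\row_k (Del k z)^-1).
Proof.
move=> Sz; apply: invmx_eq; rewrite mulmx_diag; apply/matrixP => k l.
by rewrite !mxE; case: eqP => // _; rewrite mulfV // Del_neq0.
Qed.

Lemma diag_conj_entry z (Y : 'M[R[i]]_r) k l : S z ->
  (Gam z *m Y *m invmx (Gam z)) k l = Del k z / Del l z * Y k l.
Proof.
by move=> Sz; rewrite diag_inv // mul_mx_diag mul_diag_mx !mxE mulrAC.
Qed.

Lemma diag_mxE z k l : Gam z k l = Del k z *+ (k == l).
Proof. by rewrite /Gam mxE mxE. Qed.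

Lemma diag_derivable z : S z -> derivable_mx Gam z.
Proof.
move=> Sz k l; under eq_fun do rewrite diag_mxE.
case: (k == l); last exact: derivable_cst.
exact: Del_derivable.
Qed.

Lemma diag_frame_conn v z k l : S z -> frame_conn B Gam v z k l =
  (k == l)%:R * L v k z + Del k z / Del l z * Num.conj (b v z l k).
Proof.
move=> Sz; rewrite /frame_conn mxE diag_conj_entry // [(_^t*) k l]mxE [(_^T) k l]mxE.
congr (_ + _); rewrite /chern_conn diag_inv // mul_mx_diag !mxE.
have [<-|kl] := eqVneq k l; last first.
  rewrite mul0r (_ : del v _ z = 0) ?mul0r // delE.
  rewrite (_ : (fun x => Gam x k l) = fun=> 0) ?wirt_cst //.
  by apply/funext => x; rewrite diag_mxE (negbTE kl).
rewrite (_ : (fun x => Gam x k k) = Del k); last first.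
  by apply/funext => x; rewrite diag_mxE eqxx mulr1n.
by rewrite LE // mul1r mulfK // Del_neq0.
Qed.

(** [Del k] is real, so its two logarithmic derivatives are conjugate. *)
Lemma delbar_Del w k z : S z -> delbar w (Del k) z = Num.conj (L w k z) * Del k z.
Proof.
move=> Sz; have nS : \forall x \near z, S x by exact: open_nbhs_nbhs.
have -> : delbar w (Del k) z = delbar w (fun x => Num.conj (Del k x)) z.
  rewrite !delbarE; apply: wirt_near; last exact: Del_derivable.
  by apply: filterS nS => x Sx; rewrite Del_real.
by rewrite delbarJ ?LE ?rmorphM /= ?Del_real //; exact: Del_derivable.
Qed.

Lemma frame_dbar_derivable w z k l : S z -> derivable_at (fun x => b w x k l) z.
Proof.
move=> Sz; have h : class_Cn_mx 1 S (frame_dbar B w).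
  exact: (Cn_frame_dbar w oS hB UB).
exact: Cn_mx_derivable h Sz k l.
Qed.

Let off v k l z := Del k z * (Del l z)^-1 * Num.conj (b v z l k).

Let off_derivable v k l z : S z -> derivable_at (off v k l) z.
Proof.
move=> Sz; apply: derivable_mul; last first.
  exact: derivable_conj (frame_dbar_derivable v l k Sz).
apply: derivable_mul; first exact: Del_derivable.
by apply: derivable_inv; [exact: Del_derivable | exact: Del_neq0].
Qed.

Let delbar_off v w k l z : S z -> delbar w (off v k l) z =
  Del k z / Del l z * Num.conj (del w (fun x => b v x l k) z +
    b v z l k * (L w k z - L w l z)).
Proof.
move=> Sz; have dk := Del_derivable k Sz; have dl := Del_derivable l Sz.
have nl := Del_neq0 l Sz.
have dI := derivable_inv dl nl.
have db := frame_dbar_derivable v l k Sz.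
rewrite delbarE /off (wirtM _ _ (derivable_mul dk dI) (derivable_conj db)).
rewrite (wirtM _ _ dk dI) (wirtV _ _ dl nl) (wirtJ _ _ db) -!delbarE.
rewrite !delbar_Del // conji -delE.
rewrite conj_affine; exact: quotient_rule_algebra.
Qed.

Lemma frame_curv_diag v w z k l : S z -> frame_curv B Gam v w z k l = - diag_curv v w z k l.
Proof.
move=> Sz; have nS : \forall x \near z, S x by exact: open_nbhs_nbhs.
have dconn : derivable_at (fun x => (k == l)%:R * L v k x + off v k l x) z.
  apply: derivable_add (off_derivable v k l Sz).
  exact: derivable_mul (derivable_cst _ _) (L_derivable v k Sz).
have -> : frame_curv B Gam v w z k l = - (del v (fun x => b w x k l) z +
    delbar w (fun x => frame_conn B Gam v x k l) z +
    \sum_j (b w z k j * frame_conn B Gam v z j l -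
            frame_conn B Gam v z k j * b w z j l)).
  by rewrite sumrB /frame_curv !mxE addrA.
have -> : delbar w (fun x => frame_conn B Gam v x k l) z =
    (k == l)%:R * delbar w (L v k) z + delbar w (off v k l) z.
  rewrite -[X in X * _ + _]subr0 delbarE.
  rewrite -(wirt_near _ _ _ dconn); last first.
    by apply: filterS nS => x Sx; rewrite diag_frame_conn.
  rewrite (wirtD _ _ (derivable_mul (derivable_cst _ _) (L_derivable v k Sz)) (off_derivable v k l Sz)).
  by rewrite (wirtM _ _ (derivable_cst _ _) (L_derivable v k Sz)) wirt_cst mul0r add0r subr0.
rewrite delbar_off //; congr (- _); rewrite /diag_curv.
have -> : \sum_j (b w z k j * frame_conn B Gam v z j l - frame_conn B Gam v z k j * b w z j l) =
  b w z k l * (L v l z - L v k z) +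
  \sum_j (Del j z / Del l z * b w z k j * Num.conj (b v z l j) -
          Del k z / Del j z * Num.conj (b v z j k) * b w z j l).
  rewrite !sumrB.
  have -> : \sum_j b w z k j * frame_conn B Gam v z j l = b w z k l * L v l z +
      \sum_j Del j z / Del l z * b w z k j * Num.conj (b v z l j).
    under eq_bigr do rewrite diag_frame_conn // mulrDr.
    rewrite big_split /=; congr (_ + _); last first.
      by apply: eq_bigr => j _; rewrite mulrCA mulrA.
    rewrite (bigD1 l) //= big1 ?addr0 ?eqxx ?mul1r // => j jl.
    by rewrite (negbTE jl) mul0r mulr0.
  have -> : \sum_j frame_conn B Gam v z k j * b w z j l = b w z k l * L v k z +
      \sum_j Del k z / Del j z * Num.conj (b v z j k) * b w z j l.
    under eq_bigr do rewrite diag_frame_conn // mulrDl.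
    rewrite big_split /=; congr (_ + _).
    rewrite (bigD1 k) //= big1 ?addr0 ?eqxx ?mul1r; first by rewrite mulrC.
    by move=> j jk; rewrite eq_sym (negbTE jk) !mul0r.
  by ring.
by ring.
Qed.

(** Each summand of [diag_curv] depends on [Del] through logarithmic derivatives and
ratios only; this makes it comparable with the powers of the norm of the
defining section. *)
Lemma chern_curv_diag G v w z : S z ->
  (forall x, S x -> G x = B x *m Gam x *m (B x)^t*) ->
  chern_curv v w G z =
  - (B z *m (\matrix_(k, l) diag_curv v w z k l) *m invmx (B z)).
Proof.
move=> Sz GE; have nS : \forall x \near z, S x by exact: open_nbhs_nbhs.
rewrite (@chern_curv_frame _ _ _ S B Gam G) //.
- rewrite -mulNmx -mulmxN; congr (_ *m _ *m _); apply/matrixP => k l.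
  by rewrite frame_curv_diag // [RHS]mxE [X in _ = - X]mxE.
- exact: diag_derivable.
- exact: diag_unit.
move=> k l; apply: (@derivable_at_near _ _ (fun x => (k == l)%:R * L v k x + off v k l x)).
  by apply: filterS nS => x Sx; rewrite diag_frame_conn.
apply: derivable_add (off_derivable v k l Sz).
exact: derivable_mul (derivable_cst _ _) (L_derivable v k Sz).
Qed.

End DiagonalMetric.

(** * Norm bound for diagonal metrics with weights *)

(* Stated over an arbitrary field so that [field] does not have to look inside the
complex numbers. *)
Lemma weight_offdiag (F : fieldType) (gk gl wk wl x : F) :
  wk != 0 -> wl != 0 -> gl != 0 ->
  wl / wk * ((gk * wk ^+ 2) / (gl * wl ^+ 2) * x) = gk / gl * (wk / wl * x).
Proof. by move=> *; field; do ?[apply/andP; split]. Qed.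

Lemma weight_quadratic (F : fieldType) (gj gl wj wk wl x y : F) :
  wj != 0 -> wk != 0 -> wl != 0 -> gl != 0 ->
  wl / wk * ((gj * wj ^+ 2) / (gl * wl ^+ 2) * x * y) =
  gj / gl * (wj / wk * x) * (wj / wl * y).
Proof. by move=> *; field; do ?[apply/andP; split]. Qed.

Lemma weight_quadratic' (F : fieldType) (gj gk wj wk wl x y : F) :
  wj != 0 -> wk != 0 -> wl != 0 -> gj != 0 ->
  wl / wk * ((gk * wk ^+ 2) / (gj * wj ^+ 2) * x * y) =
  gk / gj * (wk / wj * x) * (wl / wj * y).
Proof. by move=> *; field; do ?[apply/andP; split]. Qed.

Section WeightedBound.
Context {R : realType} {r : nat}.
Local Notation V := 'rV[R[i]]_2.
Variables (S : set V) (z0 : V) (B : V -> 'M[R[i]]_r) (Del : 'I_r -> V -> R[i]).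
Variables (L : V -> 'I_r -> V -> R[i]) (gam wt : 'I_r -> V -> R[i]).
Variable (h : V -> 'M[R[i]]_2).
Hypotheses (oS : open S) (hB : class_Cn_mx 2 S B)
  (UB : forall z, S z -> B z \in unitmx)
  (DelE : forall k z, S z -> Del k z = gam k z * wt k z ^+ 2)
  (gam_neq0 : forall k z, S z -> gam k z != 0)
  (wt_neq0 : forall k z, S z -> wt k z != 0)
  (gam_real : forall k z, S z -> Num.conj (gam k z) = gam k z)
  (wt_real : forall k z, S z -> Num.conj (wt k z) = wt k z)
  (Del_derivable : forall k z, S z -> derivable_at (Del k) z)
  (LE : forall v k z, S z -> del v (Del k) z = L v k z * Del k z)
  (L_derivable : forall v k z, S z -> derivable_at (L v k) z).
Let b w z := frame_dbar B w z.
Hypotheses (h_herm : forall z, S z -> (h z)^t* = h z)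
  (h_lbd : forall v w, lbd S z0 (fun z => h z w v))
  (gam_lbd : forall k, lbd S z0 (gam k))
  (gamV_lbd : forall k, lbd S z0 (fun z => (gam k z)^-1))
  (dL_lbd : forall v w k, lbd S z0 (delbar w (L v k)))
  (b_lbd : forall (w : 'I_2) k l, lbd S z0 (fun z => wt l z / wt k z * b (evec w) z k l))
  (db_lbd : forall k l, lbd S z0 (fun z => wt l z / wt k z *
     \sum_v \sum_w h z w v * (del (evec v) (fun x => b (evec w) x k l) z +
       b (evec w) z k l * (L (evec v) l z - L (evec v) k z)))).

Let C v w z k l := diag_curv B Del L (evec v) (evec w) z k l.
Let Y z k l := \sum_v \sum_w h z w v * C v w z k l.

Let P k l z := wt l z / wt k z *
     \sum_v \sum_w h z w v * (del (evec v) (fun x => b (evec w) x k l) z +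
       b (evec w) z k l * (L (evec v) l z - L (evec v) k z)).

Let conj_weight j l z x : S z ->
  Num.conj (wt j z / wt l z * x) = wt j z / wt l z * Num.conj x.
Proof. by move=> Sz; rewrite rmorphM rmorphM fmorphV /= !wt_real. Qed.

Let conjP k l z : S z -> Num.conj (P l k z) = wt k z / wt l z *
  \sum_v \sum_w h z w v * Num.conj (del (evec w) (fun x => b (evec v) x l k) z +
       b (evec v) z l k * (L (evec w) k z - L (evec w) l z)).
Proof.
move=> Sz; rewrite /P conj_weight // rmorph_sum /=.
congr (_ * _); under eq_bigr do rewrite rmorph_sum /=.
rewrite exchange_big /=; apply: eq_bigr => v _; apply: eq_bigr => w _.
rewrite rmorphM; congr (_ * _).
by rewrite -[in RHS](h_herm Sz) !mxE.
Qed.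

(* The norm of an endomorphism weighs its entry (k, l) by wt l / wt k.  In a
quadratic term this factor splits into the weights of the two entries of b, and
in the conjugate term it is the weight of the transposed entry. *)
Let weighted_split k l z : S z -> wt l z / wt k z * Y z k l =
  P k l z + (k == l)%:R * \sum_v \sum_w h z w v * delbar (evec w) (L (evec v) k) z +
  gam k z * (gam l z)^-1 * Num.conj (P l k z) +
  \sum_v \sum_w h z w v * \sum_j
    (gam j z * (gam l z)^-1 * (wt j z / wt k z * b (evec w) z k j) *
       Num.conj (wt j z / wt l z * b (evec v) z l j) -
     gam k z * (gam j z)^-1 * Num.conj (wt k z / wt j z * b (evec v) z j k) *
       (wt l z / wt j z * b (evec w) z j l)).
Proof.
move=> Sz; rewrite conjP // /P /Y !mulr_sumr -!big_split /=.
apply: eq_bigr => v _; rewrite !mulr_sumr -!big_split /=; apply: eq_bigr => w _.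
have [nk nl gl] := And3 (wt_neq0 k Sz) (wt_neq0 l Sz) (gam_neq0 l Sz).
rewrite /C /diag_curv !DelE // -/(b _) -/(b _).
set d1 := del _ _ _; set d2 := Num.conj (_ + _); set sm := \sum_j _; set sm' := \sum_j _.
have -> : sm' = wt l z / wt k z * sm.
  rewrite /sm mulr_sumr; apply: eq_bigr => j _.
  have [nj gj] := conj (wt_neq0 j Sz) (gam_neq0 j Sz).
  rewrite !DelE // mulrBr weight_quadratic // weight_quadratic' //.
  by rewrite !conj_weight.
have -> : wt l z / wt k z * (h z w v *
    (d1 + (k == l)%:R * delbar (evec w) (L (evec v) k) z +
     b (evec w) z k l * (L (evec v) l z - L (evec v) k z) +
     gam k z * wt k z ^+ 2 / (gam l z * wt l z ^+ 2) * d2 + sm)) =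
  wt l z / wt k z * (h z w v * (d1 + b (evec w) z k l * (L (evec v) l z - L (evec v) k z))) +
  (wt l z / wt k z * (k == l)%:R) * (h z w v * delbar (evec w) (L (evec v) k) z) +
  h z w v * (wt l z / wt k z * (gam k z * wt k z ^+ 2 / (gam l z * wt l z ^+ 2) * d2)) +
  h z w v * (wt l z / wt k z * sm).
  move: (b _ _ _ _ * _) (delbar _ _ _) => x y; ring.
rewrite weight_offdiag //.
have -> : wt l z / wt k z * (k == l)%:R = (k == l)%:R.
  by case: eqP => [<-|_]; rewrite ?mulr0 // mulr1 divff.
move: (b _ _ _ _ * _) (delbar _ _ _) => x y; ring.
Qed.

Let Y_lbd k l : lbd S z0 (fun z => wt l z / wt k z * Y z k l).
Proof.
apply: lbd_eq_on; first by move=> z Sz; exact: weighted_split.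
apply: lbdD.
  apply: lbdD; first apply: lbdD.
  - exact: db_lbd.
  - apply: lbdM; first exact: lbd_cst.
    by do 2! apply: lbd_sum => ?; exact: lbdM.
  - apply: lbdM; first exact: lbdM.
    exact: lbdJ (db_lbd _ _).
apply: lbd_sum => v; apply: lbd_sum => w; apply: lbdM => //.
apply: lbd_sum => j; apply: lbdD.
  apply: lbdM; last exact: lbdJ (b_lbd _ _ _).
  by apply: lbdM (b_lbd _ _ _); exact: lbdM.
apply: lbdN; apply: lbdM (b_lbd _ _ _).
by apply: lbdM (lbdJ (b_lbd _ _ _)); exact: lbdM.
Qed.

(** Bounds on the weighted entries of the (0,1)-part [b] and on the contraction of
its covariant derivative suffice: the remaining terms of the curvature are
products or conjugates of these, or logarithmic second derivatives. *)
Theorem endo_norm_diag_bound (G : V -> 'M[R[i]]_r) :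
  (forall z, S z -> G z = B z *m diag_mx (\row_k Del k z) *m (B z)^t*) ->
  exists K : R, \forall z \near z0, S z -> endo_norm (G z)
    (- 'i%C *: \sum_(k < 2) \sum_(l < 2)
       h z l k *: chern_curv (evec k) (evec l) G z) <= K.
Proof.
move=> GE.
pose Gam z := diag_mx (\row_k Del k z).
have Del_neq0 k z : S z -> Del k z != 0.
  by move=> Sz; rewrite DelE // mulf_neq0 ?expf_neq0 ?wt_neq0 ?gam_neq0.
have Del_real k z : S z -> Num.conj (Del k z) = Del k z.
  by move=> Sz; rewrite DelE // rmorphM rmorphXn /= wt_real // gam_real.
pose M z := 'i%C *: \matrix_(k, l) Y z k l.
have ME z : S z -> - 'i%C *: \sum_(k < 2) \sum_(l < 2)
       h z l k *: chern_curv (evec k) (evec l) G z = B z *m M z *m invmx (B z).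
  move=> Sz; rewrite /M -scalemxAr -scalemxAl scaleNr -scalerN; apply: congr1.
  have -> : \matrix_(k, l) Y z k l = \sum_v \sum_w h z w v *: \matrix_(k, l) C v w z k l.
    apply/matrixP => k l; rewrite mxE summxE; apply: eq_bigr => v _.
    by rewrite summxE; apply: eq_bigr => w _; rewrite !mxE.
  rewrite mulmx_sumr mulmx_suml -sumrN; apply: eq_bigr => v _.
  rewrite mulmx_sumr mulmx_suml -sumrN; apply: eq_bigr => w _.
  rewrite (chern_curv_diag oS hB UB Del_neq0 Del_real Del_derivable LE L_derivable _ _ Sz GE).
  by rewrite scalerN opprK -scalemxAr -scalemxAl.
have [K hK] : exists K : R, \forall z \near z0, S z -> endo_norm (Gam z) (M z) <= K.
  apply: lbd_endo_norm.
  apply: (@lbd_eq_on _ _ _ _ _ (fun z => \sum_k \sum_l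
    (gam l z * (gam k z)^-1 * (wt l z / wt k z * Y z k l) *
      Num.conj (wt l z / wt k z * Y z k l)))); last first.
    do 2! apply: lbd_sum => ?; apply: lbdM (lbdJ (Y_lbd _ _)).
    by apply: lbdM (Y_lbd _ _); exact: lbdM.
  move=> z Sz; rewrite mxtrace_mulC /mxtrace exchange_big /=.
  apply: eq_bigr => k _; rewrite mxE; apply: eq_bigr => l _.
  rewrite (diag_conj_entry Del_neq0) // !mxE.
  have [nk nl gk] := And3 (wt_neq0 k Sz) (wt_neq0 l Sz) (gam_neq0 k Sz).
  rewrite !DelE // conj_weight // rmorphM /= conji.
  have i2 : 'i%C * 'i%C = -1 :> R[i] by rewrite -expr2 sqr_i.
  move: (Num.conj _) => y; field: i2.
  by rewrite nl gam_neq0.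
exists K; apply: filterS hK => z hK Sz.
rewrite ME // GE // endo_norm_conj; [exact: hK | exact: UB | exact: (diag_unit Del_neq0)].
Qed.

End WeightedBound.

(** * Orders of vanishing along a coordinate line *)

Lemma sum_I2 (U : zmodType) (F : 'I_2 -> U) : \sum_a F a = F 0 + F 1.
Proof. by rewrite big_ord_recl big_ord1; congr (F _ + F _); exact: val_inj. Qed.

Section VanishingTerms.
Variable F : pzRingType.
Implicit Types x y b c d : F.

Lemma drop_vanishing x d b c : b = 0 -> x * (d + b * c) = x * d.
Proof. by move=> ->; rewrite mul0r addr0. Qed.

Lemma drop_first_term x b c y : b = 0 -> x * b + c * y = c * y.
Proof. by move=> ->; rewrite mulr0 add0r. Qed.

Lemma drop_second_term x y b c : b = 0 -> x * y + b * c = x * y.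
Proof. by move=> ->; rewrite mul0r addr0. Qed.

Lemma vanishing_pair x y c d : x = 0 -> d = 0 -> x * y + c * d = 0.
Proof. by move=> -> ->; rewrite mul0r mulr0 addr0. Qed.

End VanishingTerms.

Section Vanishing.
Context {R : realType}.
Local Notation V := 'rV[R[i]]_2.
Variables (A : set V) (p : V).
Hypotheses (oA : open A) (Ap : A p) (p0 : p 0 0 = 0).
Implicit Types (f psi : V -> R[i]) (z : V).

Lemma near_p (P : V -> Prop) : (\forall z \near p, P z) ->
  exists2 e : R[i], 0 < e & forall z : V, (forall j, `|p 0 j - z 0 j| < e) -> P z.
Proof.
move=> /nbhs_ballP [e /= e0 h]; exists e => // z hz; apply: h; split=> // i j.
by rewrite ord1; exact: hz.
Qed.

Lemma near_box (e : R[i]) : 0 < e ->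
  nbhs p [set z : V | forall j, `|p 0 j - z 0 j| < e].
Proof.
move=> e0; apply/nbhs_ballP; exists e => //= z [_ h] j; exact: h.
Qed.

Let foot z : V := z - z 0 0 *: evec 0.

Lemma segment_entry z (w : R) j : (foot z + w%:C *: (z 0 0 *: evec 0)) 0 j =
  if j == 0 then w%:C * z 0 0 else z 0 j.
Proof.
rewrite !mxE /=; case: eqP => [->|_]; first by rewrite !mulr1 subrr add0r.
by rewrite !mulr0 subr0 addr0.
Qed.

Lemma segment_box e z (w : R) : (forall j, `|p 0 j - z 0 j| < e) -> `|w| <= 1 ->
  forall j, `|p 0 j - (foot z + w%:C *: (z 0 0 *: evec 0)) 0 j| < e.
Proof.
move=> hz hw j; rewrite segment_entry; case: eqP => [->|_]; last exact: hz.
have := hz 0; rewrite p0 !sub0r !normrN normrM => h.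
apply: le_lt_trans h; rewrite ler_piMl //.
by rewrite normc_def /= expr0n addr0 sqrtr_sqr lecR.
Qed.

(** The mean value theorem on the segment from the foot point, where [psi] vanishes.  It
holds for real parts only; the factor [c] gives access to the imaginary part, or
normalises the derivative. *)
Lemma segment_MVT (e : R[i]) psi (dpsi : V -> R[i]) (c : R[i]) z :
  (forall y : V, (forall j, `|p 0 j - y 0 j| < e) ->
     cder (line psi y (z 0 0 *: evec 0)) 0 (dpsi y)) ->
  (forall y : V, (forall j, `|p 0 j - y 0 j| < e) -> y 0 0 = 0 -> psi y = 0) ->
  (forall j, `|p 0 j - z 0 j| < e) ->
  exists w : R, `|w| <= 1 /\
    complex.Re (c * psi z) =
    complex.Re (c * dpsi (foot z + w%:C *: (z 0 0 *: evec 0))).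
Proof.
move=> hd hv hz.
have [|w hw] := @MVT_line R V (fun y => complex.Re (c * psi y))
   (fun y => complex.Re (c * dpsi y)) (foot z) (z 0 0 *: evec 0) 1.
  move=> w; rewrite normr1 => hw.
  have := hd _ (segment_box hz hw).
  move=> /(cderM (cder_cst c 0)) []; rewrite mul0r add0r.
  by [].
rewrite normr1 in hw.
have -> : foot z + (1 : R)%:C *: (z 0 0 *: evec 0) = z by rewrite scale1r subrK.
rewrite [psi (foot z)]hv; last first.
- by rewrite !mxE /= mulr1 subrr.
- move=> j; have := @segment_box e z 0 hz; rewrite normr0 => /(_ ler01 j).
  by rewrite scale0r addr0.
by rewrite mulr0 subr0 mulr1 => ->; exists w.
Qed.

Lemma normc_le_ReIm (x : R[i]) : `|x| <= `|complex.Re x|%:C + `|complex.Im x|%:C.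
Proof.
rewrite {1}(complexE x); apply: le_trans (ler_normD _ _) _; rewrite normrM.
have nr (a : R) : `|a%:C : R[i]| = `|a|%:C.
  by rewrite normc_def /= expr0n addr0 sqrtr_sqr.
by rewrite !nr normc_def /= expr0n expr1n add0r sqrtr1 mul1r.
Qed.

Lemma dir_deriv_evec0 psi y (c : R[i]) : C1_at psi y ->
  dir_deriv (c *: evec 0) psi y =
    del (evec 0) psi y * c + delbar (evec 0) psi y * Num.conj c.
Proof.
move=> hpsi; rewrite dir_deriv_wirtinger // sum_I2.
have -> : (c *: evec 0 : V) 0 0 = c by rewrite !mxE mulr1.
have -> : (c *: evec 0 : V) 0 1 = 0 by rewrite !mxE mulr0.
rewrite conjC0; move: (del (evec 1) psi y) (delbar (evec 1) psi y) => a b.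
by rewrite (mulr0 a) (mulr0 b) !addr0.
Qed.

(** Mean value theorem on the segment of direction 0 ending on the line.  The
constant is doubled for the two operators [del] and [delbar], and again for the
real and imaginary parts. *)
Lemma vanishing_order_step n psi (K : R[i]) : class_Cn 1 A psi ->
  (forall z : V, A z -> z 0 0 = 0 -> psi z = 0) ->
  (\forall z \near p, `|del (evec 0) psi z| <= K * `|z 0 0| ^+ n) ->
  (\forall z \near p, `|delbar (evec 0) psi z| <= K * `|z 0 0| ^+ n) ->
  \forall z \near p, `|psi z| <= (K *+ 4) * `|z 0 0| ^+ n.+1.
Proof.
move=> hpsi hv h1 h2.
have nA : \forall z \near p, A z by exact: open_nbhs_nbhs.
have [e e0 he] := near_p (filterI nA (filterI h1 h2)).
apply: filterS (near_box e0) => z hz.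
have bd (c : R[i]) : `|c| = 1 -> `|complex.Re (c * psi z)|%:C <= (K *+ 2) * `|z 0 0| ^+ n.+1.
  move=> c1.
  have [||//|w [hw ->]] := @segment_MVT e psi (dir_deriv (z 0 0 *: evec 0) psi) c z.
  - move=> y /he [Ay _]; apply: dir_derivableP; exact: (Cn_derivable hpsi Ay).
  - by move=> y /he [Ay _]; exact: hv.
  set y := foot z + _.
  have [Ay [hy1 hy2]] := he y (segment_box hz hw).
  apply: le_trans (normc_ge_Re _) _; rewrite normrM c1 mul1r.
  rewrite (dir_deriv_evec0 _ (Cn_C1_at oA hpsi Ay)).
  move: (del (evec 0) psi y) (delbar (evec 0) psi y) hy1 hy2 => a b hy1 hy2.
  have yz : `|y 0 0| <= `|z 0 0|.
    rewrite segment_entry eqxx normrM ler_piMl //.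
    by rewrite normc_def /= expr0n addr0 sqrtr_sqr lecR.
  have K0 : `|z 0 0| ^+ n.+1 = `|z 0 0| ^+ n * `|z 0 0| by rewrite exprSr.
  have yn : `|y 0 0| ^+ n <= `|z 0 0| ^+ n by rewrite lerXn2r ?nnegrE.
  have [z00|z00] := eqVneq (z 0 0) 0.
    by rewrite z00 conjC0 mulr0 mulr0 addr0 normr0 expr0n mulr0.
  have K_ge0 : 0 <= K.
    have [_ [hz1 _]] := he z hz; move: (le_trans (normr_ge0 _) hz1).
    by rewrite pmulr_lge0 // exprn_gt0 // normr_gt0.
  apply: le_trans (ler_normD _ _) _.
  rewrite !normrM norm_conjC K0 mulrA mulr2n !mulrDl.
  have nz := normr_ge0 (z 0 0).
  apply: lerD; apply: (ler_wpM2r nz).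
    by apply: le_trans hy1 _; exact: (ler_wpM2l K_ge0 yn).
  by apply: le_trans hy2 _; exact: (ler_wpM2l K_ge0 yn).
apply: le_trans (normc_le_ReIm _) _.
have b1 := bd 1 (normr1 _); rewrite mul1r in b1.
have ni : `|'i%C : R[i]| = 1 by rewrite normc_def /= expr0n expr1n add0r sqrtr1.
have b2 := bd 'i%C ni; rewrite mulrC ReiNIm normrN in b2.
rewrite (_ : K *+ 4 = K *+ 2 + K *+ 2); last by rewrite -mulrnDr.
by rewrite mulrDl; exact: lerD.
Qed.

Lemma vanishing_order1 psi : class_Cn 1 A psi ->
  (forall z : V, A z -> z 0 0 = 0 -> psi z = 0) ->
  exists2 K : R[i], 0 <= K & \forall z \near p, `|psi z| <= K * `|z 0 0|.
Proof.
move=> hpsi hv.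
have c1 : {for p, continuous (del (evec 0) psi)}.
  exact: Cn_continuous (Cn_del _ oA hpsi) Ap.
have c2 : {for p, continuous (delbar (evec 0) psi)}.
  exact: Cn_continuous (Cn_delbar _ oA hpsi) Ap.
have [K1 h1] := @lbd_continuous R V setT p _ c1.
have [K2 h2] := @lbd_continuous R V setT p _ c2.
have K10 : 0 <= K1 by exact: le_trans (normr_ge0 _) (nbhs_singleton h1 I).
have K20 : 0 <= K2 by exact: le_trans (normr_ge0 _) (nbhs_singleton h2 I).
exists ((K1 + K2) *+ 4); first by rewrite mulrn_wge0 // addr_ge0.
apply: (@vanishing_order_step 0) => //.
  apply: filterS h1 => z h; rewrite expr0 mulr1; apply: le_trans (h I) _.
  by rewrite lerDl.
apply: filterS h2 => z h; rewrite expr0 mulr1; apply: le_trans (h I) _.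
by rewrite lerDr.
Qed.

Lemma vanishing_order2 psi : class_Cn 2 A psi ->
  (forall z : V, A z -> z 0 0 = 0 -> [/\ psi z = 0, del (evec 0) psi z = 0 &
     delbar (evec 0) psi z = 0]) ->
  exists K : R[i], \forall z \near p, `|psi z| <= K * `|z 0 0| ^+ 2.
Proof.
move=> hpsi hv.
have [|K1 K10 h1] := vanishing_order1 (Cn_del (evec 0) oA hpsi).
  by move=> z Az z0; case: (hv z Az z0).
have [|K2 K20 h2] := vanishing_order1 (Cn_delbar (evec 0) oA hpsi).
  by move=> z Az z0; case: (hv z Az z0).
exists ((K1 + K2) *+ 4); apply: vanishing_order_step (CnW hpsi) _ _ _.
- by move=> z Az z0; case: (hv z Az z0).
- apply: filterS h1 => z h; rewrite expr1; apply: le_trans h _.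
  by apply: ler_wpM2r => //; rewrite lerDl.
- apply: filterS h2 => z h; rewrite expr1; apply: le_trans h _.
  by apply: ler_wpM2r => //; rewrite lerDr.
Qed.

(** Direction 1 is tangent to the line [z_0 = 0]. *)
Lemma wirt_tangent s psi y : class_Cn 1 A psi ->
  (forall z : V, A z -> z 0 0 = 0 -> psi z = 0) -> A y -> y 0 0 = 0 ->
  wirt s (evec 1) psi y = 0.
Proof.
move=> hpsi hv Ay y0.
have nA : \forall z \near y, A z by exact: open_nbhs_nbhs.
have h (a : R[i]) : dir_deriv (a *: evec 1 : V) psi y = 0.
  apply: cder_dir_deriv; apply: cder_near (cder_cst 0 0).
  apply: filterS (near_line (a *: evec 1 : V) nA) => t At; apply/esym/hv => //.
  by rewrite !mxE /= y0 !mulr0 addr0.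
by rewrite /wirt h -[evec 1]scale1r h mulr0 addr0 mul0r.
Qed.

Variable f : V -> R[i].
Hypotheses (hf : class_Cn 1 A f) (hol : forall z, A z -> forall v, delbar v f z = 0)
  (f_line : forall z, A z -> z 0 0 = 0 -> f z = 0)
  (f_simple : exists k : 'I_2, del (evec k) f p != 0).

(** The derivative of [f] along the line vanishes, so simplicity of the zero means that
its derivative [al] across the line does not; near [p] the quotient of [f] by
[al * z_0] then has real part at least one half. *)
Lemma coordinate_le_equation :
  exists2 K : R[i], 0 <= K & nbhs p [set z : V | `|z 0 0| <= K * `|f z|].
Proof.
have [k hk] := f_simple.
pose al := del (evec 0) f p.
have al0 : al != 0.
  move: hk; have [->//|k1] : k = 0 \/ k = 1.
    by case: k => [[|[|//]] ?]; [left | right]; exact: val_inj.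
  by rewrite k1 delE wirt_tangent ?eqxx.
have nA : \forall z \near p, A z by exact: open_nbhs_nbhs.
have cont : (fun z => del (evec 0) f z / al) @ p --> (1 : R[i]).
  rewrite -(divff al0); apply: (@cvgM R[i] V (nbhs p) _ (del (evec 0) f) (fun=> al^-1)).
    exact: Cn_continuous (Cn_del _ oA hf) Ap.
  exact: cvg_cst.
have n1 : \forall z \near p, `|1 - del (evec 0) f z / al| <= 2^-1.
  by move/cvgrPdist_le : cont => /(_ 2^-1); apply; rewrite invr_gt0 ltr0n.
have [e e0 he] := near_p (filterI nA n1).
exists (2 / `|al|); first by rewrite divr_ge0.
apply: filterS (near_box e0) => z hz.
rewrite /=; have [z00|z0] := eqVneq (z 0 0) 0.
  by rewrite z00 normr0 mulr_ge0 ?divr_ge0.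
have dE y : A y -> dir_deriv (z 0 0 *: evec 0) f y = del (evec 0) f y * z 0 0.
  by move=> Ay; rewrite (dir_deriv_evec0 _ (Cn_C1_at oA hf Ay)) hol // mul0r addr0.
have [||//|w [hw hR]] := @segment_MVT e f (dir_deriv (z 0 0 *: evec 0) f) (al * z 0 0)^-1 z.
- move=> y /he [Ay _]; apply: dir_derivableP; exact: (Cn_derivable hf Ay).
- by move=> y /he [Ay _]; exact: f_line.
move: hR; set y := foot z + _ => hR.
have [Ay hy] := he y (segment_box hz hw).
have hq : complex.Re (1 - del (evec 0) f y / al) <= 2^-1.
  have := le_trans (normc_ge_Re _) hy.
  rewrite -[X in _ <= X](_ : (2^-1)%:C = _); last by rewrite fmorphV rmorph_nat.
  by rewrite lecR; exact: le_trans (ler_norm _).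
have {}hR : 2^-1 <= complex.Re ((al * z 0 0)^-1 * f z).
  rewrite hR dE // (_ : (al * z 0 0)^-1 * (del (evec 0) f y * z 0 0) = del (evec 0) f y / al); last first.
    move: (del _ _ _) (z 0 0) z0 => a b b0; by field; rewrite b0 al0.
  have ReN (x : R[i]) : complex.Re (- x) = - complex.Re x by case: x.
  move: hq; rewrite ReD ReN; move: (complex.Re (del _ _ _ / _)) => a /=; lra.
have : (2^-1 : R[i]) <= `|(al * z 0 0)^-1 * f z|.
  apply: le_trans (normc_ge_Re _).
  rewrite (_ : (2^-1 : R[i]) = (2^-1)%:C); last by rewrite fmorphV rmorph_nat.
  by rewrite lecR; apply: le_trans hR (ler_norm _).
rewrite normrM normfV normrM mulrC ler_pdivlMr ?mulr_gt0 ?normr_gt0 // => h.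
rewrite -(ler_pM2l (_ : 0 < `|al| / 2)); last by rewrite divr_gt0 ?normr_gt0.
have n2 : `|al| != 0 by rewrite normr_eq0.
rewrite (_ : `|al| / 2 * (2 / `|al| * `|f z|) = `|f z|); last by field.
by rewrite mulrAC mulrC.
Qed.

Variable S : set V.
Hypothesis f_neq0 : forall z, S z -> f z != 0.

Lemma lbd_div1 psi : class_Cn 1 A psi ->
  (forall z : V, A z -> z 0 0 = 0 -> psi z = 0) -> lbd S p (fun z => psi z / f z).
Proof.
move=> hpsi hv; have [K K0 h] := vanishing_order1 hpsi hv.
have [K' K'0 h'] := coordinate_le_equation.
exists (K * K'); apply: filterS2 h h' => z h h' Sz.
rewrite normrM normfV ler_pdivrMr ?normr_gt0 ?f_neq0 //.
by apply: le_trans h _; rewrite -mulrA; exact: ler_wpM2l.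
Qed.

Lemma lbd_div2 psi : class_Cn 2 A psi ->
  (forall z : V, A z -> z 0 0 = 0 -> [/\ psi z = 0, del (evec 0) psi z = 0 &
     delbar (evec 0) psi z = 0]) -> lbd S p (fun z => psi z / f z ^+ 2).
Proof.
move=> hpsi hv; have [K h] := vanishing_order2 hpsi hv.
have [K' K'0 h'] := coordinate_le_equation.
exists (`|K| * K' ^+ 2); apply: filterS2 h h' => z h h' Sz.
rewrite normrM normfV normrX ler_pdivrMr ?exprn_gt0 ?normr_gt0 ?f_neq0 //.
rewrite -mulrA -exprMn; apply: le_trans (_ : `|K| * `|z 0 0| ^+ 2 <= _).
  have := le_trans (normr_ge0 _) h => Kz.
  by apply: le_trans h _; rewrite -[X in X <= _]ger0_norm // normrM [`|_ ^+ 2|]ger0_norm.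
by apply: ler_wpM2l => //; rewrite lerXn2r ?nnegrE ?mulr_ge0.
Qed.

End Vanishing.

(** * The norm of a defining section *)

Section DivisorNorm.
Context {R : realType} {V : normedModType R[i]}.
Variables (A : set V) (f hh : V -> R[i]).
Hypotheses (oA : open A) (hf : class_Cn 3 A f)
  (hol : forall z, A z -> forall v, delbar v f z = 0)
  (hhC : class_Cn 3 A hh) (hh0 : forall z, A z -> 0 < hh z).

(** The square of the norm of the section with local equation [f], when the
trivialising section has square norm [hh]. *)
Definition sqnorm z : R := complex.Re (hh z * (f z * Num.conj (f z))).

Lemma sqnormE z : A z -> (sqnorm z)%:C = hh z * (f z * Num.conj (f z)).
Proof.
move=> Az; apply: RRe_real; apply: ger0_real.
by apply: mulr_ge0; [rewrite ltW // hh0 | rewrite -normCK exprn_ge0].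
Qed.

Lemma sqnorm_ge0 z : A z -> 0 <= sqnorm z.
Proof.
move=> Az; rewrite -lecR sqnormE //.
by apply: mulr_ge0; [rewrite ltW // hh0 | rewrite -normCK exprn_ge0].
Qed.

Lemma sqnorm_gt0 z : A z -> f z != 0 -> 0 < sqnorm z.
Proof.
move=> Az fz; rewrite -ltcR sqnormE //.
by apply: mulr_gt0; [exact: hh0 | rewrite -normCK exprn_gt0 // normr_gt0].
Qed.

(** The logarithmic derivative [del_sqnorm] of [sqnorm]: the conjugate of [f] is
antiholomorphic and contributes nothing. *)
Definition dlog_sqnorm v z : R[i] := del v hh z / hh z + del v f z / f z.

Lemma hh_neq0 z : A z -> hh z != 0.
Proof. by move=> Az; rewrite gt_eqF // hh0. Qed.

Lemma derivable_sqnorm z : A z -> derivable_at (fun x => (sqnorm x)%:C) z.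
Proof.
move=> Az; have nA : \forall x \near z, A x by exact: open_nbhs_nbhs.
have df := Cn_derivable hf Az; have dh := Cn_derivable hhC Az.
apply: derivable_at_near (derivable_mul dh (derivable_mul df (derivable_conj df))).
by apply: filterS nA => x Ax; rewrite sqnormE.
Qed.

Lemma near_neq0 z : A z -> f z != 0 -> \forall x \near z, A x /\ f x != 0.
Proof.
move=> Az fz; have nA : \forall x \near z, A x by exact: open_nbhs_nbhs.
apply: filterS2 nA (_ : \forall x \near z, f x != 0) => // .
have fz0 : 0 < `|f z| by rewrite normr_gt0.
have /cvgrPdist_lt/(_ _ fz0) : f @ z --> f z := Cn_continuous hf Az.
apply: filterS => x; apply: contraTneq => ->.
by rewrite subr0 ltxx.
Qed.

Lemma del_sqnorm v z : A z -> f z != 0 ->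
  del v (fun x => (sqnorm x)%:C) z / (sqnorm z)%:C = dlog_sqnorm v z.
Proof.
move=> Az fz; have nA : \forall x \near z, A x by exact: open_nbhs_nbhs.
have df := Cn_derivable hf Az; have dh := Cn_derivable hhC Az.
have dc := derivable_conj df.
have -> : del v (fun x => (sqnorm x)%:C) z =
    del v (fun x => hh x * (f x * Num.conj (f x))) z.
  rewrite !delE; apply: wirt_near (derivable_sqnorm Az).
  by apply: filterS nA => x Ax; rewrite sqnormE.
rewrite delE (wirtM _ _ dh (derivable_mul df dc)) (wirtM _ _ df dc) -!delE.
rewrite delJ // hol // conjC0 sqnormE // /dlog_sqnorm.
have h0 := hh_neq0 Az.
have c0 : Num.conj (f z) != 0 by rewrite conjC_eq0.
move: (del v hh z) (del v f z) (Num.conj (f z)) c0 => a b c c0.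
by field; rewrite fz c0 h0.
Qed.

Lemma derivable_sqnorm_powR a z : A z -> f z != 0 ->
  derivable_at (fun x => (sqnorm x `^ a)%:C) z /\
  forall v, del v (fun x => (sqnorm x `^ a)%:C) z =
    a%:C * dlog_sqnorm v z * (sqnorm z `^ a)%:C.
Proof.
move=> Az fz.
have n0 : \forall x \near z, 0 < sqnorm x.
  by apply: filterS (near_neq0 Az fz) => x [Ax fx]; exact: sqnorm_gt0.
have [h1 h2] := derivable_powR a n0 (derivable_sqnorm Az).
split=> // v; rewrite delE h2 -delE del_sqnorm //.
Qed.

Let dloghh v x := del v hh x / hh x.

Lemma Cn_dloghh v : class_Cn 2 A (dloghh v).
Proof.
apply: (CnM oA (Cn_del v oA hhC)).
exact: CnV oA (CnW hhC) hh_neq0.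
Qed.

Lemma derivable_dlog_sqnorm v z : A z -> f z != 0 -> derivable_at (dlog_sqnorm v) z.
Proof.
move=> Az fz; apply: derivable_add; first exact: Cn_derivable (Cn_dloghh v) Az.
apply: derivable_mul; first exact: Cn_derivable (Cn_del v oA hf) Az.
by apply: derivable_inv => //; exact: Cn_derivable hf Az.
Qed.

(** The logarithm of the modulus of a holomorphic function is pluriharmonic. *)
Lemma delbar_dlog_sqnorm v w z : A z -> f z != 0 ->
  delbar w (dlog_sqnorm v) z = delbar w (dloghh v) z.
Proof.
move=> Az fz; have nA : \forall x \near z, A x by exact: open_nbhs_nbhs.
have df := Cn_derivable hf Az.
have ddf := Cn_derivable (Cn_del v oA hf) Az.
have dI := derivable_inv df fz.
rewrite delbarE /dlog_sqnorm (wirtD _ _ (Cn_derivable (Cn_dloghh v) Az) (derivable_mul ddf dI)).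
rewrite (wirtM _ _ ddf dI) (wirtV _ _ df fz) -!delbarE hol // oppr0 mul0r mulr0 addr0.
suff -> : delbar w (del v f) z = 0 by rewrite mul0r addr0.
have -> : delbar w (del v f) z = wirt 'i%C w (wirt (- 'i%C) v f) z.
  by rewrite delbarE (_ : del v f = wirt (- 'i%C) v f) //; apply/funext => x; exact: delE.
rewrite (wirt_wirt _ _ _ _ oA (CnW hf) Az).
rewrite -(wirt_cst (- 'i%C) v (0 : R[i]) z); apply/esym/wirt_near.
  by apply: filterS nA => x Ax; rewrite -delbarE hol.
exact: derivable_cst.
Qed.

Variables (S : set V) (p : V).
Hypotheses (Ap : A p) (SA : S `<=` A) (f_neq0 : forall z, S z -> f z != 0).

Lemma lbd_delbar_dlog v w : lbd S p (delbar w (dlog_sqnorm v)).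
Proof.
apply: (@lbd_eq_on _ _ _ _ _ (delbar w (dloghh v))) => [z Sz|].
  by apply: delbar_dlog_sqnorm; [exact: SA | exact: f_neq0].
apply: lbd_continuous; exact: Cn_continuous (Cn_delbar w oA (Cn_dloghh v)) Ap.
Qed.

Lemma lbd_sqnorm_powR d : 0 <= d -> lbd S p (fun z => (sqnorm z `^ d)%:C).
Proof.
move=> d0; have [K hK] : lbd S p (fun z => (sqnorm z)%:C).
  apply: (@lbd_eq_on _ _ _ _ _ (fun z => hh z * (f z * Num.conj (f z)))).
    by move=> z Sz; apply: sqnormE; exact: SA.
  have cf := lbd_continuous S (Cn_continuous hf Ap).
  exact: lbdM (lbd_continuous S (Cn_continuous hhC Ap)) (lbdM cf (lbdJ cf)).
exists ((complex.Re K `^ d)%:C); apply: filterS hK => z h Sz.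
have := le_trans (normc_ge_Re _) (h Sz); rewrite lecE /= => /andP[_ {}h].
have nr (a : R) : `|a%:C : R[i]| = `|a|%:C.
  by rewrite normc_def /= expr0n addr0 sqrtr_sqr.
rewrite nr lecR ger0_norm ?powR_ge0 //.
have s0 := sqnorm_ge0 (SA Sz); rewrite ger0_norm // in h.
by apply: ge0_ler_powR => //; rewrite nnegrE // (le_trans s0).
Qed.

Lemma lbd_sqr g : lbd S p (fun z => g z * Num.conj (g z)) -> lbd S p g.
Proof.
move=> [K hK]; exists (1 + K); apply: filterS hK => z h Sz.
have := h Sz; rewrite -normCK normrX normr_id => {}h.
have K0 : 0 <= K by apply: le_trans h; rewrite exprn_ge0.
have [g1|g1] := real_leP (normr_real (g z)) (@real1 R[i]).
  by apply: le_trans g1 _; rewrite lerDl.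
apply: (@le_trans _ _ (`|g z| ^+ 2)); first by rewrite expr2 ler_peMl // ltW.
by apply: le_trans h _; rewrite lerDr ler01.
Qed.

(** Weights above -1 are compensated by one vanishing factor. *)
Lemma lbd_sqnorm_powR_mul d : -1 < d -> lbd S p (fun z => (sqnorm z `^ (d / 2))%:C * f z).
Proof.
move=> d1; apply: lbd_sqr.
apply: (@lbd_eq_on _ _ _ _ _ (fun z => (sqnorm z `^ (d + 1))%:C * (hh z)^-1)); last first.
  apply: lbdM; first by apply: lbd_sqnorm_powR; lra.
  apply: lbd_continuous; apply: (@cvgV _ _ (nbhs p) _ hh (hh p)).
    by rewrite hh_neq0.
  exact: Cn_continuous hhC Ap.
move=> z Sz; have Az := SA Sz; have s0 := sqnorm_gt0 Az (f_neq0 Sz).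
have h0 := hh_neq0 Az.
have -> : (sqnorm z `^ (d + 1))%:C = (sqnorm z `^ (d / 2))%:C ^+ 2 * (sqnorm z)%:C.
  rewrite -rmorphXn -rmorphM; congr (_%:C).
  rewrite -powR_mulrn ?powR_ge0 // -powRrM.
  by rewrite [d / 2 * _]divfK // powRD ?(gt_eqF s0) ?implybT // powRr1 // ltW.
have cr (x : R) : Num.conj (x%:C) = x%:C :> R[i] by exact: conjc_real.
rewrite rmorphM /= cr.
rewrite sqnormE //; move: (sqnorm z `^ (d / 2))%:C (f z) (Num.conj (f z)) => a b c.
by field.
Qed.

End DivisorNorm.

(** * Holomorphic and parallel sections orthogonal to a frame vector *)

Section SecondFundamentalForm.
Context {R : realType} {V : normedModType R[i]} {r : nat}.
Variables (Q G : V -> 'M[R[i]]_r) (rho : V -> 'rV[R[i]]_r) (z v : V) (k l : 'I_r).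
Hypotheses (dQ : derivable_mx Q z) (dG : derivable_mx G z) (drho : derivable_mx rho z)
  (orthonormal : \forall y \near z, Q y *m G y *m (Q y)^t* = 1%:M)
  (orth : \forall y \near z, rho y *m G y *m (row l (Q y))^t* = 0)
  (rhoz : rho z = row k (Q z)).

Lemma row_sandwich n (M N P : 'M[R[i]]_n) a b :
  (row a M *m N *m (row b P)^t*) 0 0 = (M *m N *m P^t*) a b.
Proof.
rewrite !mxE; apply: eq_bigr => j _; rewrite !mxE; congr (_ * _).
by apply: eq_bigr => c _; rewrite !mxE.
Qed.

Let dl : derivable_mx (fun y => row l (Q y)) z.
Proof. by move=> a b; under eq_fun do rewrite mxE; exact: dQ. Qed.

Let wirt_row s : wirt_mx s v (fun y => row l (Q y)) z = row l (wirt_mx s v Q z).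
Proof. by apply/matrixP => a b; rewrite !mxE; under eq_fun do rewrite mxE. Qed.

Let wirt_orth s : wirt_mx s v rho z *m G z *m (row l (Q z))^t* +
  row k (Q z) *m wirt_mx s v G z *m (row l (Q z))^t* +
  row k (Q z) *m G z *m (row l (wirt_mx (Num.conj s) v Q z))^t* = 0.
Proof.
have := wirt_mx_cst s v (0 : 'M[R[i]]_1) z.
rewrite -(@wirt_mx_near _ _ _ _ s v (fun y => rho y *m G y *m (row l (Q y))^t*) _ _ orth
  (derivable_mxM (derivable_mxM drho dG) (derivable_mxJ dl))).
rewrite (wirt_mxM _ _ (derivable_mxM drho dG) (derivable_mxJ dl)).
by rewrite (wirt_mxM _ _ drho dG) (wirt_mxJ _ _ dl) wirt_row rhoz mulmxDl.
Qed.

(** A holomorphic section orthogonal to the [l]-th frame vector and equal to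
the [k]-th one at a point: there the [(0,1)]-derivative of the [k]-th vector
has no component along the [l]-th. *)
Lemma delbar_frame_holomorphic : k != l -> delbar_mx v rho z = 0 ->
  (delbar_mx v Q z *m G z *m (Q z)^t*) k l = 0.
Proof.
move=> kl h0; have := wirt_orth 'i%C.
rewrite -delbar_mxE h0 !mul0mx add0r => /matrixP/(_ 0 0).
rewrite [LHS]mxE !row_sandwich [RHS]mxE => e1.
have := wirt_mx_cst 'i%C v (1%:M : 'M[R[i]]_r) z.
rewrite -(@wirt_mx_near _ _ _ _ 'i%C v (fun y => Q y *m G y *m (Q y)^t*) _ _ orthonormal
  (derivable_mxM (derivable_mxM dQ dG) (derivable_mxJ dQ))).
rewrite (wirt_mxM _ _ (derivable_mxM dQ dG) (derivable_mxJ dQ)).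
rewrite (wirt_mxM _ _ dQ dG) (wirt_mxJ _ _ dQ) mulmxDl => /matrixP/(_ k l).
rewrite [LHS]mxE [X in X + _ = _]mxE [RHS]mxE -addrA e1 addr0.
by rewrite delbar_mxE.
Qed.

(** If that section is parallel, the [l]-th vector has no component along the
[k]-th either. *)
Lemma delbar_frame_parallel : G z \in unitmx -> (G z)^t* = G z ->
  del_mx v rho z + rho z *m chern_conn v G z = 0 ->
  (delbar_mx v Q z *m G z *m (Q z)^t*) l k = 0.
Proof.
move=> UG hG hpar; have := wirt_orth (- 'i%C).
rewrite rmorphN /= conji opprK -!del_mxE.
have -> : del_mx v rho z = - (rho z *m chern_conn v G z).
  by apply/eqP; rewrite -addr_eq0 hpar.
rewrite rhoz /chern_conn mulNmx mulmxA mulmxKV // mulNmx addNr add0r.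
move=> /matrixP/(_ 0 0); rewrite row_sandwich [RHS]mxE -delbar_mxE => e1.
have -> : (delbar_mx v Q z *m G z *m (Q z)^t*) l k =
    Num.conj ((Q z *m G z *m (delbar_mx v Q z)^t*) k l).
  have <- : (Q z *m G z *m (delbar_mx v Q z)^t*)^t* =
      delbar_mx v Q z *m G z *m (Q z)^t*.
    by rewrite !adjmxM adjmxK hG mulmxA.
  by rewrite [LHS]mxE [X in Num.conj X = _]mxE.
by rewrite e1 conjC0.
Qed.

End SecondFundamentalForm.

(** * The estimate near one component *)

Opaque wirt del delbar frame_dbar.

Lemma split_dlog (F : fieldType) (c x s q e y d : F) :
  c * (x + s * (q + e * (y / d))) = c * (x + s * q) + e * (c * s * y / d).
Proof. by ring. Qed.

Section SingleDivisorBound.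
Context {R : realType} {r : nat}.
Local Notation V := 'rV[R[i]]_2.
Variables (A S : set V) (p : V).
Hypotheses (oA : open A) (Ap : A p) (p0 : p 0 0 = 0)
  (oS : open S) (SA : S `<=` A).
Variables (B : V -> 'M[R[i]]_r) (gam : 'I_r -> V -> R[i]) (f hh : V -> R[i]).
Variables (h : V -> 'M[R[i]]_2) (a : 'I_r -> R) (t : 'I_r -> nat).
Hypotheses (BC : class_Cn_mx 3 A B) (UB : forall z, A z -> B z \in unitmx)
  (gamC : forall k, class_Cn 3 A (gam k))
  (gam_gt0 : forall k z, A z -> 0 < gam k z)
  (fC : class_Cn 3 A f) (f_hol : forall z, A z -> forall v, delbar v f z = 0)
  (f_line : forall z : V, A z -> z 0 0 = 0 -> f z = 0)
  (f_simple : exists k : 'I_2, del (evec k) f p != 0)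
  (f_neq0 : forall z, S z -> f z != 0)
  (hhC : class_Cn 3 A hh) (hh_gt0 : forall z, A z -> 0 < hh z)
  (hC : class_Cn_mx 2 A h) (h_herm : forall z, A z -> (h z)^t* = h z)
  (a_ge0 : forall k, 0 <= a k) (a_lt1 : forall k, a k < 1)
  (a_incr : forall k l, (t k < t l)%N -> a k < a l)
  (a_eq : forall k l, t k = t l -> a k = a l).
Local Notation b w := (frame_dbar B (evec w)).
Hypotheses
  (b_normal : forall k l z, A z -> z 0 0 = 0 -> t k <> t l ->
     \sum_w h z w 0 * b w z k l = 0)
  (b_line : forall k l w z, A z -> z 0 0 = 0 -> (t l < t k)%N -> b w z k l = 0)
  (db_normal : forall k l s z, s = 'i%C \/ s = - 'i%C -> A z -> z 0 0 = 0 ->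
     (t l < t k)%N ->
     \sum_w h z w 0 * wirt s (evec 0) (fun x => b w x k l) z = 0).

Let u := sqnorm f hh.
Let wt k z : R[i] := (u z `^ (a k / 2))%:C.
Let Del k z : R[i] := gam k z * (u z `^ a k)%:C.
Let dlgam v k z := del v (gam k) z / gam k z.
Let L v k z := dlgam v k z + (a k)%:C * dlog_sqnorm f hh v z.

Let gam_neq0 k z : A z -> gam k z != 0.
Proof. by move=> Az; rewrite gt_eqF // gam_gt0. Qed.

Let u_gt0 z : S z -> 0 < u z.
Proof. by move=> Sz; apply: (sqnorm_gt0 hh_gt0 (SA Sz)); exact: f_neq0. Qed.

Let DelE k z : S z -> Del k z = gam k z * wt k z ^+ 2.
Proof.
move=> Sz; rewrite /Del /wt -rmorphXn; congr (_ * _%:C).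
by rewrite -powR_mulrn ?powR_ge0 // -powRrM divfK.
Qed.

Let wt_neq0 k z : S z -> wt k z != 0.
Proof.
move=> Sz; rewrite /wt eq_complex /= eqxx andbT.
by rewrite gt_eqF // powR_gt0 // u_gt0.
Qed.

Let wt_real k z : S z -> Num.conj (wt k z) = wt k z.
Proof. by move=> _; exact: conjc_real. Qed.

Let gam_real k z : S z -> Num.conj (gam k z) = gam k z.
Proof. by move=> Sz; apply: conj_Creal; rewrite ger0_real // ltW // gam_gt0 //; exact: SA. Qed.

Let dlgamC v k : class_Cn 2 A (dlgam v k).
Proof.
apply: (CnM oA (Cn_del v oA (gamC k))).
by apply: CnV oA (CnW (gamC k)) _ => z; exact: gam_neq0.
Qed.

Let Del_derivable k z : S z -> derivable_at (Del k) z.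
Proof.
move=> Sz; have Az := SA Sz.
apply: derivable_mul; first exact: Cn_derivable (gamC k) Az.
by have [] := derivable_sqnorm_powR oA fC f_hol hhC hh_gt0 (a k) Az (f_neq0 Sz).
Qed.

Let LE v k z : S z -> del v (Del k) z = L v k z * Del k z.
Proof.
move=> Sz; have Az := SA Sz.
have [h1 h2] := derivable_sqnorm_powR oA fC f_hol hhC hh_gt0 (a k) Az (f_neq0 Sz).
rewrite delE /Del (wirtM _ _ (Cn_derivable (gamC k) Az) h1) -!delE h2 /L /dlgam -/u.
move: (del v (gam k) z) (dlog_sqnorm f hh v z) (_ `^ _)%:C (gam_neq0 k Az) => x y q.
by move: (gam k z) (a k)%:C => c e c0; field.
Qed.

Let L_derivable v k z : S z -> derivable_at (L v k) z.
Proof.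
move=> Sz; have Az := SA Sz; apply: derivable_add; first exact: Cn_derivable (dlgamC v k) Az.
apply: derivable_mul; first exact: derivable_cst.
exact: derivable_dlog_sqnorm oA fC hhC hh_gt0 v z Az (f_neq0 Sz).
Qed.

Let dL_lbd v w k : lbd S p (delbar w (L v k)).
Proof.
apply: (@lbd_eq_on _ _ _ _ _ (fun z => delbar w (dlgam v k) z +
   (a k)%:C * delbar w (dlog_sqnorm f hh v) z)).
  move=> z Sz; have Az := SA Sz.
  have d1 := Cn_derivable (dlgamC v k) Az.
  have d2 := derivable_dlog_sqnorm oA fC hhC hh_gt0 v Az (f_neq0 Sz).
  have dc := derivable_cst (V := V) (a k)%:C z.
  rewrite !delbarE /L (wirtD _ _ d1 (derivable_mul dc d2)) (wirtM _ _ dc d2).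
  by rewrite wirt_cst mul0r add0r.
apply: lbdD.
  by apply: lbd_continuous; exact: Cn_continuous (Cn_delbar w oA (dlgamC v k)) Ap.
apply: lbdM; first exact: lbd_cst.
exact: lbd_delbar_dlog oA fC f_hol hhC hh_gt0 _ _ Ap SA f_neq0 _ _.
Qed.

Let bC w k l : class_Cn 2 A (fun z => b w z k l).
Proof. exact: (Cn_frame_dbar (evec w) oA BC UB). Qed.

Let mu k l z := wt l z / wt k z.

Let muE k l z : S z -> mu k l z = (u z `^ ((a l - a k) / 2))%:C.
Proof.
move=> Sz; have u0 := u_gt0 Sz; rewrite /mu /wt -fmorphV -rmorphM; congr (_%:C).
by rewrite mulrBl powRB ?(gt_eqF u0) ?implybT.
Qed.

Let mu_lbd k l : a k <= a l -> lbd S p (mu k l).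
Proof.
move=> kl; apply: (lbd_eq_on (muE k l)).
by apply: (lbd_sqnorm_powR fC hhC hh_gt0 Ap SA); rewrite divr_ge0 // subr_ge0.
Qed.

(* The weights lie in [0, 1), so their differences exceed -1. *)
Let muf_lbd k l : lbd S p (fun z => mu k l z * f z).
Proof.
apply: (@lbd_eq_on _ _ _ _ _ (fun z => (u z `^ ((a l - a k) / 2))%:C * f z)).
  by move=> z Sz; rewrite muE.
apply: (lbd_sqnorm_powR_mul fC hhC hh_gt0 Ap SA f_neq0).
by have := a_ge0 l; have := a_lt1 k; lra.
Qed.

Let b_lbd w k l : lbd S p (fun z => mu k l z * b w z k l).
Proof.
have bc := lbd_continuous S (Cn_continuous (bC w k l) Ap).
have [kl|lk] := leqP (t k) (t l).
  apply: lbdM bc; apply: mu_lbd.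
  by move: kl; rewrite leq_eqVlt => /orP[/eqP/a_eq->//|/a_incr/ltW].
apply: (@lbd_eq_on _ _ _ _ _ (fun z => (mu k l z * f z) * (b w z k l / f z))).
  move=> z Sz; rewrite -mulrA; congr (_ * _); rewrite mulrCA mulfV ?mulr1 //.
  exact: f_neq0.
apply: lbdM (muf_lbd k l) _.
apply: (lbd_div1 oA Ap p0 (CnW (CnW fC)) f_hol f_line f_simple f_neq0 (CnW (bC w k l))).
by move=> z Az z0; exact: b_line.
Qed.

(* The difference of two logarithmic derivatives without its pole, which comes from
the logarithmic derivative of f. *)
Let sdif k l v z := dlgam v l z - dlgam v k z +
  (a l - a k)%:C * (del v hh z / hh z).

Let Ldif k l v z : L v l z - L v k z =
  sdif k l v z + (a l - a k)%:C * (del v f z / f z).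
Proof.
rewrite /L /sdif /dlog_sqnorm rmorphB /=.
move: (dlgam v l z) (dlgam v k z) (_ / hh z) (_ / f z) => x y q s.
move: (a l)%:C (a k)%:C => c d; ring.
Qed.

(* The contraction in the estimate is psi + (a l - a k) * phi / f: psi has no pole
and phi collects the poles of the logarithmic derivatives of f. *)
Let psi k l z := \sum_v \sum_w h z w v *
  (del (evec v) (fun x => b w x k l) z + b w z k l * sdif k l (evec v) z).

Let phi k l z := \sum_v (\sum_w h z w v * b w z k l) * del (evec v) f z.

Let sdifC k l v : class_Cn 2 A (sdif k l v).
Proof.
apply: (CnD oA).
  apply: (CnD oA (dlgamC v l)).
  apply: Cn_eq oA _ (CnM oA (Cn_cst 2 A (-1)) (dlgamC v k)) => z _.
  exact: mulN1r.
apply: (CnM oA (Cn_cst _ _ _)); apply: (CnM oA (Cn_del v oA hhC)).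
by apply: CnV oA (CnW hhC) _ => z; exact: hh_neq0.
Qed.

Let psiC k l : class_Cn 1 A (psi k l).
Proof.
apply: (Cn_sum _ _ oA) => v; apply: (Cn_sum _ _ oA) => w.
apply: (CnM oA (CnW (hC w v))).
apply: (CnD oA (Cn_del _ oA (bC w k l))).
exact: (CnM oA (CnW (bC w k l)) (CnW (sdifC k l _))).
Qed.

Let phiC k l : class_Cn 2 A (phi k l).
Proof.
apply: (Cn_sum _ _ oA) => v; apply: (CnM oA _ (Cn_del _ oA fC)).
by apply: (Cn_sum _ _ oA) => w; exact: (CnM oA (hC w v) (bC w k l)).
Qed.

(* Derivatives along the divisor vanish, so that only the terms with v = 0 of phi and
psi survive on it. *)
Let f_tangent z : A z -> z 0 0 = 0 -> del (evec 1) f z = 0.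
Proof.
move=> Az z0; rewrite delE.
exact: (wirt_tangent oA _ (CnW (CnW fC)) f_line Az z0).
Qed.

Let phi_line k l z : t k <> t l -> A z -> z 0 0 = 0 -> phi k l z = 0.
Proof.
move=> kl Az z0; rewrite /phi sum_I2.
exact: vanishing_pair (b_normal Az z0 kl) (f_tangent Az z0).
Qed.

Let psi_line k l z : (t l < t k)%N -> A z -> z 0 0 = 0 -> psi k l z = 0.
Proof.
move=> kl Az z0; rewrite /psi sum_I2.
have bz w : b w z k l = 0 := b_line w Az z0 kl.
have d1 w : del (evec 1) (fun x => b w x k l) z = 0.
  rewrite delE; apply: (wirt_tangent oA _ (CnW (bC w k l)) _ Az z0).
  by move=> x Ax x0; exact: b_line.
have e v w : h z w v * (del (evec v) (fun x => b w x k l) z + b w z k l * sdif k l (evec v) z)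
    = h z w v * del (evec v) (fun x => b w x k l) z.
  exact: drop_vanishing (bz w).
transitivity (\sum_w h z w 0 * del (evec 0) (fun x => b w x k l) z +
    \sum_w h z w 1 * del (evec 1) (fun x => b w x k l) z).
  by apply: congr2; apply: eq_bigr => w _; exact: e.
rewrite [X in _ + X]big1 => [|w _]; last by rewrite (d1 w) mulr0.
rewrite addr0 -[RHS](db_normal (or_intror erefl) Az z0 kl).
by apply: eq_bigr => w _; apply: congr1; exact: delE.
Qed.

Let wirt_phi k l s z : s = 'i%C \/ s = - 'i%C -> (t l < t k)%N -> A z -> z 0 0 = 0 ->
  wirt s (evec 0) (phi k l) z = 0.
Proof.
move=> hs kl Az z0.
have dh w v : derivable_at (fun x => h x w v) z := Cn_derivable (hC w v) Az.
have db w : derivable_at (fun x => b w x k l) z := Cn_derivable (bC w k l) Az.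
have df v : derivable_at (del (evec v) f) z := Cn_derivable (Cn_del (evec v) oA fC) Az.
have ds v : derivable_at (fun x => \sum_w h x w v * b w x k l) z.
  by apply: derivable_sum => w; exact: derivable_mul (dh w v) (db w).
rewrite /phi (wirt_sum _ _ _ (fun v => derivable_mul (ds v) (df v))) sum_I2.
have bz w : b w z k l = 0 := b_line w Az z0 kl.
have e v : wirt s (evec 0) (fun x => (\sum_w h x w v * b w x k l) * del (evec v) f x) z =
   (\sum_w h z w v * wirt s (evec 0) (fun x => b w x k l) z) * del (evec v) f z.
  rewrite (wirtM _ _ (ds v) (df v)) [X in _ + X * _]big1; last first.
    by move=> w _; rewrite (bz w) mulr0.
  rewrite (mul0r (wirt s (evec 0) (del (evec v) f) z)) addr0.
  apply: (congr1 (fun x => x * _)); rewrite (wirt_sum _ _ _ (fun w => derivable_mul (dh w v) (db w))).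
  apply: eq_bigr => w _; rewrite (wirtM _ _ (dh w v) (db w)).
  exact: drop_first_term (bz w).
apply: etrans (congr2 +%R (e 0) (e 1)) _.
have f1 := f_tangent Az z0; have n0 := db_normal hs Az z0 kl.
by apply: vanishing_pair n0 f1.
Qed.

Let db_lbd k l : lbd S p (fun z => mu k l z *
     \sum_v \sum_w h z w v * (del (evec v) (fun x => b w x k l) z +
       b w z k l * (L (evec v) l z - L (evec v) k z))).
Proof.
apply: (@lbd_eq_on _ _ _ _ _ (fun z => mu k l z * psi k l z +
   (a l - a k)%:C * (mu k l z * (phi k l z / f z)))).
  move=> z Sz; rewrite mulrCA -mulrDr; congr (_ * _).
  rewrite /psi /phi mulr_suml mulr_sumr -big_split /=; apply: eq_bigr => v _.
  rewrite !mulr_suml mulr_sumr -big_split /=; apply: eq_bigr => w _.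
  rewrite Ldif.
  exact: split_dlog.
have psi_c := lbd_continuous S (Cn_continuous (psiC k l) Ap).
have cst_l := lbd_cst S p ((a l - a k)%:C : R[i]).
have [kl|lk|kl] := ltngtP (t k) (t l).
- have m := mu_lbd (ltW (a_incr kl)).
  apply: lbdD; first exact: lbdM.
  apply: lbdM cst_l (lbdM m _).
  apply: (lbd_div1 oA Ap p0 (CnW (CnW fC)) f_hol f_line f_simple f_neq0 (CnW (phiC k l))).
  by move=> z Az z0; apply: phi_line => // e; rewrite e ltnn in kl.
- apply: lbdD.
    apply: (@lbd_eq_on _ _ _ _ _ (fun z => (mu k l z * f z) * (psi k l z / f z))).
      move=> z Sz; rewrite -mulrA; congr (_ * _); rewrite mulrCA mulfV ?mulr1 //.
      exact: f_neq0.
    apply: lbdM (muf_lbd k l) _.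
    apply: (lbd_div1 oA Ap p0 (CnW (CnW fC)) f_hol f_line f_simple f_neq0 (psiC k l)).
    by move=> z; exact: psi_line.
  apply: lbdM cst_l _.
  apply: (@lbd_eq_on _ _ _ _ _ (fun z => (mu k l z * f z) * (phi k l z / f z ^+ 2))).
    move=> z Sz; have fz := f_neq0 Sz; move: (mu k l z) (phi k l z) => x y.
    by move: (f z) fz => c c0; field.
  apply: lbdM (muf_lbd k l) _.
  apply: (lbd_div2 oA Ap p0 (CnW (CnW fC)) f_hol f_line f_simple f_neq0 (phiC k l)).
  move=> z Az z0; split.
  + by apply: phi_line => // e; rewrite e ltnn in lk.
  + by rewrite delE; apply: wirt_phi => //; right.
  + by rewrite delbarE; apply: wirt_phi => //; left.
have e := a_eq kl.
apply: (@lbd_eq_on _ _ _ _ _ (fun z => mu k l z * psi k l z)).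
  by move=> z Sz; rewrite e subrr mul0r addr0.
by apply: lbdM psi_c; apply: mu_lbd; rewrite e.
Qed.

(** The ratio [mu k l] of weights is bounded if [a k <= a l], and in any case after
multiplication by [f].  When [t l < t k] the missing factor [f] comes from
[b_line] and [db_normal], and for the terms with a pole from the second order vanishing of [phi];
when [t k < t l] the pole is compensated by [b_normal] alone. *)
Theorem single_divisor_bound (G : V -> 'M[R[i]]_r) :
  (forall z, S z -> G z = B z *m diag_mx (\row_k (gam k z * (u z `^ a k)%:C)) *m (B z)^t*) ->
  exists K : R, \forall z \near p, S z -> endo_norm (G z)
    (- 'i%C *: \sum_(k < 2) \sum_(l < 2)
       h z l k *: chern_curv (evec k) (evec l) G z) <= K.
Proof.
move=> GE.
apply: (@endo_norm_diag_bound R r S p B Del L gam wt h oS _ _ DelE _ wt_neq0 gam_real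
  wt_real Del_derivable LE L_derivable) => //.
- exact: Cn_mx_sub SA (Cn_mxW BC).
- by move=> z /SA; exact: UB.
- by move=> k z /SA; exact: gam_neq0.
- by move=> z /SA; exact: h_herm.
- by move=> v w; apply: lbd_continuous; exact: Cn_continuous (hC w v) Ap.
- by move=> k; apply: lbd_continuous; exact: Cn_continuous (gamC k) Ap.
- move=> k; apply: lbd_continuous.
  exact: Cn_continuous (CnV oA (gamC k) (gam_neq0 k)) Ap.
Qed.

End SingleDivisorBound.

(** * The estimate near a crossing *)

Lemma dlog_algebra (F : fieldType) (dc c x1 x2 e1 e2 l1 l2 : F) : c != 0 ->
  (dc * x1 + c * (e1 * l1 * x1)) * x2 + c * x1 * (e2 * l2 * x2) =
  (dc / c + e1 * l1 + e2 * l2) * (c * x1 * x2).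
Proof. by move=> c0; field. Qed.

Section CrossingBound.
Context {R : realType} {r : nat}.
Local Notation V := 'rV[R[i]]_2.
Variables (A S : set V) (p : V).
Hypotheses (oA : open A) (Ap : A p) (oS : open S) (SA : S `<=` A).
Variables (gam : 'I_r -> V -> R[i]) (f1 h1 f2 h2 : V -> R[i]).
Variables (h : V -> 'M[R[i]]_2) (a1 a2 : 'I_r -> R).
Hypotheses (gamC : forall k, class_Cn 3 A (gam k))
  (gam_gt0 : forall k z, A z -> 0 < gam k z)
  (f1C : class_Cn 3 A f1) (f1_hol : forall z, A z -> forall v, delbar v f1 z = 0)
  (f2C : class_Cn 3 A f2) (f2_hol : forall z, A z -> forall v, delbar v f2 z = 0)
  (f1_neq0 : forall z, S z -> f1 z != 0) (f2_neq0 : forall z, S z -> f2 z != 0)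
  (h1C : class_Cn 3 A h1) (h1_gt0 : forall z, A z -> 0 < h1 z)
  (h2C : class_Cn 3 A h2) (h2_gt0 : forall z, A z -> 0 < h2 z)
  (hC : class_Cn_mx 2 A h) (h_herm : forall z, A z -> (h z)^t* = h z).

Let u1 := sqnorm f1 h1.
Let u2 := sqnorm f2 h2.
Let wt k z : R[i] := (u1 z `^ (a1 k / 2))%:C * (u2 z `^ (a2 k / 2))%:C.
Let Del k z : R[i] := gam k z * (u1 z `^ a1 k)%:C * (u2 z `^ a2 k)%:C.
Let dlgam v k z := del v (gam k) z / gam k z.
Let L v k z := dlgam v k z + (a1 k)%:C * dlog_sqnorm f1 h1 v z +
   (a2 k)%:C * dlog_sqnorm f2 h2 v z.
Let B (z : V) : 'M[R[i]]_r := 1%:M.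

Let gam_neq0 k z : A z -> gam k z != 0.
Proof. by move=> Az; rewrite gt_eqF // gam_gt0. Qed.

Let u1_gt0 z : S z -> 0 < u1 z.
Proof. by move=> Sz; apply: (sqnorm_gt0 h1_gt0 (SA Sz)); exact: f1_neq0. Qed.

Let u2_gt0 z : S z -> 0 < u2 z.
Proof. by move=> Sz; apply: (sqnorm_gt0 h2_gt0 (SA Sz)); exact: f2_neq0. Qed.

Let half_powR (x y : R) : (x `^ (y / 2))%:C ^+ 2 = (x `^ y)%:C :> R[i].
Proof.
rewrite -rmorphXn; congr (_%:C).
by rewrite -powR_mulrn ?powR_ge0 // -powRrM divfK.
Qed.

Let DelE k z : S z -> Del k z = gam k z * wt k z ^+ 2.
Proof. by move=> Sz; rewrite /Del /wt exprMn !half_powR mulrA. Qed.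

Let powR_neq0C (x y : R) : 0 < x -> (x `^ y)%:C != 0 :> R[i].
Proof. by move=> x0; rewrite eq_complex /= eqxx andbT gt_eqF // powR_gt0. Qed.

Let wt_neq0 k z : S z -> wt k z != 0.
Proof. by move=> Sz; rewrite /wt mulf_neq0 // powR_neq0C // ?u1_gt0 ?u2_gt0. Qed.

Let wt_real k z : S z -> Num.conj (wt k z) = wt k z.
Proof.
have cr (x : R) : Num.conj (x%:C) = x%:C :> R[i] by exact: conjc_real.
by move=> _; rewrite /wt rmorphM /= !cr.
Qed.

Let gam_real k z : S z -> Num.conj (gam k z) = gam k z.
Proof. by move=> Sz; apply: conj_Creal; rewrite ger0_real // ltW // gam_gt0 //; exact: SA. Qed.

Let dlgamC v k : class_Cn 2 A (dlgam v k).
Proof.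
apply: (CnM oA (Cn_del v oA (gamC k))).
by apply: CnV oA (CnW (gamC k)) _ => z; exact: gam_neq0.
Qed.

Let d1 k z (Sz : S z) :=
  derivable_sqnorm_powR oA f1C f1_hol h1C h1_gt0 (a1 k) (SA Sz) (f1_neq0 Sz).
Let d2 k z (Sz : S z) :=
  derivable_sqnorm_powR oA f2C f2_hol h2C h2_gt0 (a2 k) (SA Sz) (f2_neq0 Sz).

Let Del_derivable k z : S z -> derivable_at (Del k) z.
Proof.
move=> Sz; apply: derivable_mul (proj1 (d2 k Sz)).
exact: derivable_mul (Cn_derivable (gamC k) (SA Sz)) (proj1 (d1 k Sz)).
Qed.

Let LE v k z : S z -> del v (Del k) z = L v k z * Del k z.
Proof.
move=> Sz; have Az := SA Sz.
have [e1 e1'] := d1 k Sz; have [e2 e2'] := d2 k Sz.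
have dg := Cn_derivable (gamC k) Az.
rewrite delE /Del (wirtM _ _ (derivable_mul dg e1) e2) (wirtM _ _ dg e1) -!delE.
rewrite (e1' v) (e2' v) -/u1 -/u2; exact: dlog_algebra (gam_neq0 k Az).
Qed.

Let dl1 v z (Sz : S z) :=
  derivable_dlog_sqnorm oA f1C h1C h1_gt0 v (SA Sz) (f1_neq0 Sz).
Let dl2 v z (Sz : S z) :=
  derivable_dlog_sqnorm oA f2C h2C h2_gt0 v (SA Sz) (f2_neq0 Sz).

Let L_derivable v k z : S z -> derivable_at (L v k) z.
Proof.
move=> Sz; apply: derivable_add.
  apply: derivable_add (Cn_derivable (dlgamC v k) (SA Sz)) _.
  exact: derivable_mul (derivable_cst _ _) (dl1 v Sz).
exact: derivable_mul (derivable_cst _ _) (dl2 v Sz).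
Qed.

Let dL_lbd v w k : lbd S p (delbar w (L v k)).
Proof.
apply: (@lbd_eq_on _ _ _ _ _ (fun z => delbar w (dlgam v k) z +
   (a1 k)%:C * delbar w (dlog_sqnorm f1 h1 v) z +
   (a2 k)%:C * delbar w (dlog_sqnorm f2 h2 v) z)).
  move=> z Sz; have dg := Cn_derivable (dlgamC v k) (SA Sz).
  have c1 := derivable_cst (V := V) (a1 k)%:C z.
  have c2 := derivable_cst (V := V) (a2 k)%:C z.
  have m1 := derivable_mul c1 (dl1 v Sz); have m2 := derivable_mul c2 (dl2 v Sz).
  rewrite !delbarE /L (wirtD _ _ (derivable_add dg m1) m2) (wirtD _ _ dg m1).
  rewrite (wirtM _ _ c1 (dl1 v Sz)) (wirtM _ _ c2 (dl2 v Sz)) !wirt_cst.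
  by rewrite !mul0r !add0r.
apply: lbdD; first apply: lbdD.
- by apply: lbd_continuous; exact: Cn_continuous (Cn_delbar w oA (dlgamC v k)) Ap.
- apply: lbdM; first exact: lbd_cst.
  exact: lbd_delbar_dlog oA f1C f1_hol h1C h1_gt0 _ _ Ap SA f1_neq0 _ _.
apply: lbdM; first exact: lbd_cst.
exact: lbd_delbar_dlog oA f2C f2_hol h2C h2_gt0 _ _ Ap SA f2_neq0 _ _.
Qed.

Let dbar0 w z : frame_dbar B w z = 0.
Proof. exact: frame_dbar_cst. Qed.

Let dbar0f w k l : (fun z => frame_dbar B w z k l) = fun=> 0.
Proof. by apply/funext => z; rewrite dbar0 mxE. Qed.

(** The frame is holomorphic, so the curvature is diagonal with entries
[delbar (L v k)]; these extend smoothly because the logarithms of the moduli of the two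
equations are pluriharmonic. *)
Theorem crossing_bound (G : V -> 'M[R[i]]_r) :
  (forall z, S z -> G z =
     diag_mx (\row_k (gam k z * (u1 z `^ a1 k)%:C * (u2 z `^ a2 k)%:C))) ->
  exists K : R, \forall z \near p, S z -> endo_norm (G z)
    (- 'i%C *: \sum_(k < 2) \sum_(l < 2)
       h z l k *: chern_curv (evec k) (evec l) G z) <= K.
Proof.
move=> GE.
apply: (@endo_norm_diag_bound R r S p B Del L gam wt h oS _ _ DelE _ wt_neq0 gam_real
  wt_real Del_derivable LE L_derivable).
- by move=> i j; exact: Cn_cst.
- by move=> z _; exact: unitmx1.
- by move=> k z /SA; exact: gam_neq0.
- by move=> z /SA; exact: h_herm.
- by move=> v w; apply: lbd_continuous; exact: Cn_continuous (hC w v) Ap.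
- by move=> k; apply: lbd_continuous; exact: Cn_continuous (gamC k) Ap.
- move=> k; apply: lbd_continuous.
  exact: Cn_continuous (CnV oA (gamC k) (gam_neq0 k)) Ap.
- exact: dL_lbd.
- move=> w k l; apply: (@lbd_eq_on _ _ _ _ _ (fun=> 0)); last exact: lbd_cst.
  by move=> z Sz; rewrite dbar0 mxE mulr0.
- move=> k l; apply: (@lbd_eq_on _ _ _ _ _ (fun=> 0)); last exact: lbd_cst.
  move=> z Sz; rewrite big1 ?mulr0 // => v _; rewrite big1 // => w _.
  by rewrite dbar0f dbar0 mxE mul0r addr0 delE wirt_cst mulr0.
by move=> z Sz; rewrite GE // /B mul1mx trmx1 map_mx1 mulmx1.
Qed.

End CrossingBound.

(** * Metric duality and flags *)

Section MatrixPairing.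
Variables (F : comUnitRingType).

Lemma pairing_change n (v : 'rV[F]_n) (e es H : 'M[F]_n) (us : 'cV[F]_n) :
  e \in unitmx -> es \in unitmx ->
  (v *m invmx e) *m (e *m H *m es) *m (invmx es *m us) = v *m H *m us.
Proof. by move=> Ue Us; rewrite !mulmxA (mulmxKV Ue) (mulmxK Us). Qed.

Lemma frame_product n (q e es qs H : 'M[F]_n) : e \in unitmx -> es \in unitmx ->
  (q *m invmx e) *m (e *m H *m es) *m (invmx es *m qs) = q *m H *m qs.
Proof. by move=> Ue Us; rewrite !mulmxA (mulmxKV Ue) (mulmxK Us). Qed.

End MatrixPairing.

Section SpanRows.
Context {R : realType} {r : nat}.

(** Coefficients with respect to selected vectors of one frame select vectors of the
same indices in any other frame. *)
Lemma span_rows_coef (T : pred 'I_r) (M : 'M[R[i]]_r) (u : 'rV[R[i]]_r) :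
  (u <= span_rows T M)%MS -> exists C : 'rV[R[i]]_r,
    u = C *m M /\ forall M' : 'M[R[i]]_r, (C *m M' <= span_rows T M')%MS.
Proof.
move=> /sub_sumsmxP [w ->].
apply: (big_ind (fun u : 'rV[R[i]]_r => exists C : 'rV[R[i]]_r,
    u = C *m M /\ forall M' : 'M[R[i]]_r, (C *m M' <= span_rows T M')%MS)).
- by exists 0; split=> [|M']; rewrite mul0mx // sub0mx.
- move=> _ _ [C1 [-> h1]] [C2 [-> h2]]; exists (C1 + C2); rewrite mulmxDl.
  by split=> // M'; rewrite mulmxDl addmx_sub.
move=> k Tk; have : (w k *m <<row k M>> <= row k M)%MS.
  by apply: submx_trans (submxMl _ _) _; rewrite genmxE.
move=> /sub_rVP [a ->]; exists (a *: delta_mx 0 k).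
rewrite -scalemxAl -rowE; split=> // M'.
rewrite -scalemxAl -rowE; apply: scalemx_sub.
by apply: (sumsmx_sup k) => //; rewrite genmxE.
Qed.

End SpanRows.

Section MetricDual.
Context {R : realType}.

Lemma herm_evec (G : 'M[R[i]]_2) (tau : 'rV[R[i]]_2) a :
  herm G tau (evec a) = (tau *m G) 0 a.
Proof.
rewrite /herm [LHS]mxE (bigD1 a) //= big1 => [|j ja].
  rewrite [(_^t*) a 0]mxE [(_^T) a 0]mxE [X in Num.conj X]mxE !eqxx /=.
  by rewrite conjC1 mulr1 addr0.
by rewrite [(_^t*) j 0]mxE [(_^T) j 0]mxE [X in Num.conj X]mxE (negbTE ja) conjC0 mulr0.
Qed.

(** The vector dual to the first coordinate form is the conjugate of any
nonzero vector orthogonal to the second coordinate direction. *)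
Lemma metric_dual (G : 'M[R[i]]_2) (tau : 'rV[R[i]]_2) : posdef G ->
  herm G tau (evec 1) = 0 -> tau != 0 -> tau 0 0 != 0 /\
  exists s, forall w, invmx G w 0 = s * Num.conj (tau 0 w).
Proof.
move=> pG; have [hG pos] := pG; rewrite herm_evec => h1 t0.
have U := posdef_unit pG.
set s0 := (tau *m G) 0 0.
have e : tau *m G = s0 *: evec 0.
  apply/rowP => a; rewrite [in RHS]mxE [in RHS]mxE /=.
  have [->|->] : a = 0 \/ a = 1.
    by case: a => [[|[|//]] ?]; [left | right]; exact: val_inj.
  - by rewrite mulr1.
  - by rewrite h1 mulr0.
have e' : tau = s0 *: row 0 (invmx G).
  by rewrite rowE scalemxAl -e mulmxK.
have s00 : s0 != 0 by apply: contraNneq t0 => z; rewrite e' z scale0r.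
split.
  have := pos _ t0; rewrite /herm e -scalemxAl -rowE mxE => h.
  apply: contraTneq h => z; rewrite !mxE z conjC0 mulr0.
  by rewrite ltxx.
exists (Num.conj s0)^-1 => w.
have hI : (invmx G)^t* = invmx G by rewrite adjmx_inv hG.
have c0 : Num.conj s0 != 0 by rewrite conjC_eq0.
have -> : tau 0 w = s0 * invmx G 0 w by rewrite {1}e' mxE mxE.
rewrite rmorphM /= mulKf //.
have -> : invmx G w 0 = (invmx G)^t* w 0 by rewrite hI.
by rewrite mxE [X in Num.conj X]mxE.
Qed.

End MetricDual.

Section FlagFacts.
Context {R : realType} {X : surface R} {m r : nat} {D : 'I_m -> set X}
  {E : hol_bundle X r} {g : hermitian_metric X} {P : parabolic D E}.
Variables (K : Hpar_data g P) (i : 'I_m).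

Lemma unit_disc0 : unit_disc (0 : R[i]).
Proof. by rewrite /unit_disc /= normr0. Qed.

Lemma unit_disc_open : open (@unit_disc R).
Proof.
rewrite openE => z; rewrite /unit_disc /= => hz.
apply/nbhs_ballP; exists (1 - `|z|) => /=; first by rewrite subr_gt0.
move=> y; rewrite /ball /= => h.
rewrite -[y](subrK z) addrC; apply: le_lt_trans (ler_normD _ _) _.
by rewrite -ltrBDl distrC.
Qed.

Lemma disc_center x : D i x -> disc K i x 0 = x.
Proof. exact: tube_center (nb_tube K i) x. Qed.

Lemma divisor_nb x : D i x -> nb K i x.
Proof.
move=> Dx; rewrite (tube_leaves (nb_tube K i)); exists x => //; exists 0.
  exact: unit_disc0.
exact: disc_center.
Qed.

Lemma flag_mono s s' x : D i x -> (s <= s' <= plen P i)%N ->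
  (flag P i s' x <= flag P i s x)%MS.
Proof.
move=> Dx /andP[/subnK <-]; elim: (s' - s)%N => [//|n IH] h.
rewrite addSn in h *; apply: submx_trans (IH (ltnW h)).
by apply: ltmxW; exact: flag_proper.
Qed.

(** Transported from the flag on the divisor by parallel sections. *)
Lemma flagx_mono s s' x z : D i x -> unit_disc z -> (s <= s' <= plen P i)%N ->
  (flagx K i s' (disc K i x z) <= flagx K i s (disc K i x z))%MS.
Proof.
move=> Dx Uz hs; have /andP[ss' s'p] := hs; apply/row_subP => k.
have := row_sub k (flagx K i s' (disc K i x z)).
move=> /(flagx_transport K s'p Dx Uz) [v [h1 h2 h3]].
apply/(flagx_transport K (leq_trans ss' s'p) Dx Uz).
by exists v; split=> //; exact: submx_trans h2 (flag_mono Dx hs).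
Qed.

Lemma flagx_sub_flag s x : D i x -> (s <= plen P i)%N ->
  (flagx K i s x <= flag P i s x)%MS.
Proof.
move=> Dx hs; apply/row_subP => k; set u := row k _.
have : (u <= flagx K i s (disc K i x 0))%MS by rewrite disc_center // row_sub.
by move=> /(flagx_transport K hs Dx unit_disc0) [v [_ h <-]].
Qed.

(** A frame of vectors lying in the extended flag provides enough parallel
sections to recover the flag itself on the divisor. *)
Lemma flag_sub_flagx s x (q : 'M[R[i]]_r) : D i x -> (s <= plen P i)%N ->
  q \in unitmx -> (q <= flagx K i 0 x)%MS -> (flag P i s x <= flagx K i s x)%MS.
Proof.
move=> Dx hs Uq hq; apply/row_subP => k; set u := row k _.
have uF : (u <= flag P i s x)%MS by exact: row_sub.
have u0 : (u <= flagx K i 0 x)%MS.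
  by apply: submx_trans hq; rewrite -[u](mulmxKV Uq) submxMl.
have : (u <= flagx K i 0 (disc K i x 0))%MS by rewrite disc_center.
move=> /(flagx_transport K (leq0n _) Dx unit_disc0) [v [h1 h2 h3]].
suff : (u <= flagx K i s (disc K i x 0))%MS by rewrite disc_center.
apply/(flagx_transport K hs Dx unit_disc0).
by exists v; split => //; rewrite h3.
Qed.

Lemma Q_orth s s' x (u w : 'rV[R[i]]_r) y z : D i y -> unit_disc z -> x = disc K i y z ->
  posdef (H1 K x) -> (s < s' <= plen P i)%N ->
  (u <= Q K i s x)%MS -> (w <= flagx K i s' x)%MS ->
  w *m H1 K x *m u^t* = 0.
Proof.
move=> Dy Uz -> [hH _] ss' hu hw.
have {}hw : (w <= flagx K i s.+1 (disc K i y z))%MS.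
  exact: submx_trans hw (flagx_mono Dy Uz ss').
have hk : (u <= kermx (H1 K (disc K i y z) *m (flagx K i s.+1 (disc K i y z))^t*))%MS.
  by apply: submx_trans hu _; exact: capmxSr.
have [C ->] := submxP hw.
have e0 : u *m H1 K (disc K i y z) *m (flagx K i s.+1 (disc K i y z))^t* = 0.
  by rewrite -mulmxA; exact/sub_kermxP.
have e1 : flagx K i s.+1 (disc K i y z) *m H1 K (disc K i y z) *m u^t* = 0.
  have := congr1 (fun M : 'M[R[i]]_(1, r) => M^t*) e0.
  by rewrite !adjmxM adjmxK hH trmx0 map_mx0 mulmxA.
by rewrite -!mulmxA [X in C *m X]mulmxA e1 mulmx0.
Qed.

Lemma Q_sub_flagx s x (u : 'rV[R[i]]_r) : (u <= Q K i s x)%MS -> (u <= flagx K i s x)%MS.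
Proof. by move=> h; apply: submx_trans h _; exact: capmxSl. Qed.

End FlagFacts.

(** * The (0,1)-part of the connection in an adapted frame *)

Lemma second_coefficient (R : realType) (x0 x1 a b : R[i]) :
  Num.conj x0 * a + Num.conj x1 * b = 0 -> x0 = 0 -> x1 = 1 -> b = 0.
Proof.
by move=> h e0 e1; move: h; rewrite e0 e1 conjC0 conjC1 mul0r add0r mul1r.
Qed.

Lemma first_coefficient (R : realType) (x0 x1 a b : R[i]) :
  Num.conj x0 * a + Num.conj x1 * b = 0 -> b = 0 -> x0 != 0 -> a = 0.
Proof.
move=> h b0 n0; move: h; rewrite b0 mulr0 addr0 => /eqP.
by rewrite mulf_eq0 conjC_eq0 (negbTE n0) => /eqP.
Qed.

Section AdaptedFrame.
Context {R : realType} {X : surface R} {m r : nat} {D : 'I_m -> set X}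
  {E : hol_bundle X r} {g : hermitian_metric X} {P : parabolic D E}.
Variables (K : Hpar_data g P) (i : 'I_m).
Variables (W : set X) (q : X -> 'M[R[i]]_r) (t : 'I_r -> nat).
Hypotheses (oW : open W) (WN : W `<=` nb K i `\` Dother (D := D) i)
  (hq : smooth_frame E W q) (tlt : forall k, (t k < plen P i)%N)
  (gramq : forall y, W y -> gram q (H1 K) y = 1%:M)
  (Qrow : forall y, W y -> forall k, (row k (q y) <= Q K i (t k) y)%MS).
Variables (c : chart R X) (We : set X) (e : X -> 'M[R[i]]_r).
Hypotheses (ac : atlas c) (cline : is_coord_line c (D i) 0) (he : hframe E We e).

Definition adapted_nbhd : set X := W `&` (cdom c `&` We).
Local Notation N := adapted_nbhd.
Local Notation A := (cimg c N).

Lemma adapted_open : open N.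
Proof.
apply: openI => //; apply: openI; last exact: hframe_open he.
by have [[]] := atlas_chart ac.
Qed.

Lemma adapted_img_open : open A.
Proof. exact: cimg_open ac adapted_open. Qed.

Definition frame_coord (z : 'rV[R[i]]_2) := q (cinv c z) *m invmx (e (cinv c z)).
Definition gram_coord (z : 'rV[R[i]]_2) := gram e (H1 K) (cinv c z).
Local Notation Am := frame_coord.
Local Notation Gm := gram_coord.
(** The inverse of [frame_coord], because the frame [q] is orthonormal for the
auxiliary metric. *)
Definition change_coord (z : 'rV[R[i]]_2) := Gm z *m (Am z)^t*.
Local Notation B := change_coord.

Lemma frame_coord_Cn n : class_Cn_mx n A Am.
Proof.
move=> k l; have [_ /(_ k) h] := hq; have := h We e he 0 l c ac.
move=> /(@smooth_Cn _ _ n) hC.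
have hs : A `<=` cimg c (W `&` We).
  by move=> _ [x [cx [Wx [_ Wex]]] <-]; exact: cimg_mem.
apply: Cn_eq adapted_img_open _ (Cn_sub hs hC) => z _ /=.
by rewrite /frame_coord -row_mul mxE.
Qed.

Lemma nb_adapted x : W x -> nb K i x.
Proof. by move=> /WN []. Qed.

Lemma H1_posdef x : W x -> posdef (H1 K x).
Proof. by move=> Wx; have [h _] := H1_metric K; apply: h; exists i => //; exact: nb_adapted. Qed.

Lemma gram_coord_Cn n : class_Cn_mx n A Gm.
Proof.
have [_ h] := H1_metric K; move=> k l; have := h We e he k l c ac.
move=> /(@smooth_Cn _ _ n); apply: Cn_sub => _ [x [cx [Wx [_ Wex]]] <-].
apply: cimg_mem => //; split=> //; exists i => //; exact: nb_adapted.
Qed.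

Lemma gram_H1_herm x : W x -> (gram e (H1 K) x)^t* = gram e (H1 K) x.
Proof.
by move=> /H1_posdef [h _]; rewrite /gram !adjmxM adjmxK h mulmxA.
Qed.

Lemma gram_H1_unit x : N x -> gram e (H1 K) x \in unitmx.
Proof.
move=> [Wx [_ Wex]]; have U := hframe_unit he Wex.
by rewrite /gram !unitmx_mul adjmx_unit U posdef_unit //; exact: H1_posdef.
Qed.

Lemma frame_orthonormal x : N x ->
  (q x *m invmx (e x)) *m gram e (H1 K) x *m (q x *m invmx (e x))^t* = 1%:M.
Proof.
move=> [Wx [_ Wex]]; have U := hframe_unit he Wex.
have Us : (e x)^t* \in unitmx by rewrite adjmx_unit.
by rewrite adjmxM adjmx_inv /gram (frame_product _ _ _ U Us); exact: gramq.
Qed.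

Lemma change_coordV z : A z -> Am z *m B z = 1%:M.
Proof. by move=> /(cimgP ac) [_ Nz _]; rewrite /B mulmxA; exact: frame_orthonormal. Qed.

Lemma change_coord_unit z : A z -> B z \in unitmx.
Proof. by move=> /change_coordV /mulmx1_unit []. Qed.

Lemma change_coord_Cn n : class_Cn_mx n A B.
Proof.
exact: Cn_mxM adapted_img_open (gram_coord_Cn n) (Cn_mxJ adapted_img_open (frame_coord_Cn n)).
Qed.

Lemma change_frame_dbar w z : A z ->
  frame_dbar B w z = - (delbar_mx w Am z *m Gm z *m (Am z)^t*).
Proof.
move=> Az; have nA : \forall y \near z, A y by exact: (open_nbhs_nbhs (conj adapted_img_open Az)).
have dA := Cn_mx_derivable (frame_coord_Cn 1) Az.
have dB := Cn_mx_derivable (change_coord_Cn 1) Az.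
rewrite frame_dbarE (_ : invmx (B z) = Am z); last first.
  by apply: invmx_eq; apply: mulmx1C; exact: change_coordV.
have := wirt_mx_cst 'i%C w (1%:M : 'M[R[i]]_r) z.
rewrite -(@wirt_mx_near _ _ _ _ 'i%C w (fun y => Am y *m B y)); last 2 first.
- by apply: filterS nA => y /change_coordV.
- exact: derivable_mxM.
rewrite (wirt_mxM _ _ dA dB) -!delbar_mxE => /eqP.
by rewrite addrC addr_eq0 => /eqP ->; rewrite mulmxA.
Qed.

Section Curve.
Variables (b : R[i] -> X) (zeta : R[i]).
Hypotheses (nN : \forall x \near zeta, N (b x)).
Let beta x := cmap c (b x).
Hypotheses (dbeta : forall a, derivable_at (fun x => beta x 0 a) zeta)
  (hbeta : forall a v, delbar v (fun x => beta x 0 a) zeta = 0).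
Let Qb x := q (b x) *m invmx (e (b x)).
Let Gb x := gram e (H1 K) (b x).

Let Nz : N (b zeta). Proof. exact: nbhs_singleton nN. Qed.
Let Abz : A (beta zeta). Proof. by have [_ [cz _]] := Nz; exact: cimg_mem. Qed.

Let QbE : \forall x \near zeta, Am (beta x) = Qb x.
Proof.
apply: filterS nN => x [_ [cx _]]; rewrite /frame_coord /beta.
by rewrite (cmapK ac cx).
Qed.

Let GbE : \forall x \near zeta, Gm (beta x) = Gb x.
Proof.
apply: filterS nN => x [_ [cx _]]; rewrite /gram_coord /beta.
by rewrite (cmapK ac cx).
Qed.

Let dcomp (F : 'rV[R[i]]_2 -> 'M[R[i]]_r) : class_Cn_mx 1 A F ->
  derivable_mx (fun x => F (beta x)) zeta.
Proof.
move=> hF k l; apply: (@derivable_comp R R[i] (fun z => F z k l) beta zeta) => //.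
exact: Cn_C1_at adapted_img_open (hF k l) Abz.
Qed.

Lemma curve_frame_derivable : derivable_mx Qb zeta.
Proof. exact: derivable_mx_near QbE (dcomp (frame_coord_Cn 1)). Qed.

Lemma curve_gram_derivable : derivable_mx Gb zeta.
Proof. exact: derivable_mx_near GbE (dcomp (gram_coord_Cn 1)). Qed.

(** Derivatives of the frame along a holomorphic curve see the combination of the
components of [frame_dbar] given by the velocity of the curve. *)
Lemma curve_frame_dbar k l :
  \sum_w Num.conj (del (1 : R[i]) (fun x => beta x 0 w) zeta) *
     frame_dbar B (evec w) (beta zeta) k l =
  - (delbar_mx (1 : R[i]) Qb zeta *m Gb zeta *m (Qb zeta)^t*) k l.
Proof.
have e1 : delbar_mx (1 : R[i]) Qb zeta = \sum_w Num.conj (del (1 : R[i]) (fun x => beta x 0 w) zeta) *: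
    delbar_mx (evec w) Am (beta zeta).
  rewrite delbar_mxE -(wirt_mx_near _ _ QbE (dcomp (frame_coord_Cn 1))) -delbar_mxE.
  apply/matrixP => a b'; rewrite summxE mxE.
  rewrite (@delbar_comp R R[i] (fun z => Am z a b') beta zeta) //; last first.
    exact: Cn_C1_at adapted_img_open (frame_coord_Cn 1 a b') Abz.
  by apply: eq_bigr => w _; rewrite mxE [in RHS]mxE; exact: mulrC.
rewrite -(nbhs_singleton QbE) -(nbhs_singleton GbE) e1 !mulmx_suml summxE -sumrN.
apply: eq_bigr => w _; rewrite change_frame_dbar // -!scalemxAl [in RHS]mxE [in LHS]mxE.
exact: mulrN.
Qed.

Variables (v : R[i] -> 'rV[R[i]]_r) (k l : 'I_r).
Let rho x := v x *m invmx (e (b x)).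
Hypotheses (drho : derivable_mx rho zeta)
  (vz : v zeta = row k (q (b zeta)))
  (orth : \forall x \near zeta, v x *m H1 K (b x) *m (row l (q (b x)))^t* = 0).

Let rhoz : rho zeta = row k (Qb zeta).
Proof. by rewrite /rho vz row_mul. Qed.

Let orth' : \forall x \near zeta, rho x *m Gb x *m (row l (Qb x))^t* = 0.
Proof.
apply: filterS2 nN orth => x [_ [_ Wex]] o.
have U := hframe_unit he Wex.
have Us : (e (b x))^t* \in unitmx by rewrite adjmx_unit.
by rewrite /rho /Gb /Qb row_mul adjmxM adjmx_inv /gram (pairing_change _ _ _ U Us).
Qed.

Let orthonormal' : \forall x \near zeta, Qb x *m Gb x *m (Qb x)^t* = 1%:M.
Proof. by apply: filterS nN => x; exact: frame_orthonormal. Qed.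

Lemma curve_holomorphic : k != l -> delbar_mx (1 : R[i]) rho zeta = 0 ->
  \sum_w Num.conj (del (1 : R[i]) (fun x => beta x 0 w) zeta) *
     frame_dbar B (evec w) (beta zeta) k l = 0.
Proof.
move=> kl h0; rewrite curve_frame_dbar.
by rewrite (delbar_frame_holomorphic curve_frame_derivable curve_gram_derivable
  drho orthonormal' orth' rhoz kl h0) oppr0.
Qed.

Lemma curve_parallel :
  del_mx (1 : R[i]) rho zeta + rho zeta *m chern_conn (1 : R[i]) Gb zeta = 0 ->
  \sum_w Num.conj (del (1 : R[i]) (fun x => beta x 0 w) zeta) *
     frame_dbar B (evec w) (beta zeta) l k = 0.
Proof.
move=> hp; rewrite curve_frame_dbar.
have [Wz _] := Nz.
by rewrite (delbar_frame_parallel curve_frame_derivable curve_gram_derivable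
  drho orth' rhoz (gram_H1_unit Nz) (gram_H1_herm Wz) hp) oppr0.
Qed.

End Curve.

Section Leaf.
Variable y : X.
Hypothesis Dy : D i y.
Local Notation b := (disc K i y).
Let beta x := cmap c (b x).
Local Notation tau w x := (del (1 : R[i]) (fun x0 : R[i] => beta x0 0 w) x).

Lemma leaf_near x : unit_disc x -> N (b x) ->
  \forall x' \near x, unit_disc x' /\ N (b x').
Proof.
move=> Ux Nx; have [hc _ _] := tube_disc (nb_tube K i) Dy.
have n1 : \forall x' \near x, unit_disc x'.
  by exact: (open_nbhs_nbhs (conj (@unit_disc_open R) Ux)).
have n2 : \forall x' \near x, N (b x').
  by apply: (hc x Ux); exact: (open_nbhs_nbhs (conj adapted_open Nx)).
exact: filterS2 n1 n2.
Qed.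

Lemma leaf_holo : holo_mx_on (unit_disc `&` (b @^-1` cdom c)) beta.
Proof. by have [_ _ /(_ c ac) []] := tube_disc (nb_tube K i) Dy. Qed.

Lemma leaf_dom_open : open (unit_disc `&` (b @^-1` N)).
Proof.
rewrite openE => x [Ux Nx]; exact: leaf_near.
Qed.

Lemma leaf_Cn n a : class_Cn n (unit_disc `&` (b @^-1` N)) (fun x => beta x 0 a).
Proof.
by apply: Cn_sub (holo_Cn n (leaf_holo 0 a)) => x [Ux [_ [cx _]]].
Qed.

Lemma leaf_derivable x a : unit_disc x -> N (b x) -> derivable_at (fun x => beta x 0 a) x.
Proof. by move=> Ux Nx; exact: Cn_derivable (leaf_Cn 1 a) (conj Ux Nx). Qed.

Lemma leaf_delbar x a v : unit_disc x -> N (b x) -> delbar v (fun x => beta x 0 a) x = 0.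
Proof.
by move=> Ux [_ [cx _]]; have [_ ->] := leaf_holo 0 a.
Qed.

(** Along a leaf the summands [Q_s] are parallel for the flat metric, so the
(0,1)-part of the connection does not mix them in the leaf direction. *)
Lemma leaf_normal k l x : (t l < t k)%N -> unit_disc x -> N (b x) ->
  \sum_w Num.conj (tau w x) * frame_dbar B (evec w) (beta x) k l = 0 /\
  \sum_w Num.conj (tau w x) * frame_dbar B (evec w) (beta x) l k = 0.
Proof.
move=> lk Ux Nx; have tk := tlt k.
have nx := leaf_near Ux Nx.
have nN : \forall x' \near x, N (b x') by apply: filterS nx => x' [].
have [Wx [cx Wex]] := Nx.
have := Q_sub_flagx (Qrow Wx k).
move=> /(flagx_transport K (ltnW tk) Dy Ux) [v [par v0 vx]].
have [hs hp] := par We e he.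
have oU : open (unit_disc `&` (b @^-1` We)).
  rewrite openE => x' [Ux' Wx']; have [hc _ _] := tube_disc (nb_tube K i) Dy.
  apply: filterI; first exact: (open_nbhs_nbhs (conj (@unit_disc_open R) Ux')).
  by apply: (hc x' Ux'); exact: (open_nbhs_nbhs (conj (hframe_open he) Wx')).
have drho := Cn_mx_derivable (smooth_Cn_mx 1 hs) (conj Ux Wex).
have [hp1 hp2] := hp x Ux Wex.
have orth : \forall x' \near x, v x' *m H1 K (b x') *m (row l (q (b x')))^t* = 0.
  apply: filterS nx => x' [Ux' [Wx' _]].
  apply: (@Q_orth _ _ _ _ _ _ _ _ K i (t l) (t k) _ _ _ y x') => //.
  - exact: H1_posdef.
  - by rewrite lk ltnW.
  - exact: Qrow.
  by apply/(flagx_transport K (ltnW tk) Dy Ux'); exists v.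
have db a : derivable_at (fun x => cmap c (b x) 0 a) x by exact: leaf_derivable.
have hb a w : delbar w (fun x => cmap c (b x) 0 a) x = 0 by exact: leaf_delbar.
split; last exact: (curve_parallel nN db hb drho vx orth hp1).
apply: (curve_holomorphic nN db hb drho vx orth) => //.
by apply: contraTneq lk => ->; rewrite ltnn.
Qed.

Lemma leaf_center : b 0 = y. Proof. exact: disc_center. Qed.

Lemma leaf_tangent : N y ->
  (tau 0 0 != 0) /\ exists s, forall w, invmx (gmat g c y) w 0 = s * Num.conj (tau w 0).
Proof.
move=> [Wy [hcy Wey]].
have th := tube_orth (nb_tube K i) Dy ac hcy cline.
have [_ _ /(_ c ac) [_ /(_ 0 (@unit_disc0 R))]] := tube_disc (nb_tube K i) Dy.
rewrite leaf_center => /(_ hcy) t0.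
have [h1 [s h2]] := metric_dual (gmat_posdef g ac hcy) th t0.
by split; [move: h1; rewrite mxE | exists s => w; rewrite h2 mxE].
Qed.

End Leaf.

Section Line.
Variable y : X.
Hypotheses (Dy : D i y) (Ny : N y).
Let y0 := cmap c y.
Let b (x : R[i]) := cinv c (y0 + x *: evec 1).
Let beta x := cmap c (b x).

Let cont0 : (fun x : R[i] => y0 + x *: evec 1 : 'rV[R[i]]_2) @ (0 : R[i]) --> y0.
Proof.
have idc : (fun x : R[i] => x) @ (0 : R[i]) --> (0 : R[i]) by [].
have FF : Filter (nbhs (0 : R[i])) := nbhs_filter _.
have e1 := cvgZ idc (cvg_cst (evec 1 : 'rV[R[i]]_2)).
have := cvgD (cvg_cst y0) (e1 FF FF).
by rewrite scale0r addr0; apply.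
Qed.

Let b0 : b 0 = y.
Proof. by have [_ [hcy _]] := Ny; rewrite /b scale0r addr0 cmapK. Qed.

Let near_A (O : set X) : open O -> O y ->
  \forall x \near (0 : R[i]), cimg c (N `&` O) (y0 + x *: evec 1).
Proof.
move=> oO Oy; apply: cont0; apply: (open_nbhs_nbhs (conj _ _)).
  by apply: cimg_open ac _; apply: openI adapted_open oO.
by have [_ [hcy _]] := Ny; exact: cimg_mem.
Qed.

Let betaE a : \forall x \near (0 : R[i]), y0 0 a + x * (evec 1 : 'rV[R[i]]_2) 0 a = beta x 0 a.
Proof.
apply: filterS (near_A openT I) => x /(cimgP ac) [_ _ h].
by rewrite /beta /b h [RHS]mxE; congr (_ + _); rewrite [RHS]mxE.
Qed.

Let dbeta a : derivable_at (fun x => beta x 0 a) 0.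
Proof.
apply: derivable_at_near (betaE a) _.
by have [] := wirt_affine 0 (y0 0 a) ((evec 1 : 'rV[R[i]]_2) 0 a) 0 0.
Qed.

Let wirt_beta s a v : wirt s v (fun x => beta x 0 a) 0 =
  (1 + s * 'i%C) / 2 * (v * (evec 1 : 'rV[R[i]]_2) 0 a).
Proof.
have [h1 <-] := wirt_affine s (y0 0 a) ((evec 1 : 'rV[R[i]]_2) 0 a) 0 v.
by apply/esym/wirt_near => //; exact: betaE.
Qed.

Let i2 : 'i%C * 'i%C = -1 :> R[i].
Proof. by rewrite -expr2 sqr_i. Qed.

Let hbeta a v : delbar v (fun x => beta x 0 a) 0 = 0.
Proof. by rewrite delbarE wirt_beta i2 subrr mul0r mul0r. Qed.

Let del_beta a : del (1 : R[i]) (fun x => beta x 0 a) 0 = (a == 1)%:R.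
Proof.
rewrite delE wirt_beta mulNr i2 opprK mul1r mxE eqxx /= [X in X * _](_ : _ = 1) ?mul1r //.
by rewrite divff // pnatr_eq0.
Qed.

(** On the divisor the flag is holomorphic, hence the (0,1)-part of the
connection preserves it in the direction of the divisor. *)
Lemma line_frame_dbar k l : (t l < t k)%N -> frame_dbar B (evec 1) y0 k l = 0.
Proof.
move=> lk; have tk := tlt k; have [Wy [hcy Wey]] := Ny.
have [d /(_ y Dy) [W' [e' [he' W'y flagE]]]] := flag_hol tk.
have fq y' : D i y' -> W y' -> (flag P i (t k) y' <= flagx K i (t k) y')%MS.
  move=> Dy' Wy'; apply: (flag_sub_flagx Dy' (ltnW tk) (q := q y')).
    by have [+ _] := hq; apply.
  apply/row_subP => j; apply: submx_trans (Q_sub_flagx (Qrow Wy' j)) _.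
  rewrite -(disc_center K Dy').
  by apply: flagx_mono Dy' (@unit_disc0 R) _; rewrite leq0n ltnW.
have uF : (row k (q y) <= span_rows (fun j : 'I_r => (j < d)%N) (e' y))%MS.
  have /eqmxP <- := flagE y Dy W'y.
  apply: submx_trans (Q_sub_flagx (Qrow Wy k)) _.
  exact: flagx_sub_flag Dy (ltnW tk).
have [C [uE hC]] := span_rows_coef uF.
pose v x := C *m e' (b x).
have nN' := near_A (hframe_open he') W'y.
have nN : \forall x \near (0 : R[i]), N (b x).
  by apply: filterS nN' => x /(cimgP ac) [_ [h _] _].
have Dline z : A z -> z 0 0 = 0 -> D i (cinv c z).
  by move=> /(cimgP ac) [cz _ ez] z0; apply/(cline cz); rewrite ez.
have y00 : y0 0 0 = 0 by apply/(cline hcy).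
have orth : \forall x \near (0 : R[i]), v x *m H1 K (b x) *m (row l (q (b x)))^t* = 0.
  apply: filterS nN' => x /(cimgP ac) [cx [Nx W'x] ex].
  have [Wx _] := Nx.
  have Dx : D i (b x).
    apply/(cline cx); rewrite ex mxE y00 add0r !mxE.
    exact: mulr0.
  apply: (@Q_orth _ _ _ _ _ _ _ _ K i (t l) (t k) _ _ _ (b x) 0) => //.
  - exact: unit_disc0.
  - by rewrite disc_center.
  - exact: H1_posdef.
  - by rewrite lk ltnW.
  - exact: Qrow.
  apply: submx_trans (fq _ Dx Wx).
  by have /eqmxP -> := flagE _ Dx W'x; exact: hC.
pose h z := e' (cinv c z) *m invmx (e (cinv c z)).
pose A' := cimg c (N `&` W').
have oA' : open A' by apply: cimg_open ac _; exact: openI adapted_open (hframe_open he').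
have hh : holo_mx_on A' h.
  move=> a a'; have [h1 h2] := hframe_compat he he' a a' ac.
  have sA z : A' z -> cimg c (We `&` W') z.
    by move=> [x [cx [[_ [_ Wx]] W'x]] <-]; exact: cimg_mem.
  by split=> [s z /sA|z /sA]; [exact: h1 | exact: h2].
have A'y : A' (beta 0).
  by rewrite /beta b0; exact: cimg_mem.
have hC1 a a' : C1_at (fun z => h z a a') (beta 0).
  exact: Cn_C1_at oA' (holo_Cn 1 (hh a a')) A'y.
have dh : derivable_mx (fun x => h (beta x)) 0.
  by move=> a a'; apply: (@derivable_comp R R[i] (fun z => h z a a') beta 0).
have dh0 : delbar_mx (1 : R[i]) (fun x => h (beta x)) 0 = 0.
  apply/matrixP => a a'; rewrite mxE [RHS]mxE.
  rewrite (@delbar_comp R R[i] (fun z => h z a a') beta 0) //.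
  rewrite big1 // => w _; have [_ ->] := hh a a'; last exact: A'y.
  exact: mul0r.
have rhoE : \forall x \near (0 : R[i]), C *m h (beta x) = v x *m invmx (e (b x)).
  apply: filterS nN => x [_ [cx _]].
  by rewrite /h /beta (cmapK ac cx) /v mulmxA.
have dC : derivable_mx (fun _ : R[i] => C) 0 := derivable_mx_cst C 0.
have dCh := derivable_mxM dC dh.
have drho : derivable_mx (fun x => v x *m invmx (e (b x))) 0.
  exact: derivable_mx_near rhoE dCh.
have rho0 : delbar_mx (1 : R[i]) (fun x => v x *m invmx (e (b x))) 0 = 0.
  rewrite delbar_mxE -(wirt_mx_near _ _ rhoE dCh) (wirt_mxM _ _ dC dh).
  by rewrite wirt_mx_cst mul0mx add0r -delbar_mxE dh0 mulmx0.
have v0 : v 0 = row k (q (b 0)) by rewrite /v b0 uE.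
have kl : k != l by apply: contraTneq lk => ->; rewrite ltnn.
have H := curve_holomorphic nN dbeta hbeta drho v0 orth kl rho0.
rewrite sum_I2 in H.
have := second_coefficient H (del_beta 0) (del_beta 1).
by rewrite b0.
Qed.

End Line.

Let img_point z : A z -> z 0 0 = 0 -> [/\ D i (cinv c z), N (cinv c z) &
  cmap c (disc K i (cinv c z) 0) = z].
Proof.
move=> Az z0; have [cz Nz ez] := cimgP ac Az.
have Dz : D i (cinv c z) by apply/(cline cz); rewrite ez.
by split => //; rewrite leaf_center.
Qed.

(** The leaf is transverse to the divisor, so the leaf direction and the direction of
the divisor together determine all components. *)
Lemma frame_dbar_line k l (w : 'I_2) z : A z -> z 0 0 = 0 -> (t l < t k)%N ->
  frame_dbar B (evec w) z k l = 0.
Proof.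
move=> Az z0 lk; have [Dy Ny ez] := img_point Az z0.
have [t0 _] := leaf_tangent Dy Ny.
have Ny' : N (disc K i (cinv c z) 0) by rewrite leaf_center.
have [h _] := leaf_normal Dy lk (@unit_disc0 R) Ny'.
have h1 := line_frame_dbar Dy Ny lk.
have [_ _ ez'] := cimgP ac Az; rewrite ez' in h1.
rewrite ez sum_I2 in h.
have h0 := first_coefficient h h1 t0.
have [->|->] : w = 0 \/ w = 1; last by [].
  by case: w => [[|[|//]] ?]; [left | right]; exact: val_inj.
exact: h0.
Qed.

(** As the leaf is orthogonal to the divisor, contraction with the inverse metric in the
slot of [dz_0] picks out the direction of the leaf. *)
Lemma frame_dbar_normal k l z : A z -> z 0 0 = 0 -> t k <> t l ->
  \sum_w invmx (gmat g c (cinv c z)) w 0 * frame_dbar B (evec w) z k l = 0.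
Proof.
move=> Az z0 kl; have [Dy Ny ez] := img_point Az z0.
have [_ [s hs]] := leaf_tangent Dy Ny.
have Ny' : N (disc K i (cinv c z) 0) by rewrite leaf_center.
have h : \sum_w Num.conj (del (1 : R[i]) (fun x : R[i] =>
    cmap c (disc K i (cinv c z) x) 0 w) 0) * frame_dbar B (evec w) z k l = 0.
  have [lk|lk|//] := ltngtP (t k) (t l).
    by have [_] := leaf_normal Dy lk (@unit_disc0 R) Ny'; rewrite ez.
  by have [+ _] := leaf_normal Dy lk (@unit_disc0 R) Ny'; rewrite ez.
apply: (etrans _ (etrans (congr1 (fun x => s * x) h) (mulr0 s))) => /=.
by rewrite mulr_sumr; apply: eq_bigr => w _; rewrite hs mulrA.
Qed.

(** Differentiating the vanishing along the leaves at the divisor, where all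
coefficients vanish, leaves the normal derivative of the normal coefficient. *)
Lemma wirt_frame_dbar_normal k l s z : s = 'i%C \/ s = - 'i%C -> A z -> z 0 0 = 0 ->
  (t l < t k)%N ->
  \sum_w invmx (gmat g c (cinv c z)) w 0 *
    wirt s (evec 0) (fun x => frame_dbar B (evec w) x k l) z = 0.
Proof.
move=> hs Az z0 lk; have [Dy Ny ez] := img_point Az z0.
have [t0 [s1 hs1]] := leaf_tangent Dy Ny.
set y := cinv c z in Dy Ny ez t0 hs1 *.
have Ny' : N (disc K i y 0) by rewrite leaf_center.
pose beta x := cmap c (disc K i y x).
pose tau w x := del (1 : R[i]) (fun x : R[i] => beta x 0 w) x.
pose bb w x := frame_dbar B (evec w) x k l.
have U0 := @unit_disc0 R.
have bC w : class_Cn 1 A (bb w).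
  exact: Cn_frame_dbar (evec w) adapted_img_open (change_coord_Cn 2) change_coord_unit k l.
have dbeta a : derivable_at (fun x => beta x 0 a) 0 by exact: leaf_derivable.
have hbeta a v : delbar v (fun x => beta x 0 a) 0 = 0 by exact: leaf_delbar.
have dtau w : derivable_at (tau w) 0.
  exact: Cn_derivable (Cn_del (1 : R[i]) (leaf_dom_open Dy) (leaf_Cn Dy 2 w)) (conj U0 Ny').
have bC1 w : C1_at (bb w) (beta 0).
  by rewrite [beta 0]ez; exact: Cn_C1_at adapted_img_open (bC w) Az.
have dbb w : derivable_at (bb w \o beta) 0 by exact: derivable_comp.
have dprod w := derivable_mul (derivable_conj (dtau w)) (dbb w).
have zero : \forall x \near (0 : R[i]), 0 = \sum_w Num.conj (tau w x) * (bb w \o beta) x.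
  apply: filterS (leaf_near Dy U0 Ny') => x [Ux Nx].
  by have [h _] := leaf_normal Dy lk Ux Nx; rewrite -[LHS]h.
have line w x : A x -> x 0 0 = 0 -> bb w x = 0 by move=> Ax x0; exact: frame_dbar_line.
have bt s' w : wirt s' (evec 1) (bb w) z = 0.
  refine (wirt_tangent adapted_img_open _ (bC w) (line w) Az z0).
have e0 : \sum_w Num.conj (tau w 0) * wirt s (1 : R[i]) (bb w \o beta) 0 = 0.
  have := wirt_cst s (1 : R[i]) (0 : R[i]) (0 : R[i]).
  rewrite (wirt_near _ _ zero (derivable_cst _ _)) (wirt_sum _ _ _ dprod) => h.
  apply: etrans h; apply: eq_bigr => w _.
  rewrite (wirtM _ _ (derivable_conj (dtau w)) (dbb w)); apply/esym.
  by apply: drop_first_term; rewrite /= [beta 0]ez; exact: line.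
have [u u0 hu] : exists2 u : R[i], u != 0 & forall w,
    wirt s (1 : R[i]) (bb w \o beta) 0 = wirt s (evec 0) (bb w) z * u.
  case: hs => ->.
    exists (Num.conj (tau 0 0)); first by rewrite conjC_eq0.
    move=> w; rewrite -!delbarE (delbar_comp (bC1 w) dbeta hbeta) sum_I2 [beta 0]ez.
    have := bt 'i%C w; rewrite -delbarE => b1.
    exact: drop_second_term b1.
  exists (tau 0 0) => //.
  move=> w; rewrite -!delE (del_comp (bC1 w) dbeta hbeta) sum_I2 [beta 0]ez.
  have := bt (- 'i%C) w; rewrite -delE => b1.
  exact: drop_second_term b1.
apply: (mulIf u0); rewrite mul0r mulr_suml.
apply: (etrans _ (etrans (congr1 (fun x => s1 * x) e0) (mulr0 s1))) => /=.
by rewrite mulr_sumr; apply: eq_bigr => w _; rewrite hs1 hu !mulrA.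
Qed.

End AdaptedFrame.

(** * Local boundedness and the points off the divisor *)

Section LocalMatrixBounds.
Context {R : realType} {V : normedModType R[i]} (S : set V) (z0 : V).

Definition lbd_mx {p q} (F : V -> 'M[R[i]]_(p, q)) := forall i j, lbd S z0 (fun z => F z i j).

Lemma lbd_mxM p q r (F : V -> 'M[R[i]]_(p, q)) (G : V -> 'M[R[i]]_(q, r)) :
  lbd_mx F -> lbd_mx G -> lbd_mx (fun z => F z *m G z).
Proof.
move=> hF hG i j.
apply: (@lbd_eq_on _ _ _ _ _ (fun z => \sum_k F z i k * G z k j)) => [z _|].
  by rewrite mxE.
by apply: lbd_sum => k; exact: lbdM.
Qed.

Lemma lbd_mxJ p q (F : V -> 'M[R[i]]_(p, q)) : lbd_mx F -> lbd_mx (fun z => (F z)^t*).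
Proof.
move=> hF i j; apply: (@lbd_eq_on _ _ _ _ _ (fun z => Num.conj (F z j i))) => [z _|].
  by rewrite !mxE.
exact: lbdJ.
Qed.

Lemma lbd_mx_Cn p q n A (F : V -> 'M[R[i]]_(p, q)) : A z0 -> class_Cn_mx n A F -> lbd_mx F.
Proof. by move=> Az h i j; apply: lbd_continuous; exact: Cn_continuous (h i j) Az. Qed.

End LocalMatrixBounds.

Section Metric.
Context {R : realType} {X : surface R} (g : hermitian_metric X).

Definition inv_metric (c : chart R X) (z : 'rV[R[i]]_2) := invmx (gmat g c (cinv c z)).

Lemma inv_metric_Cn n c W : atlas c -> open W -> class_Cn_mx n (cimg c (cdom c `&` W)) (inv_metric c).
Proof.
move=> ac oW; have sub : cimg c (cdom c `&` W) `<=` cimg c (cdom c).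
  by move=> _ [x [cx _] <-]; exact: cimg_mem.
apply: Cn_mx_sub sub _; apply: Cn_invmx.
- by apply: (cimg_open ac); have [[]] := atlas_chart ac.
- apply: smooth_Cn_mx => i j; exact: (gmat_smooth g ac i j ac).
- by move=> z /(cimgP ac) [cz _ _]; apply: posdef_unit; exact: gmat_posdef.
Qed.

Lemma inv_metric_herm c z : atlas c -> cdom c (cinv c z) -> (inv_metric c z)^t* = inv_metric c z.
Proof.
by move=> ac cz; rewrite /inv_metric adjmx_inv; have [-> _] := gmat_posdef g ac cz.
Qed.

End Metric.

Section DivisorEquation.
Context {R : realType} {X : surface R} {m r : nat} {D : 'I_m -> set X}
  {E : hol_bundle X r} {g : hermitian_metric X} {P : parabolic D E}.
Variables (K : Hpar_data g P) (i : 'I_m) (c : chart R X) (W : set X) (eL : X -> 'M[R[i]]_1).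
Hypotheses (ac : atlas c) (heL : hframe (odiv K i) W eL).

Definition div_eq (z : 'rV[R[i]]_2) : R[i] :=
  (csec K i (cinv c z) *m invmx (eL (cinv c z))) 0 0.
Definition div_metric (z : 'rV[R[i]]_2) : R[i] :=
  gram eL (odiv_metric K i) (cinv c z) 0 0.

Lemma div_eq_Cn n : class_Cn n (cimg c W) div_eq.
Proof. by have [h _ _] := csec_canonical heL; exact: holo_Cn (h c ac). Qed.

Lemma div_eq_holo z v : cimg c W z -> delbar v div_eq z = 0.
Proof. by move=> Wz; have [h _ _] := csec_canonical heL; have [_ ->] := h c ac. Qed.

Lemma div_eq0 z : cimg c W z -> (D i (cinv c z) <-> div_eq z = 0).
Proof. by move=> /(cimgP ac) [_ Wz _]; have [_ h _] := csec_canonical heL; exact: h. Qed.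

Lemma div_metric_Cn n : class_Cn n (cimg c W) div_metric.
Proof.
have [_ /(_ W eL heL 0 0 c ac) h] := odiv_metricP K i.
apply: Cn_sub (smooth_Cn n h) => _ [x [cx Wx] <-]; exact: cimg_mem.
Qed.

Lemma div_metric_gt0 z : cimg c W z -> 0 < div_metric z.
Proof.
move=> /(cimgP ac) [_ Wz _]; have [/(_ (cinv c z) I) [_ pos] _] := odiv_metricP K i.
have U := hframe_unit heL Wz.
have n0 : row 0 (eL (cinv c z)) != 0.
  apply/eqP => z0; have e0 : eL (cinv c z) = 0.
    by apply/row_matrixP => j; rewrite ord1 z0 row0.
  by move: U; rewrite e0 unitmxE det0 unitr0.
by have := pos _ n0; rewrite /herm row_sandwich.
Qed.

(** [sqnorm] is the square of the norm, whence the halved exponent. *)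
Lemma signorm_powR x a : cdom c x -> W x ->
  signorm K i x `^ (2 * a) = sqnorm div_eq div_metric (cmap c x) `^ a.
Proof.
move=> cx Wx.
have Wz : cimg c W (cmap c x) by exact: cimg_mem.
have e : complex.Re (herm (odiv_metric K i x) (csec K i x) (csec K i x)) =
   sqnorm div_eq div_metric (cmap c x).
  rewrite /sqnorm /div_eq /div_metric (cmapK ac cx); congr complex.Re.
  have U := hframe_unit heL Wx.
  have Us : (eL x)^t* \in unitmx by rewrite adjmx_unit.
  rewrite /herm -(pairing_change _ _ _ U Us) -adjmx_inv -adjmxM -/(gram _ _ x).
  set s := csec K i x *m invmx (eL x); set G := gram eL _ x.
  rewrite [LHS]mxE big_ord1 [X in X * _]mxE big_ord1 [(s^t*) _ _]mxE [(s^T) _ _]mxE.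
  by rewrite mulrAC mulrC mulrA.
rewrite /signorm /section_norm e.
have u0 := sqnorm_ge0 div_eq div_metric_gt0 Wz.
by rewrite powRrM powR_mulrn ?sqrtr_ge0 // sqr_sqrtr.
Qed.

End DivisorEquation.

Section LocallyBounded.
Context {R : realType} {X : surface R} {m r : nat} {D : 'I_m -> set X}
  {E : hol_bundle X r} {g : hermitian_metric X} {P : parabolic D E}.
Variable (K : Hpar_data g P).

(** One chart and one frame are enough, by [endo_norm_Lambda_curv]. *)
Definition locally_bounded_curv (x0 : X) : Prop :=
  exists c W e O (B0 : R), [/\ atlas c, hframe E W e, nbhs x0 O,
    O `<=` cdom c `&` W & forall y, O y -> ~ Dsupp (D := D) y ->
      endo_norm (gram e (Hpar K) y) (Lambda_curv g c e (Hpar K) y) <= B0].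

Lemma locally_bounded_chart x0 c W e (S : set 'rV[R[i]]_2) :
  atlas c -> hframe E W e -> cdom c x0 -> W x0 ->
  (\forall y \near x0, ~ Dsupp (D := D) y -> S (cmap c y)) ->
  (exists B0 : R, \forall z \near cmap c x0, S z ->
    endo_norm ((gram e (Hpar K) \o cinv c) z)
    (- 'i%C *: \sum_(k < 2) \sum_(l < 2)
       inv_metric g c z l k *: chern_curv (evec k) (evec l) (gram e (Hpar K) \o cinv c) z) <= B0) ->
  locally_bounded_curv x0.
Proof.
move=> ac he cx Wx hS [B0 hB].
have [[oc _] _ hc _] := atlas_chart ac.
have n1 : nbhs x0 (cdom c `&` W).
  by apply: filterI; apply: open_nbhs_nbhs; split => //; exact: hframe_open he.
have n2 := hc x0 cx _ hB.
pose O := [set y | (cdom c `&` W) y /\ (~ Dsupp (D := D) y -> S (cmap c y)) /\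
   (S (cmap c y) -> endo_norm (gram e (Hpar K) y) (Lambda_curv g c e (Hpar K) y) <= B0)].
exists c, W, e, O, B0; split; [exact: ac | exact: he | | |].
- apply: filterS2 n1 (filterI hS n2) => y cWy [h1 h2]; split; first exact: cWy.
  split; first exact: h1.
  move=> Sy.
  pose F z x := endo_norm (gram e (Hpar K) x) (- 'i%C *: \sum_(k < 2) \sum_(l < 2)
    (invmx (gmat g c x)) l k *: chern_curv (evec k) (evec l) (gram e (Hpar K) \o cinv c) z).
  have h : F (cmap c y) (cinv c (cmap c y)) <= B0 := h2 Sy.
  exact: (eq_ind _ (fun x => F (cmap c y) x <= B0) h _ (cmapK ac (proj1 cWy))).
- by move=> y [].
by move=> y [_ [h1 h2]] /h1 /h2.
Qed.

Lemma Dsupp_closed : (forall i, closed (D i)) -> closed (Dsupp (D := D)).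
Proof.
by move=> h; rewrite /Dsupp; apply: closed_bigcup => [|i _]; [exact: finite_finset | exact: h].
Qed.

Lemma locally_bounded_off x0 : (forall i, closed (D i)) -> ~ Dsupp (D := D) x0 ->
  locally_bounded_curv x0.
Proof.
move=> cD nD; have [c ac cx] := atlas_cover x0.
have [W [e [he Wx]]] := hframe_cover E x0.
pose M := ~` Dsupp (D := D).
have oM : open M by exact: closed_openC (Dsupp_closed cD).
have [[oc _] _ _ _] := atlas_chart ac.
have oW := hframe_open he.
pose A := cimg c (cdom c `&` (M `&` W)).
have oA : open A by apply: (cimg_open ac); apply: openI oc (openI oM oW).
have Ax : A (cmap c x0) by exact: cimg_mem.
apply: (locally_bounded_chart ac he cx Wx (S := setT)); first by apply: nearW.
apply: lbd_endo_norm.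
have GC n : class_Cn_mx n A (gram e (Hpar K) \o cinv c).
  apply: Cn_mx_sub (gram_Cn (Hpar_metric K) n ac he) => _ [y [cy [_ MWy]] <-].
  exact: cimg_mem.
have GU z : A z -> (gram e (Hpar K) \o cinv c) z \in unitmx.
  move=> /(cimgP ac) [_ [_ [Mz Wz]] _].
  have h := gram_unit (Hpar_metric K) he Wz Mz; exact: h.
have bG := lbd_mx_Cn setT Ax (GC 0%N).
have bGI := lbd_mx_Cn setT Ax (Cn_invmx oA (GC 0%N) GU).
have bh := lbd_mx_Cn setT Ax (inv_metric_Cn g 0 ac (openI oM oW)).
have bC k l : lbd_mx setT (cmap c x0) (chern_curv (evec k) (evec l) (gram e (Hpar K) \o cinv c)).
  have h := Cn_chern_conn (evec k) oA (GC 2) GU.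
  move=> a b; apply: (@lbd_eq_on _ _ _ _ _ (fun z =>
    - delbar (evec l) (fun w => chern_conn (evec k) (gram e (Hpar K) \o cinv c) w a b) z)).
    by move=> z _; rewrite /chern_curv !mxE.
  apply: lbdN; apply: lbd_continuous.
  exact: Cn_continuous (Cn_delbar (evec l) oA (h a b)) Ax.
set MM := (X in lbd _ _ X).
pose T z : 'M[R[i]]_r := - 'i%C *: \sum_(k < 2) \sum_(l < 2)
  inv_metric g c z l k *: chern_curv (evec k) (evec l) (gram e (Hpar K) \o cinv c) z.
have bT : lbd_mx setT (cmap c x0) T.
  move=> a b; apply: (@lbd_eq_on _ _ _ _ _ (fun z => - 'i%C * \sum_(k < 2) \sum_(l < 2)
    inv_metric g c z l k * chern_curv (evec k) (evec l) (gram e (Hpar K) \o cinv c) z a b)).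
    move=> z _; rewrite mxE summxE; congr (_ * _); apply: eq_bigr => k _.
    by rewrite summxE; apply: eq_bigr => l _; rewrite mxE.
  apply: lbdM; first exact: lbd_cst.
  by do 2! apply: lbd_sum => ?; apply: lbdM; [exact: bh | exact: bC].
rewrite /MM /mxtrace; apply: lbd_sum => k.
have := lbd_mxM bT (lbd_mxM (lbd_mxM bG (lbd_mxJ bT)) bGI).
exact.
Qed.

End LocallyBounded.

(** * The crossing points *)

Section Crossing.
Context {R : realType} {X : surface R} {m r : nat} {D : 'I_m -> set X}
  {E : hol_bundle X r} {g : hermitian_metric X} {P : parabolic D E}.
Variable (K : Hpar_data g P).

Lemma locally_bounded_crossing i j x0 : (forall i, closed (D i)) ->
  i != j -> D i x0 -> D j x0 -> locally_bounded_curv K x0.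
Proof.
move=> cD ij Di Dj; have [c ac cx] := atlas_cover x0.
have he := fr_hol K ij; set W := nb K i `&` nb K j in he.
have Wx : W x0 by split; exact: divisor_nb.
have [W1 [e1 [he1 Wx1]]] := hframe_cover (odiv K i) x0.
have [W2 [e2 [he2 Wx2]]] := hframe_cover (odiv K j) x0.
have [[oc _] _ _ _] := atlas_chart ac.
have oW := hframe_open he; have oW1 := hframe_open he1; have oW2 := hframe_open he2.
pose O := W `&` (W1 `&` W2).
have oO : open O by apply: openI oW (openI oW1 oW2).
pose A := cimg c (cdom c `&` O).
have oA : open A by apply: (cimg_open ac); exact: openI.
have Ax : A (cmap c x0) by exact: cimg_mem.
pose M := ~` Dsupp (D := D).
have oM : open M by exact: closed_openC (Dsupp_closed cD).
pose S := cimg c ((cdom c `&` O) `&` M).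
have oS : open S by apply: (cimg_open ac); exact: openI (openI oc oO) oM.
have SA : S `<=` A by move=> _ [x [cy [Ox _]] <-]; exact: cimg_mem.
have AW z : A z -> cimg c W z by move=> [x [cy [_ [h _]]] <-]; exact: cimg_mem.
have AW1 z : A z -> cimg c W1 z by move=> [x [cy [_ [_ [h _]]]] <-]; exact: cimg_mem.
have AW2 z : A z -> cimg c W2 z by move=> [x [cy [_ [_ [_ h]]]] <-]; exact: cimg_mem.
pose gam k z := (cfac K i j k (cinv c z))%:C : R[i].
have gamC k : class_Cn 3 A (gam k).
  have [W' [_ sW' sm _]] := cfacP K k ij.
  apply: Cn_sub (smooth_Cn 3 (sm c ac)) => _ [x [cy [_ [Wy _]]] <-].
  by apply: cimg_mem => //; apply: sW'; exact: subset_closure.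
have gam_gt0 k z : A z -> 0 < gam k z.
  have [W' [_ sW' _ pos]] := cfacP K k ij.
  move=> /(cimgP ac) [_ [_ [Wy _]] _].
  by rewrite /gam ltcR; apply: pos; apply: sW'; exact: subset_closure.
apply: (locally_bounded_chart ac he cx Wx (S := S)).
  have n1 : nbhs x0 (cdom c `&` O) by exact: (open_nbhs_nbhs (conj (openI oc oO) (conj cx (conj Wx (conj Wx1 Wx2))))).
  by apply: filterS n1 => y [cy Oy] ny; exact: cimg_mem.
apply: (@crossing_bound R r A S (cmap c x0) oA Ax oS SA gam (div_eq K i c e1) (div_metric K i c e1)
  (div_eq K j c e2) (div_metric K j c e2) (inv_metric g c) (alpha K i j) (alpha K j i)).
- exact: gamC.
- exact: gam_gt0.
- exact: Cn_sub AW1 (div_eq_Cn ac he1 3).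
- by move=> z /AW1 Az v; exact: (div_eq_holo ac he1 v Az).
- exact: Cn_sub AW2 (div_eq_Cn ac he2 3).
- by move=> z /AW2 Az v; exact: (div_eq_holo ac he2 v Az).
- move=> z Sz; apply/eqP => /(div_eq0 ac he1 (AW1 _ (SA _ Sz))) Dz.
  by have [_ [_ Mz] _] := cimgP ac Sz; apply: Mz; exists i.
- move=> z Sz; apply/eqP => /(div_eq0 ac he2 (AW2 _ (SA _ Sz))) Dz.
  by have [_ [_ Mz] _] := cimgP ac Sz; apply: Mz; exists j.
- exact: Cn_sub AW1 (div_metric_Cn ac he1 3).
- by move=> z /AW1; exact: div_metric_gt0.
- exact: Cn_sub AW2 (div_metric_Cn ac he2 3).
- by move=> z /AW2; exact: div_metric_gt0.
- exact: inv_metric_Cn.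
- by move=> z /(cimgP ac) [cz _ _]; exact: inv_metric_herm.
move=> z Sz; have [cz [[_ [[Wi Wj] [W1z W2z]]] Mz] ez] := cimgP ac Sz.
rewrite /= (Hpar_crossing ij Wi Wj Mz); congr diag_mx; apply/rowP => k.
rewrite !mxE (signorm_powR ac he1 _ cz W1z) (signorm_powR ac he2 _ cz W2z) ez.
by rewrite rmorphM rmorphM.
Qed.

End Crossing.

(** * The points on a single component *)

Lemma congruence_solve (F : pzRingType) n (B A G Bs As : 'M[F]_n) :
  B *m A = 1%:M -> As *m Bs = 1%:M -> B *m (A *m G *m As) *m Bs = G.
Proof. by move=> h1 h2; rewrite -!mulmxA h2 mulmx1 mulmxA h1 mul1mx. Qed.

Lemma adjmx1 (R : realType) n : (1%:M : 'M[R[i]]_n)^t* = 1%:M.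
Proof. by rewrite trmx1 map_mx1. Qed.

Section Single.
Context {R : realType} {X : surface R} {m r : nat} {D : 'I_m -> set X}
  {E : hol_bundle X r} {g : hermitian_metric X} {P : parabolic D E}.
Variables (K : Hpar_data g P) (i : 'I_m).

(** The summands [Q_s] are orthogonal for this metric by construction, and inside a
summand the frame was chosen orthogonal. *)
Lemma Hpar_adapted W q t x : (forall k : 'I_r, (t k < plen P i)%N) ->
  W `<=` nb K i `\` Dother (D := D) i -> W x -> ~ D i x ->
  (forall k, (row k (q x) <= Q K i (t k) x)%MS) ->
  (forall k l, k != l -> t k = t l ->
     herm (G K i (t k) x) (row k (q x)) (row l (q x)) = 0) ->
  gram q (Hpar K) x = diag_mx (\row_k
    (herm (G K i (t k) x) (row k (q x)) (row k (q x)) *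
      (signorm K i x `^ (2 * weight P i (t k)))%:C)).
Proof.
move=> tlt WN Wx nDx hQ h0.
have [nx no] := WN _ Wx.
have ns : ~ Dsupp (D := D) x.
  move=> [l _ Dl]; have [e|ne] := eqVneq l i; first by apply: nDx; rewrite -e.
  by apply: no; exists l.
apply/matrixP => k l; rewrite /gram -row_sandwich -/(herm _ _ _).
rewrite (Hpar_sum (tlt k) (tlt l) nx ns (hQ k) (hQ l)) [RHS]mxE [X in _ = X *+ _]mxE.
have [<-|kl] := eqVneq k l; first by rewrite eqxx mulr1n mulrC.
rewrite mulr0n; case: eqP => // tkl.
by rewrite h0 // mulr0.
Qed.

Lemma locally_bounded_single x0 : (forall i, closed (D i)) ->
  (forall x, D i x -> exists c, [/\ atlas c, cdom c x & is_coord_line c (D i) 0]) ->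
  D i x0 -> ~ Dother (D := D) i x0 -> locally_bounded_curv K x0.
Proof.
move=> cD smD Dx nO; have [c [ac cx cline]] := smD _ Dx.
have [W [q [t [[oW Wx] WN hq tlt hy]]]] := G_H1 (conj (divisor_nb K Dx) nO).
have gramq y (Wy : W y) : gram q (H1 K) y = 1%:M by have [] := hy y Wy.
have Qrow y (Wy : W y) : forall k, (row k (q y) <= Q K i (t k) y)%MS by have [] := hy y Wy.
have Goff y (Wy : W y) := let: And3 _ _ h := hy y Wy in h.
have [We [e [he Wex]]] := hframe_cover E x0.
have [WL [eL [heL WLx]]] := hframe_cover (odiv K i) x0.
have oWL := hframe_open heL.
set N := adapted_nbhd W c We.
have oN : open N by exact: (adapted_open oW ac he).
have Nx : N x0 by [].
pose O := N `&` WL; have oO : open O by exact: openI.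
pose A := cimg c O; have oA : open A by exact: cimg_open.
have Ax : A (cmap c x0) by exact: cimg_mem.
have oM : open (~` D i) by exact: closed_openC.
pose S := cimg c (O `&` ~` D i).
have oS : open S by apply: (cimg_open ac); exact: openI.
have SA : S `<=` A by move=> _ [x [cy [Oy _]] <-]; exact: cimg_mem.
have AN : A `<=` cimg c N by move=> _ [x [cy [h _]] <-]; exact: cimg_mem.
have AW : A `<=` cimg c W by move=> _ [x [cy [[h _] _]] <-]; exact: cimg_mem.
have AL : A `<=` cimg c WL by move=> _ [x [cy [_ h]] <-]; exact: cimg_mem.
pose gam k z : R[i] := herm (G K i (t k) (cinv c z)) (row k (q (cinv c z))) (row k (q (cinv c z))).
have gamC k : class_Cn 3 A (gam k).
  have [_ _ sm] := G_metric K (tlt k).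
  have hs : smooth_section E W (fun x => row k (q x)) by have [_ h] := hq; exact: h.
  have h := sm W _ _ oW WN hs hs (fun x Wx => conj (Qrow x Wx k) (Qrow x Wx k)).
  exact: Cn_sub AW (smooth_Cn 3 (h c ac)).
have gam_gt0 k z : A z -> 0 < gam k z.
  move=> /(cimgP ac) [_ [[Wz _] _] _]; have [_ pos _] := G_metric K (tlt k).
  apply: pos; [exact: WN | exact: Qrow |].
  have [U _] := hq; move: (U _ Wz); rewrite -row_free_unit => /row_freeP[C hC].
  apply/eqP => r0; have := congr1 (fun M : 'M[R[i]]_r => M k k) hC.
  rewrite mxE [RHS]mxE eqxx big1 => [/eqP|j _]; first by rewrite eq_sym oner_eq0.
  have := congr1 (fun M : 'rV[R[i]]_r => M 0 j) r0; rewrite mxE [RHS]mxE => ->.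
  exact: mul0r.
pose a k := weight P i (t k).
have lineD z : A z -> z 0 0 = 0 -> D i (cinv c z).
  by move=> /(cimgP ac) [cz _ ez] z0; apply/(cline _ cz); rewrite ez.
apply: (locally_bounded_chart ac he cx Wex (S := S)).
  have n1 : nbhs x0 O by exact: (open_nbhs_nbhs (conj oO (conj Nx WLx))).
  apply: filterS n1 => y Oy ny; have [[_ [cy _]] _] := Oy.
  by apply: cimg_mem => //; split=> // Dy; apply: ny; exists i.
apply: (@single_divisor_bound R r A S (cmap c x0) oA Ax _ oS SA (change_coord K q c e) gam
  (div_eq K i c eL) (div_metric K i c eL) (inv_metric g c) a t).
- exact/(cline _ cx).
- exact: Cn_mx_sub AN (change_coord_Cn oW WN hq ac he 3).
- by move=> z /AN; exact: (change_coord_unit gramq ac he).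
- exact: gamC.
- exact: gam_gt0.
- exact: Cn_sub AL (div_eq_Cn ac heL 3).
- by move=> z /AL Az v; exact: (div_eq_holo ac heL v Az).
- by move=> z Az z0; apply/(div_eq0 ac heL (AL _ Az)); exact: lineD.
- have [_ _ h] := csec_canonical heL; have [k hk] := h c x0 ac cx WLx Dx.
  by exists k; exact: hk.
- move=> z Sz; apply/eqP => /(div_eq0 ac heL (AL _ (SA _ Sz))) Dz.
  by have [_ [_ nD] _] := cimgP ac Sz; exact: nD.
- exact: Cn_sub AL (div_metric_Cn ac heL 3).
- by move=> z /AL; exact: div_metric_gt0.
- apply: Cn_mx_sub (inv_metric_Cn g 2 ac oO) => _ [x [cy Oy] <-].
  exact: cimg_mem.
- by move=> z /(cimgP ac) [cz _ _]; exact: inv_metric_herm.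
- by move=> k; exact: weight_ge0.
- by move=> k; exact: weight_lt1.
- by move=> k l h; apply: weight_incr; rewrite h tlt.
- by move=> k l h; rewrite /a h.
- move=> k l z /AN Az z0 kl.
  exact: (frame_dbar_normal oW WN hq tlt gramq Qrow ac cline he Az z0 kl).
- move=> k l w z /AN Az z0 kl.
  exact: (frame_dbar_line oW WN hq tlt gramq Qrow ac cline he w Az z0 kl).
- move=> k l s z hs /AN Az z0 kl.
  exact: (wirt_frame_dbar_normal oW WN hq tlt gramq Qrow ac cline he hs Az z0 kl).
move=> z Sz; have [cz [[[Wz [_ Wez]] WLz] nD] ez] := cimgP ac Sz.
have hB := change_coordV gramq ac he (AN _ (SA _ Sz)).
have hBs : (frame_coord q c e z)^t* *m (change_coord K q c e z)^t* = 1%:M.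
  by have := congr1 (fun M => M^t*) (mulmx1C hB); rewrite adjmxM adjmx1.
have := congruence_solve (gram e (Hpar K) (cinv c z)) (mulmx1C hB) hBs.
have U := hframe_unit he Wez.
have Us : (e (cinv c z))^t* \in unitmx by rewrite adjmx_unit.
have eq1 : frame_coord q c e z *m gram e (Hpar K) (cinv c z) *m (frame_coord q c e z)^t* =
    gram q (Hpar K) (cinv c z).
  by rewrite /frame_coord adjmxM adjmx_inv /gram (frame_product _ _ _ U Us).
rewrite eq1 (Hpar_adapted tlt WN Wz nD (Qrow _ Wz) (Goff _ Wz)).
have -> : \row_k (herm (G K i (t k) (cinv c z)) (row k (q (cinv c z))) (row k (q (cinv c z))) *
      (signorm K i (cinv c z) `^ (2 * weight P i (t k)))%:C) =
   \row_k (gam k z * (sqnorm (div_eq K i c eL) (div_metric K i c eL) z `^ a k)%:C).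
  by apply/rowP => k; rewrite !mxE (signorm_powR ac heL _ cz WLz) ez.
by move=> h; exact: (esym h).
Qed.

End Single.

(** * The global bound *)

Theorem proposition2p10 (R : realType) (X : surface R)
    (g : hermitian_metric X) (m r : nat) (D : 'I_m -> set X)
    (E : hol_bundle X r) (P : parabolic D E) (K : Hpar_data g P) :
  compact [set: X] -> gauduchon g -> snc D ->
  exists B : R, forall x : X, ~ Dsupp (D := D) x ->
    forall (c : chart R X) (W : set X) (e : X -> 'M[R[i]]_r),
      atlas c -> cdom c x -> hframe E W e -> W x ->
      endo_norm (gram e (Hpar K) x) (Lambda_curv g c e (Hpar K) x) <= B.
Proof.
move=> cX _ sD; have cD := snc_closed sD.
have oM : open (~` Dsupp (D := D)) by exact: closed_openC (Dsupp_closed cD).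
have loc x0 : locally_bounded_curv K x0.
  have [[i _ Dx]|nD] := pselect (Dsupp (D := D) x0); last exact: locally_bounded_off.
  have [[j /= ji Dj]|nO] := pselect (Dother (D := D) i x0).
    by apply: (locally_bounded_crossing K cD _ Dj Dx).
  exact: locally_bounded_single cD (snc_smooth sD (i := i)) Dx nO.
pose Bd (x : X) (B : R) := ~ Dsupp (D := D) x ->
    forall (c : chart R X) (W : set X) (e : X -> 'M[R[i]]_r),
      atlas c -> cdom c x -> hframe E W e -> W x ->
      endo_norm (gram e (Hpar K) x) (Lambda_curv g c e (Hpar K) x) <= B.
have FF : Filter (pinfty_nbhs R) by apply: filter_filter.
have h x0 : [set: X] x0 -> \forall x \near x0 & B \near pinfty_nbhs R, Bd x B.
  move=> _; have [c [W [e [V [B0 [ac he nO sub bd]]]]]] := loc x0.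
  exists (V, [set B | B0 <= B]).
    by split=> //=; apply: nbhs_pinfty_ge; exact: num_real.
  move=> [y B] [/= Oy B0B] ny c' W' e' ac' cy' he' Wy'.
  have [cy Wy] := sub _ Oy.
  rewrite (endo_norm_Lambda_curv g oM (Hpar_metric K) ac' cy' ac cy ny he' Wy' he Wy).
  by apply: le_trans B0B; exact: bd.
have /compact_near_coveringP/(_ _ _ (fun B x => Bd x B) FF h) nB := cX.
by have [B hB] := filter_ex nB; exists B => x; exact: hB.
Qed.
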